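(* Let $Q$ be a finite quiver with $n$ vertices and without oriented cycles, let $(\dim S_1,\dots,\dim S_t)$ be a perpendicular sequence of real Schur roots, where $S_1,\dots,S_t$ are Schur indecomposable representations of $Q$ (i.e. $\mathrm{End}(S_i)=\mathbf{k}$), and let $W=m_1S_1+\cdots+m_tS_t$ (direct sum with positive multiplicities). Consider the following procedure. Start with $\alpha_1,\dots,\alpha_n$ equal to the dimension vectors of the $n$ simple representations of $Q$. For $i=1,\dots,t$ do: (1) given the current dimension vectors $\alpha_1,\dots,\alpha_{n+1-i}$, form the quiver $\Sigma_i$ with vertices $1,\dots,n+1-i$ and $\delta_{kl}-\langle\alpha_k,\alpha_l\rangle$ arrows from $k$ to $l$; (2) expand $\dim S_i$ as a linear combination of $\alpha_1,\dots,\alpha_{n+1-i}$; the coefficients give a dimension vector $\gamma_i$ of $\Sigma_i$; (3) find the dimension vectors $\overline{\alpha_1},\dots,\overline{\alpha_{n-i}}$ of the simple objects of the right perpendicular category, in the category of representations of $\Sigma_i$, of the generic representation of $\Sigma_i$ of dimension $\gamma_i$; (4) define the new $\alpha_1,\dots,\alpha_{n-i}$ as the linear combinations of the old $\alpha_1,\dots,\alpha_{n+1-i}$ with coefficients given by $\overline{\alpha_1},\dots,\overline{\alpha_{n-i}}$ respectively. After the last step return $\alpha_1,\dots,\alpha_{n-t}$. Then this procedure is correct: the returned $\alpha_1,\dots,\alpha_{n-t}$ are the dimension vectors of the simple objects (up to isomorphism) of $W^{\perp}$.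
   Context: $\mathbf{k}$ is an algebraically closed field of characteristic $0$. A finite quiver $Q$ has vertex set $Q_0$ and arrow set $Q_1$; an arrow $\varphi$ goes from its tail $t\varphi$ to its head $h\varphi$. For $\alpha\in\mathbb{Z}_{\ge 0}^{Q_0}$ put $R(Q,\alpha)=\bigoplus_{\varphi\in Q_1}\mathrm{Hom}(\mathbf{k}^{\alpha_{t\varphi}},\mathbf{k}^{\alpha_{h\varphi}})$, with the action of $GL(\alpha)=\prod_{a}GL(\alpha_a)$ by $(gV)(\varphi)=g(h\varphi)V(\varphi)g(t\varphi)^{-1}$. $\mathrm{Hom}$ and $\mathrm{Ext}=\mathrm{Ext}^1$ are taken in the category of representations over $\mathbf{k}$. ''Generic'' means belonging to a suitable non-empty Zariski open subset. The Euler form is $\langle\alpha,\beta\rangle=\sum_{a\in Q_0}\alpha_a\beta_a-\sum_{\varphi\in Q_1}\alpha_{t\varphi}\beta_{h\varphi}$, and $q_Q(\alpha)=\langle\alpha,\alpha\rangle$. A dimension vector $\alpha$ is a Schur root if a generic element of $R(Q,\alpha)$ is indecomposable; a Schur root is real if $q_Q(\alpha)=1$ (then $R(Q,\alpha)$ has a dense orbit). Write $\alpha\perp\beta$ if $\mathrm{Hom}(A,B)=0=\mathrm{Ext}(A,B)$ for generic $A\in R(Q,\alpha)$, $B\in R(Q,\beta)$. A sequence $(\alpha_1,\dots,\alpha_s)$ is perpendicular if all $\alpha_i$ are Schur roots and $\alpha_i\perp\alpha_j$ for all $i<j$. For a representation $W$, the right perpendicular category $W^{\perp}$ is the full subcategory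 of representations $V$ with $\mathrm{Hom}(W,V)=0$ and $\mathrm{Ext}(W,V)=0$; it is an abelian subcategory closed under extensions. *)

(* Defs.v *)
From HB Require Import structures.
From mathcomp Require Import all_boot all_order all_algebra.
From mathcomp Require Import mpoly.

Set Implicit Arguments.
Unset Strict Implicit.
Unset Printing Implicit Defensive.

Import GRing.Theory.
Local Open Scope ring_scope.

Record quiver := Quiver {
  Q0 : finType;
  Q1 : finType;
  tl : Q1 -> Q0;
  hd : Q1 -> Q0 }.

Definition adj (Q : quiver) : rel (Q0 Q) :=
  fun a b => [exists phi : Q1 Q, (tl phi == a) && (hd phi == b)].

(* [cycle e [:: x]] means [e x x], so loops are excluded as well. *)
Definition acyclic (Q : quiver) : Prop :=
  forall c : seq (Q0 Q), cycle (@adj Q) c -> c = [::].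

Definition dimvec (Q : quiver) := Q0 Q -> nat.

Definition euler (Q : quiver) (al be : dimvec Q) : int :=
  \sum_(a : Q0 Q) (al a * be a)%N%:Z
  - \sum_(phi : Q1 Q) (al (tl phi) * be (hd phi))%N%:Z.

Section Representations.
Variable k : closedFieldType.

Section FixedQuiver.
Variable Q : quiver.

(* Vectors are columns: an arrow acts by multiplication on the left. *)
Definition repSpace (al : dimvec Q) : Type :=
  forall phi : Q1 Q, 'M[k]_(al (hd phi), al (tl phi)).

Record rep := Rep { repdim : dimvec Q; arr : repSpace repdim }.

Definition zero_rep : rep := @Rep (fun _ => 0%N) (fun _ => 0).

Definition dsum (A B : rep) : rep :=
  @Rep (fun a => repdim A a + repdim B a)%N
       (fun phi => block_mx (arr A phi) 0 0 (arr B phi)).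

Definition multiple (m : nat) (A : rep) : rep := iter m (dsum A) zero_rep.

Definition is_zero (A : rep) : Prop := forall a, repdim A a = 0%N.

Definition fam (A B : rep) : Type :=
  forall a : Q0 Q, 'M[k]_(repdim B a, repdim A a).

Definition is_hom (A B : rep) (f : fam A B) : Prop :=
  forall phi : Q1 Q, f (hd phi) *m arr A phi = arr B phi *m f (tl phi).

Definition is_inverse (A B : rep) (f : fam A B) (g : fam B A) : Prop :=
  forall a, g a *m f a = 1%:M /\ f a *m g a = 1%:M.

Definition is_iso (A B : rep) (f : fam A B) : Prop :=
  is_hom f /\ exists g : fam B A, is_hom g /\ is_inverse f g.

Definition isomorphic (A B : rep) : Prop := exists f : fam A B, is_iso f.

Definition hom_vanishes (A B : rep) : Prop :=
  forall f : fam A B, is_hom f -> forall a, f a = 0.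

Definition short_exact (B E A : rep) (i : fam B E) (p : fam E A) : Prop :=
  [/\ is_hom i, is_hom p,
      forall a, injective (fun v : 'cV[k]_(repdim B a) => i a *m v),
      forall a (w : 'cV[k]_(repdim A a)),
        exists v : 'cV[k]_(repdim E a), p a *m v = w
    & forall a (v : 'cV[k]_(repdim E a)),
        p a *m v = 0 <-> exists u : 'cV[k]_(repdim B a), i a *m u = v].

(* Ext^1(A, B) as the group of Yoneda extensions of A by B, whose zero is the
   class of the split extension. *)
Definition ext_vanishes (A B : rep) : Prop :=
  forall (E : rep) (i : fam B E) (p : fam E A), short_exact i p ->
  exists s : fam A E, is_hom s /\ forall a, p a *m s a = 1%:M.

(* The full subcategory of representations satisfying this predicate. *)
Definition rperp (W : rep) : rep -> Prop :=
  fun V => hom_vanishes W V /\ ext_vanishes W V.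

Definition mono_in (C : rep -> Prop) (U V : rep) (f : fam U V) : Prop :=
  forall (X : rep) (g h : fam X U), C X -> is_hom g -> is_hom h ->
  (forall a, f a *m g a = f a *m h a) -> forall a, g a = h a.

(* Subobjects are taken inside the full subcategory [C], so [V] need not be
   simple as a representation. *)
Definition simple_in (C : rep -> Prop) (V : rep) : Prop :=
  [/\ C V, ~ is_zero V
    & forall (U : rep) (f : fam U V), C U -> is_hom f -> mono_in C f ->
      is_zero U \/ is_iso f].

(* [C] has exactly [m] simple objects up to isomorphism, and they have
   dimension vectors [al 0], ..., [al (m - 1)]. *)
Definition simple_dims (C : rep -> Prop) (m : nat) (al : 'I_m -> dimvec Q)
    : Prop :=
  exists T : 'I_m -> rep,
    [/\ forall i, simple_in C (T i),
        forall i j, isomorphic (T i) (T j) -> i = j,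
        forall V, simple_in C V -> exists i, isomorphic V (T i)
      & forall i a, repdim (T i) a = al i a].

Definition indecomposable (V : rep) : Prop :=
  ~ is_zero V /\
  forall A B : rep, isomorphic V (dsum A B) -> is_zero A \/ is_zero B.

(* End(V) = k; the zero representation, with End = 0, is excluded. *)
Definition schur_indecomposable (V : rep) : Prop :=
  ~ is_zero V /\
  forall f : fam V V, is_hom f -> exists c : k, forall a, f a = c%:M.

End FixedQuiver.

(* Zariski topology on a space [X] which the coordinates [c] identify with the
   affine space k^I: an open set is a union of principal open sets. *)
Definition zariski_open (X : Type) (I : finType) (c : X -> I -> k)
    (U : X -> Prop) : Prop :=
  exists F : {mpoly k[#|I|]} -> Prop,
  forall x, U x <-> exists2 p, F p & p.@[fun i => c x (enum_val i)] != 0.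

Definition generically (X : Type) (I : finType) (c : X -> I -> k)
    (P : X -> Prop) : Prop :=
  exists U : X -> Prop,
    [/\ zariski_open c U, exists x, U x & forall x, U x -> P x].

Section Generic.
Variable Q : quiver.

Definition entries (al : dimvec Q) : finType :=
  {phi : Q1 Q & ('I_(al (hd phi)) * 'I_(al (tl phi)))%type}.

Definition rep_coord (al : dimvec Q) (V : repSpace al) (e : entries al) : k :=
  V (tag e) (tagged e).1 (tagged e).2.

Definition rep_coord2 (al be : dimvec Q) (VW : repSpace al * repSpace be)
    (e : entries al + entries be) : k :=
  match e with inl x => rep_coord VW.1 x | inr y => rep_coord VW.2 y end.

Definition schur_root (al : dimvec Q) : Prop :=
  generically (@rep_coord al) (fun V => indecomposable (Rep V)).

Definition real_schur_root (al : dimvec Q) : Prop :=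
  schur_root al /\ euler al al = 1.

(* Generic in the product R(Q, al) x R(Q, be): the open set need not be a
   product of open sets. *)
Definition perpendicular (al be : dimvec Q) : Prop :=
  generically (@rep_coord2 al be) (fun AB =>
    hom_vanishes (Rep AB.1) (Rep AB.2) /\ ext_vanishes (Rep AB.1) (Rep AB.2)).

Definition perpendicular_sequence (t : nat) (al : 'I_t -> dimvec Q) : Prop :=
  (forall i, schur_root (al i)) /\
  (forall i j : 'I_t, (i < j)%N -> perpendicular (al i) (al j)).

End Generic.

Definition arrows_quiver (m : nat) (r : 'I_m -> 'I_m -> nat) : quiver :=
  @Quiver 'I_m {kl : 'I_m * 'I_m & 'I_(r kl.1 kl.2)}
    (fun phi => (tag phi).1) (fun phi => (tag phi).2).

Section Procedure.
Variable Q : quiver.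

(* One pass of the loop for the root [d], as a relation between the current
   list [al] and a possible next list [al'].  It is a relation because the
   simple objects come in no preferred order; it holds of no [al'] when some
   number of arrows would be negative or [d] has no expansion with nonnegative
   integer coefficients. *)
Definition step (d : dimvec Q) (m : nat) (al : 'I_m -> dimvec Q)
    (m' : nat) (al' : 'I_m' -> dimvec Q) : Prop :=
  exists (r : 'I_m -> 'I_m -> nat) (ga : dimvec (arrows_quiver r))
         (albar : 'I_m' -> dimvec (arrows_quiver r)),
  [/\ forall i j, (r i j)%:Z = (i == j)%:Z - euler (al i) (al j),
      forall a, d a = (\sum_(i < m) ga i * al i a)%N,
      generically (@rep_coord _ ga) (fun G => simple_dims (rperp (Rep G)) albar)
    & forall j a, al' j a = (\sum_(i < m) albar j i * al i a)%N].

(* [reached d i al]: [al] is a possible current list after [i] passes. *)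
Inductive reached (t : nat) (d : 'I_t -> dimvec Q)
    : nat -> forall m : nat, ('I_m -> dimvec Q) -> Prop :=
| reached_start m (al : 'I_m -> dimvec Q) :
    simple_dims (fun _ : rep Q => True) al -> reached d 0 al
| reached_step (i : 'I_t) m (al : 'I_m -> dimvec Q)
    m' (al' : 'I_m' -> dimvec Q) :
    reached d i al -> step (d i) al al' -> reached d i.+1 al'.

End Procedure.
End Representations.

(* Main.v *)
Require Import Defs.
From mathcomp Require Import all_boot all_order all_algebra.
From mathcomp Require Import mpoly zify.
From Stdlib Require Import Classical FunctionalExtensionality.

(* The perpendicular category of an exceptional sequence of length s is an abelian
   subcategory C closed under extensions, and the proof compares C with the
   representations of its own Ext-quiver.

   Every representation X reaches C through finitely many steps, each a quotient by
   the image of a member G of the sequence or a non-split extension by G.  Both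
   kinds of steps preserve the vanishing of Ext(X, C), so a simple representation at
   a lowest vertex of the support of C yields a non-zero object P with
   Ext(P, C) = 0; one of minimal dimension is simple in C, because Ext is right
   exact.  Appending such simple objects one after the other lengthens the
   exceptional sequence until its perpendicular category is zero.  The Gram matrix
   of the Euler form is triangular, so an exceptional sequence has length at most n,
   and a linear form which vanishes on the sequence and on C vanishes everywhere, so
   the length is exactly n in the end.  Hence C has n - s simple objects T_i, whose
   Ext-quiver Sigma has no oriented cycles.

   Fix cocycles c_e representing bases of the Ext(T_i, T_j).  A representation V of
   Sigma is sent to the sum of the T_i tensor V_i, glued by the c_e tensor V(e).
   Since a quiver has no relations this needs no further condition, and a triangular
   induction shows that the functor is an equivalence from the representations of
   Sigma to C which preserves the Euler form.  A real Schur root of C then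
   corresponds to an exceptional G over Sigma.  The orbit of G contains a non-empty
   open set, so the generic representation may be replaced by G, and the equivalence
   restricts to one between the perpendicular categories of G and of its image. *)

Set Implicit Arguments.
Unset Strict Implicit.
Unset Printing Implicit Defensive.

Import GRing.Theory.
Local Open Scope ring_scope.

(** * Homomorphisms and extensions *)

Definition blockE := (mulmx_block, mul_row_block, mul_block_col, mul_row_col,
  mul_col_mx, mul_mx_row, add_block_mx, add_row_mx, add_col_mx,
  mulmx0, mul0mx, mulmx1, mul1mx, addr0, add0r, subr0, sub0r, oppr0).

(** Lets the elementwise exactness conditions of [short_exact] be used as statements about
    matrices. *)
Lemma mx_col_choice (k : fieldType) m n (P : 'I_n -> 'cV[k]_m -> Prop) :
  (forall j, exists v, P j v) -> exists M : 'M[k]_(m, n), forall j, P j (col j M).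
Proof.
move=> H; have [v Hv] := fin_all_exists H.
exists (\matrix_(x, j) v j x 0) => j.
suff -> : col j (\matrix_(x, j) v j x 0) = v j by [].
by apply/matrixP => x y; rewrite !mxE (ord1 y).
Qed.

Lemma mx_colP (k : fieldType) m n (M N : 'M[k]_(m, n)) :
  (forall j, col j M = col j N) -> M = N.
Proof.
by move=> H; apply/matrixP => x j; have /colP/(_ x) := H j; rewrite !mxE.
Qed.

Lemma col_mul (k : fieldType) m n p (M : 'M[k]_(m, n)) (N : 'M[k]_(n, p)) j :
  col j (M *m N) = M *m col j N.
Proof. by rewrite !colE mulmxA. Qed.

Section Homomorphisms.
Variables (k : closedFieldType) (Q : quiver).
Implicit Types A B C E X Y G : rep k Q.

(** The degree-one term of the standard two-term complex of the pair. Every element is a cocycle,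
    since a quiver carries no relations. *)
Definition ext_space A B : Type :=
  forall phi : Q1 Q, 'M[k]_(repdim B (hd phi), repdim A (tl phi)).

Definition cobound A B (f : fam A B) : ext_space A B :=
  fun phi => f (hd phi) *m arr A phi - arr B phi *m f (tl phi).

(* Hom(A, B) and Ext(A, B) are the kernel and the cokernel of [cobound]. *)
Definition ext0 A B : Prop :=
  forall xi : ext_space A B, exists f : fam A B, forall phi, cobound f phi = xi phi.

Lemma is_homE A B (f : fam A B) : is_hom f <-> forall phi, cobound f phi = 0.
Proof.
split=> H phi; first by rewrite /cobound H subrr.
by apply/eqP; rewrite -subr_eq0; apply/eqP/H.
Qed.

(** The subobject is [A] and the quotient is [B], so the off-diagonal block is a cocycle for
    Ext([B], [A]). *)
Definition extn A B (xi : ext_space B A) : rep k Q :=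
  @Rep k Q (fun a => repdim A a + repdim B a)%N
    (fun phi => block_mx (arr A phi) (xi phi) 0 (arr B phi)).

Definition fam_id A : fam A A := fun a => 1%:M.
Definition fam_comp A B C (g : fam B C) (f : fam A B) : fam A C :=
  fun a => g a *m f a.

Lemma is_hom_id A : is_hom (@fam_id A).
Proof. by move=> phi; rewrite mul1mx mulmx1. Qed.

Lemma is_hom_comp A B C (g : fam B C) (f : fam A B) :
  is_hom g -> is_hom f -> is_hom (fam_comp g f).
Proof. by move=> Hg Hf phi; rewrite /fam_comp -mulmxA Hf !mulmxA Hg. Qed.

Lemma inverse_is_hom A B (f : fam A B) (g : fam B A) :
  is_hom f -> is_inverse f g -> is_hom g.
Proof.
move=> Hf H phi; have [gf fg] := H (hd phi); have [gf' fg'] := H (tl phi).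
rewrite -[LHS]mulmx1 -fg' mulmxA -[_ *m f _]mulmxA -Hf.
by rewrite !mulmxA gf mul1mx.
Qed.

Lemma is_isoP A B (f : fam A B) :
  is_iso f <-> is_hom f /\ exists g : fam B A, is_inverse f g.
Proof.
split=> [[Hf [g [_ Hg]]]|[Hf [g Hg]]]; first by split=> //; exists g.
by split=> //; exists g; split=> //; apply: inverse_is_hom Hg.
Qed.

Lemma is_iso_comp A B C (g : fam B C) (f : fam A B) :
  is_iso g -> is_iso f -> is_iso (fam_comp g f).
Proof.
move=> [Hg [g' [Hg' Kg]]] [Hf [f' [Hf' Kf]]]; split; first exact: is_hom_comp.
exists (fam_comp f' g'); split=> [|a]; first exact: is_hom_comp.
rewrite /fam_comp; have [g1 g2] := Kg a; have [f1 f2] := Kf a.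
rewrite -!mulmxA (mulmxA (g' a)) g1 mul1mx f1; split=> //.
by rewrite (mulmxA (f a)) f2 mul1mx g2.
Qed.

Lemma isomorphic_sym A B : isomorphic A B -> isomorphic B A.
Proof.
case=> f [Hf [g [Hg K]]]; exists g; split=> //; exists f; split=> // a.
by have [] := K a.
Qed.

Lemma isomorphic_trans A B C : isomorphic A B -> isomorphic B C -> isomorphic A C.
Proof. by case=> f Hf [g Hg]; exists (fam_comp g f); apply: is_iso_comp. Qed.

Lemma isomorphic_dim A B : isomorphic A B -> repdim A =1 repdim B.
Proof.
case=> f [_ [g [_ K]]] a; have [gf fg] := K a.
by apply/eqP; rewrite eqn_leq (mulmx1_min gf) (mulmx1_min fg).
Qed.

Lemma fam_dim0l A B (a : Q0 Q) (f : fam A B) : repdim A a = 0%N -> f a = 0.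
Proof. by move: (f a) => M e; move: M; rewrite e => M; rewrite thinmx0. Qed.

Lemma fam_dim0r A B (a : Q0 Q) (f : fam A B) : repdim B a = 0%N -> f a = 0.
Proof. by move: (f a) => M e; move: M; rewrite e => M; rewrite flatmx0. Qed.

Lemma hom0_isol A A' B : isomorphic A A' -> hom_vanishes A B -> hom_vanishes A' B.
Proof.
case=> f [Hf [g [Hg K]]] H h Hh a; have [gf fg] := K a.
by rewrite -[h a]mulmx1 -fg mulmxA [h a *m f a](H _ (is_hom_comp Hh Hf)) mul0mx.
Qed.

Lemma hom0_isor A B B' : isomorphic B B' -> hom_vanishes A B -> hom_vanishes A B'.
Proof.
case=> f [Hf [g [Hg K]]] H h Hh a; have [gf fg] := K a.
by rewrite -[h a]mul1mx -fg -mulmxA [g a *m _](H _ (is_hom_comp Hg Hh)) mulmx0.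
Qed.

Lemma ext0_isol A A' B : isomorphic A A' -> ext0 A B -> ext0 A' B.
Proof.
case=> f [Hf [g [Hg K]]] H xi.
have [h Hh] := H (fun phi => xi phi *m f (tl phi)).
exists (fam_comp h g) => phi; have [gf fg] := K (tl phi).
rewrite -[RHS]mulmx1 -fg mulmxA -Hh /cobound /fam_comp mulmxBl -!mulmxA.
by rewrite Hg.
Qed.

Lemma ext0_isor A B B' : isomorphic B B' -> ext0 A B -> ext0 A B'.
Proof.
case=> f [Hf [g [Hg K]]] H xi.
have [h Hh] := H (fun phi => g (hd phi) *m xi phi).
exists (fam_comp f h) => phi; have [gf fg] := K (hd phi).
rewrite -[RHS]mul1mx -fg -mulmxA -Hh /cobound /fam_comp mulmxBr !mulmxA.
by rewrite Hf.
Qed.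

(** A cocycle is a coboundary exactly when the extension it defines splits, and every extension
    splits vertexwise. *)
Lemma ext_vanishesP A B : ext_vanishes A B <-> ext0 A B.
Proof.
split=> [H xi|H E i p [Hi Hp inji surjp ker]].
- pose E := extn xi.
  pose i : fam B E := fun a => col_mx 1%:M 0.
  pose p : fam E A := fun a => row_mx 0 1%:M.
  have Ep : short_exact i p.
    split.
    + by move=> phi; rewrite /i /= !blockE.
    + by move=> phi; rewrite /p /= !blockE.
    + by move=> a v w; rewrite /i !mul_col_mx !mul1mx !mul0mx => /eq_col_mx [].
    + by move=> a w; exists (col_mx 0 w); rewrite /p !blockE.
    + move=> a v; rewrite /p /i; split.
        rewrite -[v]vsubmxK !blockE => ->.
        by exists (usubmx v); rewrite !blockE.
      by case=> u <-; rewrite !blockE.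
  have [s [Hs Ks]] := H E i p Ep.
  (* The lower block of the splitting is the identity, so its upper block cobounds [xi]. *)
  exists (fun a => usubmx (s a)) => phi; rewrite /cobound.
  have dsE a : dsubmx (s a) = 1%:M.
    by rewrite -(Ks a) /p -{2}[s a]vsubmxK mul_row_col mul0mx add0r mul1mx.
  have := Hs phi; rewrite -{1}[s (hd phi)]vsubmxK -{1}[s (tl phi)]vsubmxK /=.
  rewrite mul_col_mx mul_block_col !dsE mulmx1 => /eq_col_mx [-> _].
  by rewrite addrC addKr.
- have ex_s a : exists s : 'M[k]_(repdim E a, repdim A a), p a *m s = 1%:M.
    have [s Hs] := mx_col_choice (fun j => surjp a (col j 1%:M)).
    by exists s; apply: mx_colP => j; rewrite col_mul.
  have [s ps] := fin_all_exists ex_s.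
  have lift_ker a n (M : 'M[k]_(repdim E a, n)) :
      p a *m M = 0 -> exists N, M = i a *m N.
    move=> pM.
    have [N HN] : exists N : 'M_(repdim B a, n), forall j, i a *m col j N = col j M.
      apply: (mx_col_choice (P := fun j v => i a *m v = col j M)) => j.
      by apply/ker; rewrite -col_mul pM; apply/colP => x; rewrite !mxE.
    by exists N; apply: mx_colP => j; rewrite col_mul HN.
  (* The vertexwise section [s] need not commute with the arrows. Its defect dies in [A], hence
     comes from a cocycle [xi] with values in [B], and a family cobounding [xi] corrects [s]. *)
  have lift_xi phi : exists x : 'M[k]_(repdim B (hd phi), repdim A (tl phi)),
      arr E phi *m s (tl phi) - s (hd phi) *m arr A phi = i (hd phi) *m x.
    apply: lift_ker.
    by rewrite mulmxBr !mulmxA Hp ps mul1mx -mulmxA ps mulmx1 subrr.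
  have [xi Hxi] := fin_all_exists lift_xi.
  have [u Hu] := H xi.
  exists (fun a => s a + i a *m u a); split=> [phi|a].
    rewrite mulmxDl mulmxDr (mulmxA (arr E phi)) -Hi -!mulmxA.
    have /eqP := Hxi phi; rewrite -Hu /cobound mulmxBr subr_eq => /eqP ->.
    by rewrite -addrA [_ + i _ *m (arr B _ *m _)]addrC addrA subrK addrC.
  rewrite mulmxDr ps mulmxA.
  suff -> : p a *m i a = 0 by rewrite mul0mx addr0.
  apply: mx_colP => j; rewrite col_mul.
  have -> : col j (0 : 'M[k]_(repdim A a, repdim B a)) = 0 by apply/colP => x; rewrite !mxE.
  by apply/ker; exists (col j 1%:M); rewrite -col_mul mulmx1.
Qed.

End Homomorphisms.

(** * Long exact sequences of an extension *)

Section Extensions.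
Variables (k : closedFieldType) (Q : quiver).
Implicit Types A B C E X Y G : rep k Q.

Section OneExtension.
Variables (A B : rep k Q) (xi : ext_space B A).
Let E := extn xi.

Definition extn_in : fam A E := fun a => col_mx 1%:M 0.
Definition extn_out : fam E B := fun a => row_mx 0 1%:M.

Lemma extn_in_hom : is_hom extn_in.
Proof. by move=> phi; rewrite /extn_in /= !blockE. Qed.

Lemma extn_out_hom : is_hom extn_out.
Proof. by move=> phi; rewrite /extn_out /= !blockE. Qed.

Lemma extn_inK a n (M : 'M[k]_(repdim A a, n)) : extn_in a *m M = 0 -> M = 0.
Proof.
rewrite /extn_in mul_col_mx mul1mx mul0mx -(@col_mx0 _ (repdim A a) (repdim B a) n).
by case/eq_col_mx.
Qed.

Lemma extn_outK a n (M : 'M[k]_(n, repdim B a)) : M *m extn_out a = 0 -> M = 0.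
Proof.
rewrite /extn_out mul_mx_row mulmx1 mulmx0 -(@row_mx0 _ n (repdim A a) (repdim B a)).
by case/eq_row_mx.
Qed.

(** Here and in [coboundr] the differential becomes block triangular on an extension. The pieces of
    the long exact sequences below are read off block by block. *)
Lemma coboundl Y (f : fam E Y) phi :
  cobound f phi =
  row_mx (cobound (fun a => lsubmx (f a)) phi)
         (lsubmx (f (hd phi)) *m xi phi + cobound (fun a => rsubmx (f a)) phi).
Proof.
rewrite {1}/cobound -{1}[f (hd phi)]hsubmxK -{1}[f (tl phi)]hsubmxK /=.
by rewrite mul_row_block mul_mx_row opp_row_mx add_row_mx mulmx0 addr0 addrA.
Qed.

Lemma coboundr Y (f : fam Y E) phi :
  cobound f phi =
  col_mx (cobound (fun a => usubmx (f a)) phi - xi phi *m dsubmx (f (tl phi)))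
         (cobound (fun a => dsubmx (f a)) phi).
Proof.
rewrite {1}/cobound -{1}[f (hd phi)]vsubmxK -{1}[f (tl phi)]vsubmxK /=.
rewrite mul_col_mx mul_block_col opp_col_mx add_col_mx mul0mx add0r.
by rewrite opprD addrA.
Qed.

Lemma hom0_extnl Y : hom_vanishes A Y -> hom_vanishes B Y -> hom_vanishes E Y.
Proof.
move=> HA HB f /is_homE Hf a.
have l0 b : lsubmx (f b) = 0.
  apply: (HA (fun b => lsubmx (f b))); apply/is_homE => phi.
  by have := Hf phi; rewrite coboundl -row_mx0 => /eq_row_mx [].
rewrite -[f a]hsubmxK l0 (HB (fun b => rsubmx (f b))) ?row_mx0 //.
apply/is_homE => phi; have := Hf phi; rewrite coboundl -row_mx0 => /eq_row_mx [].
by rewrite l0 mul0mx add0r.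
Qed.

Lemma hom0_extnr Y : hom_vanishes Y A -> hom_vanishes Y B -> hom_vanishes Y E.
Proof.
move=> HA HB f /is_homE Hf a.
have d0 b : dsubmx (f b) = 0.
  apply: (HB (fun b => dsubmx (f b))); apply/is_homE => phi.
  by have := Hf phi; rewrite coboundr -col_mx0 => /eq_col_mx [].
rewrite -[f a]vsubmxK d0 (HA (fun b => usubmx (f b))) ?col_mx0 //.
apply/is_homE => phi; have := Hf phi; rewrite coboundr -col_mx0 => /eq_col_mx [].
by rewrite d0 mulmx0 subr0.
Qed.

Lemma hom0_extn_sub Y : hom_vanishes Y E -> hom_vanishes Y A.
Proof.
move=> H f Hf a; apply: (@extn_inK a).
exact: (H _ (is_hom_comp extn_in_hom Hf)).
Qed.

Lemma hom0_extn_quo Y : hom_vanishes E Y -> hom_vanishes B Y.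
Proof.
move=> H f Hf a; apply: (@extn_outK a).
exact: (H _ (is_hom_comp Hf extn_out_hom)).
Qed.

Lemma ext0_extnl Y : ext0 A Y -> ext0 B Y -> ext0 E Y.
Proof.
move=> HA HB eta.
have [f1 Hf1] := HA (fun phi => lsubmx (eta phi)).
have [f2 Hf2] := HB (fun phi => rsubmx (eta phi) - f1 (hd phi) *m xi phi).
exists (fun a => row_mx (f1 a) (f2 a)) => phi; rewrite coboundl -[RHS]hsubmxK.
rewrite /cobound !row_mxKl !row_mxKr -!/(cobound _ _) -Hf1.
by have := Hf2 phi; rewrite /cobound => ->; rewrite [_ *m xi _ + _]addrC subrK.
Qed.

Lemma ext0_extnr Y : ext0 Y A -> ext0 Y B -> ext0 Y E.
Proof.
move=> HA HB eta.
have [f2 Hf2] := HB (fun phi => dsubmx (eta phi)).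
have [f1 Hf1] := HA (fun phi => usubmx (eta phi) + xi phi *m f2 (tl phi)).
exists (fun a => col_mx (f1 a) (f2 a)) => phi; rewrite coboundr -[RHS]vsubmxK.
rewrite /cobound !col_mxKu !col_mxKd -Hf2.
by have := Hf1 phi; rewrite /cobound => ->; rewrite addrK.
Qed.

(* [Ext] is right exact because representations of a quiver have no [Ext^2]. *)
Lemma ext0_extn_sub Y : ext0 E Y -> ext0 A Y.
Proof.
move=> H eta; have [f Hf] := H (fun phi => row_mx (eta phi) 0).
exists (fun a => lsubmx (f a)) => phi.
by have := Hf phi; rewrite coboundl => /eq_row_mx [].
Qed.

Lemma ext0_extn_quo Y : ext0 Y E -> ext0 Y B.
Proof.
move=> H eta; have [f Hf] := H (fun phi => col_mx 0 (eta phi)).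
exists (fun a => dsubmx (f a)) => phi.
by have := Hf phi; rewrite coboundr => /eq_col_mx [].
Qed.

(** Exactness of Hom([Y], [B]) -> Ext([Y], [A]) -> Ext([Y], [E]). *)
Lemma ext0_sub Y : hom_vanishes Y B -> ext0 Y E -> ext0 Y A.
Proof.
move=> HB H eta; have [f Hf] := H (fun phi => col_mx (eta phi) 0).
have d0 b : dsubmx (f b) = 0.
  apply: (HB (fun b => dsubmx (f b))); apply/is_homE => phi.
  by have := Hf phi; rewrite coboundr => /eq_col_mx [].
exists (fun a => usubmx (f a)) => phi.
by have := Hf phi; rewrite coboundr => /eq_col_mx []; rewrite d0 mulmx0 subr0.
Qed.

Lemma ext0_quo Y : hom_vanishes A Y -> ext0 E Y -> ext0 B Y.
Proof.
move=> HA H eta; have [f Hf] := H (fun phi => row_mx 0 (eta phi)).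
have l0 b : lsubmx (f b) = 0.
  apply: (HA (fun b => lsubmx (f b))); apply/is_homE => phi.
  by have := Hf phi; rewrite coboundl => /eq_row_mx [].
exists (fun a => rsubmx (f a)) => phi.
by have := Hf phi; rewrite coboundl => /eq_row_mx []; rewrite l0 mul0mx add0r.
Qed.

(** The connecting map sends [g] to the class of [xi g]. As this class is zero, [g] lifts to a map
    into [E], which vanishes. *)
Lemma hom0_quo Y : hom_vanishes Y E -> ext0 Y A -> hom_vanishes Y B.
Proof.
move=> H HA g /is_homE Hg a.
have [f Hf] := HA (fun phi => xi phi *m g (tl phi)).
have := H (fun b => col_mx (f b) (g b)); rewrite -[g a](col_mxKd (f a)) => -> //.
  by rewrite -col_mx0 col_mxKd.
apply/is_homE => phi; rewrite coboundr /cobound !col_mxKu !col_mxKd.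
have := Hf phi; have := Hg phi; rewrite /cobound => -> ->.
by rewrite subrr col_mx0.
Qed.

End OneExtension.

Definition tdim A := (\sum_a repdim A a)%N.

Lemma tdim_isomorphic A B : isomorphic A B -> tdim A = tdim B.
Proof. by move=> /isomorphic_dim H; apply: eq_bigr => a _; rewrite H. Qed.

Lemma tdim_extn A B (xi : ext_space B A) : tdim (extn xi) = (tdim A + tdim B)%N.
Proof. by rewrite /tdim big_split. Qed.

Lemma tdim_eq0 A : tdim A = 0%N <-> is_zero A.
Proof.
split=> [/eqP|H]; last by apply: big1 => a _; apply: H.
by rewrite sum_nat_eq0 => /forallP H a; apply/eqP; have := H a.
Qed.

Lemma is_zero_hom0l A Y : is_zero A -> hom_vanishes A Y.
Proof. by move=> Z f _ a; apply: fam_dim0l. Qed.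

Lemma is_zero_hom0r A Y : is_zero A -> hom_vanishes Y A.
Proof. by move=> Z f _ a; apply: fam_dim0r. Qed.

Lemma is_zero_ext0l A Y : is_zero A -> ext0 A Y.
Proof.
move=> Z xi; exists (fun=> 0) => phi; move: (cobound _ _) (xi phi); rewrite Z => M N.
by rewrite (thinmx0 M) (thinmx0 N).
Qed.

Lemma is_zero_ext0r A Y : is_zero A -> ext0 Y A.
Proof.
move=> Z xi; exists (fun=> 0) => phi; move: (cobound _ _) (xi phi); rewrite Z => M N.
by rewrite (flatmx0 M) (flatmx0 N).
Qed.

End Extensions.

(** * Images and wide subcategories *)

(** Rank normal form in bases adapted to kernel, image and cokernel. Their dimensions are fields, so
    [m] and [n] need not be literal sums. *)
Record mx_factor (k : fieldType) m n (f : 'M[k]_(m, n)) := MxFactor {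
  mf_ker : nat; mf_im : nat; mf_coker : nat;
  mf_u : 'M[k]_(mf_ker + mf_im, n); mf_u' : 'M[k]_(n, mf_ker + mf_im);
  mf_v : 'M[k]_(m, mf_im + mf_coker); mf_v' : 'M[k]_(mf_im + mf_coker, m);
  mf_u'u : mf_u' *m mf_u = 1%:M; mf_uu' : mf_u *m mf_u' = 1%:M;
  mf_v'v : mf_v' *m mf_v = 1%:M; mf_vv' : mf_v *m mf_v' = 1%:M;
  mf_eq : f = mf_v *m block_mx 0 1%:M 0 0 *m mf_u }.

Lemma mx_factor_exists (k : fieldType) m n (f : 'M[k]_(m, n)) : inhabited (mx_factor f).
Proof.
have factor_rank r p c (g : 'M[k]_(r + c, r + p)) : \rank g = r -> inhabited (mx_factor g).
  move=> rk; pose s : 'M[k]_(p + r, r + p) := block_mx 0 1%:M 1%:M 0.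
  pose s' : 'M[k]_(r + p, p + r) := block_mx 0 1%:M 1%:M 0.
  have ss' : s *m s' = 1%:M by rewrite /s /s' !blockE -scalar_mx_block.
  have s's : s' *m s = 1%:M by rewrite /s /s' !blockE -scalar_mx_block.
  constructor.
  apply: (@MxFactor k _ _ g p r c (s *m row_ebase g) (invmx (row_ebase g) *m s')
            (col_ebase g) (invmx (col_ebase g))).
  - by rewrite mulmxA -(mulmxA _ s') s's mulmx1 mulVmx // row_ebase_unit.
  - by rewrite mulmxA -(mulmxA s) mulmxV ?row_ebase_unit // mulmx1.
  - by rewrite mulVmx // col_ebase_unit.
  - by rewrite mulmxV // col_ebase_unit.
  - rewrite -{1}(mulmx_ebase g) rk pid_mx_block mulmxA -(mulmxA _ _ s).
    by rewrite /s !blockE.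
have [r rk] : exists r, \rank f = r by exists (\rank f).
have [hm hn] : (r <= m /\ r <= n)%N by rewrite -rk rank_leq_row rank_leq_col.
have [c em] : exists c, m = (r + c)%N by exists (m - r)%N; rewrite subnKC.
have [p en] : exists p, n = (r + p)%N by exists (n - r)%N; rewrite subnKC.
by subst m n; apply: factor_rank rk.
Qed.

Lemma mx_dim0r (k : fieldType) m n (M N : 'M[k]_(m, n)) : n = 0%N -> M = N.
Proof. by move=> n0; subst n; rewrite (thinmx0 M) (thinmx0 N). Qed.

Lemma mx_dim0l (k : fieldType) m n (M N : 'M[k]_(m, n)) : m = 0%N -> M = N.
Proof. by move=> m0; subst m; rewrite (flatmx0 M) (flatmx0 N). Qed.

Section Wide.
Variables (k : closedFieldType) (Q : quiver).
Implicit Types A B X Y U V K I Z : rep k Q.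

(* The image factorization of [f]: [A] is an extension of [I] by the kernel [K],
   and [B] is an extension of the cokernel [Z] by [I]. *)
Record factorization A B (f : fam A B) := Factorization {
  fKer : rep k Q; fIm : rep k Q; fCok : rep k Q;
  fxi : ext_space fIm fKer; feta : ext_space fCok fIm;
  fal : fam A (extn fxi); fbe : fam (extn feta) B;
  fal_iso : is_iso fal; fbe_iso : is_iso fbe;
  f_eq : forall a, f a = fbe a *m block_mx 0 1%:M 0 0 *m fal a }.

(** In vertexwise adapted bases, commutation of [f] with the arrows makes the arrow matrices [A']
    and [B'] block upper triangular with a common diagonal block, which defines the image. *)
Lemma factorization_exists A B (f : fam A B) : is_hom f -> inhabited (factorization f).
Proof.
move=> Hf.
have ex a : exists F : mx_factor (f a), True by case: (mx_factor_exists (f a)) => F; exists F.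
have [F _] := fin_all_exists ex.
pose A' phi := mf_u (F (hd phi)) *m arr A phi *m mf_u' (F (tl phi)).
pose B' phi := mf_v' (F (hd phi)) *m arr B phi *m mf_v (F (tl phi)).
have E phi : block_mx 0 1%:M 0 0 *m A' phi = B' phi *m block_mx 0 1%:M 0 0.
  rewrite /A' /B'; set Nh := block_mx 0 1%:M 0 0; set Nt := block_mx 0 1%:M 0 0.
  have H := Hf phi; rewrite (mf_eq (F (hd phi))) in H.
  rewrite (mf_eq (F (tl phi))) -/Nh -/Nt in H.
  have := congr1 (fun M => mf_v' (F (hd phi)) *m M *m mf_u' (F (tl phi))) H.
  rewrite !mulmxA mf_v'v mul1mx => ->.
  by rewrite -!mulmxA mf_uu' mulmx1.
have ex' phi : [/\ dlsubmx (A' phi) = 0, dlsubmx (B' phi) = 0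
    & drsubmx (A' phi) = ulsubmx (B' phi)].
  have := E phi; rewrite -[A' phi]submxK -[B' phi]submxK !block_mxKdl !block_mxKdr.
  rewrite !block_mxKul !blockE => /eq_block_mx [-> -> _ <-].
  by [].
pose K := @Rep k Q (fun a => mf_ker (F a)) (fun phi => ulsubmx (A' phi)).
pose I := @Rep k Q (fun a => mf_im (F a)) (fun phi => drsubmx (A' phi)).
pose Z := @Rep k Q (fun a => mf_coker (F a)) (fun phi => drsubmx (B' phi)).
pose xi : ext_space I K := fun phi => ursubmx (A' phi).
pose eta : ext_space Z I := fun phi => ursubmx (B' phi).
have EA phi : arr (extn xi) phi = A' phi.
  by rewrite -[RHS]submxK; case: (ex' phi) => -> _ _.
have EB phi : arr (extn eta) phi = B' phi.
  by rewrite -[RHS]submxK; case: (ex' phi) => _ -> <-.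
constructor.
apply: (@Factorization A B f K I Z xi eta (fun a => mf_u (F a)) (fun a => mf_v (F a))).
- apply/is_isoP; split=> [phi|].
    by rewrite EA /A' -!mulmxA mf_u'u mulmx1.
  by exists (fun a => mf_u' (F a)) => a; rewrite mf_u'u mf_uu'.
- apply/is_isoP; split=> [phi|].
    by rewrite EB /B' !mulmxA mf_vv' mul1mx.
  by exists (fun a => mf_v' (F a)) => a; rewrite mf_v'v mf_vv'.
- by move=> a; apply: mf_eq.
Qed.

Section Factored.
Variables (A B : rep k Q) (f : fam A B) (F : factorization f).

Lemma factor_isol : isomorphic A (extn (fxi F)).
Proof. by exists (fal F); apply: fal_iso. Qed.

Lemma factor_isor : isomorphic B (extn (feta F)).
Proof. by apply: isomorphic_sym; exists (fbe F); apply: fbe_iso. Qed.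

Lemma factor_ker :
  exists i : fam (fKer F) A, [/\ is_hom i, forall a, f a *m i a = 0
    & forall a n (M : 'M[k]_(_, n)), i a *m M = 0 -> M = 0].
Proof.
have [Ha [g [Hg K]]] := fal_iso F.
exists (fam_comp g (@extn_in _ _ _ _ (fxi F))); split.
- exact/(is_hom_comp Hg)/extn_in_hom.
- move=> a; have [gf fg] := K a; rewrite /fam_comp (f_eq F) -mulmxA (mulmxA _ (g a)) fg mul1mx.
  by rewrite -mulmxA /extn_in !blockE col_mx0 mulmx0.
- move=> a n M; have [gf fg] := K a; rewrite /fam_comp => H.
  apply: (@extn_inK _ _ _ _ (fxi F)).
  by rewrite -[LHS]mul1mx -fg -mulmxA (mulmxA (g a)) H mulmx0.
Qed.

Lemma factor_im :
  exists j : fam (fIm F) B, [/\ is_hom j,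
    forall a n (M : 'M[k]_(_, n)), j a *m M = 0 -> M = 0
    & exists p : fam A (fIm F), is_hom p /\ forall a, f a = j a *m p a].
Proof.
have [Ha _] := fal_iso F; have [Hb [g [Hg K]]] := fbe_iso F.
exists (fam_comp (fbe F) (@extn_in _ _ _ _ (feta F))); split.
- exact/(is_hom_comp Hb)/extn_in_hom.
- move=> a n M; have [gf fg] := K a; rewrite /fam_comp => H.
  apply: (@extn_inK _ _ _ _ (feta F)).
  by rewrite -[LHS]mul1mx -gf -!mulmxA (mulmxA (fbe F a)) H mulmx0.
- exists (fam_comp (@extn_out _ _ _ _ (fxi F)) (fal F)); split.
    exact: (is_hom_comp (@extn_out_hom _ _ _ _ _) Ha).
  move=> a; rewrite (f_eq F) /fam_comp /extn_in /extn_out !mulmxA; congr (_ *m _).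
  by rewrite -mulmxA mul_col_mx mul1mx mul0mx block_mxEv row_mx0.
Qed.

Lemma factor_im0 : is_zero (fIm F) -> forall a, f a = 0.
Proof.
move=> Z a; rewrite (f_eq F) (_ : block_mx 0 _ 0 0 = 0) ?mulmx0 ?mul0mx //.
by rewrite (mx_dim0l 1%:M 0 (Z a)) block_mx_const.
Qed.

Let N a : 'M[k]_(repdim (extn (feta F)) a, repdim (extn (fxi F)) a) := block_mx 0 1%:M 0 0.
Let N' a : 'M[k]_(repdim (extn (fxi F)) a, repdim (extn (feta F)) a) := block_mx 0 0 1%:M 0.

Lemma factor_N'N a : repdim (fKer F) a = 0%N -> N' a *m N a = 1%:M.
Proof.
move=> Z; rewrite /N /N' mulmx_block !blockE [RHS]scalar_mx_block.
by rewrite (mx_dim0l 1%:M 0 Z).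
Qed.

Lemma factor_NN' a : repdim (fCok F) a = 0%N -> N a *m N' a = 1%:M.
Proof.
move=> Z; rewrite /N /N' mulmx_block !blockE [RHS]scalar_mx_block.
by rewrite (mx_dim0l (1%:M : 'M_(repdim (fCok F) a)) 0 Z).
Qed.

Lemma factor_iso : is_hom f -> is_zero (fKer F) -> is_zero (fCok F) -> is_iso f.
Proof.
move=> Hf ZK ZC; apply/is_isoP; split=> //.
have [_ [u [_ Ku]]] := fal_iso F; have [_ [v [_ Kv]]] := fbe_iso F.
exists (fun a => u a *m block_mx 0 0 1%:M 0 *m v a) => a.
have [u1 u2] := Ku a; have [v1 v2] := Kv a; rewrite (f_eq F) -!mulmxA.
rewrite (mulmxA (v a)) v1 mul1mx (mulmxA (fal F a)) u2 mul1mx.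
by rewrite (mulmxA _ _ (fal F a)) (mulmxA _ _ (v a)) factor_N'N // factor_NN' // !mul1mx.
Qed.

Lemma factor_mono : is_zero (fKer F) ->
  forall a n (M : 'M[k]_(_, n)), f a *m M = 0 -> M = 0.
Proof.
move=> Z a n M; have [_ [u [_ Ku]]] := fal_iso F; have [_ [v [_ Kv]]] := fbe_iso F.
have [u1 u2] := Ku a; have [v1 v2] := Kv a; rewrite (f_eq F) => H.
have K : N a *m (fal F a *m M) = 0.
  rewrite -[LHS]mul1mx -v1 -mulmxA [X in _ *m X](_ : _ = 0) ?mulmx0 //.
  by rewrite !mulmxA; apply: H.
by rewrite -[M]mul1mx -u1 -mulmxA -[fal F a]mul1mx -(factor_N'N (Z a)) -!mulmxA K !mulmx0.
Qed.

Lemma factor_tdiml : tdim A = (tdim (fKer F) + tdim (fIm F))%N.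
Proof. by rewrite (tdim_isomorphic factor_isol) tdim_extn. Qed.

Lemma factor_tdimr : tdim B = (tdim (fIm F) + tdim (fCok F))%N.
Proof. by rewrite (tdim_isomorphic factor_isor) tdim_extn. Qed.

End Factored.
End Wide.

(** * Wide subcategories and Schur's lemma *)

Section WideSubcategories.
Variables (k : closedFieldType) (Q : quiver).
Implicit Types A B X Y U V G : rep k Q.

(** An abelian subcategory closed under extensions, whose kernels, images and cokernels are those of
    the ambient category. *)
Record wide (C : rep k Q -> Prop) : Prop := Wide {
  wide_iso : forall A B, isomorphic A B -> C A -> C B;
  wide_zero : forall A, is_zero A -> C A;
  wide_extn : forall A B (xi : ext_space B A), C A -> C B -> C (extn xi);
  wide_factor : forall A B (f : fam A B) (F : factorization f),
    C A -> C B -> [/\ C (fKer F), C (fIm F) & C (fCok F)] }.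

Definition Perp G V : Prop := hom_vanishes G V /\ ext0 G V.

(** For the image, Hom([G], -) vanishes because it embeds into [B], and Ext([G], -) because it is a
    quotient of [A]. Kernel and cokernel then follow from the long exact sequences. *)
Lemma wide_Perp G : wide (Perp G).
Proof.
split=> [A B AB [h e]|A Z|A B xi [h1 e1] [h2 e2]|A B f F [h1 e1] [h2 e2]].
- by split; [apply: hom0_isor AB h | apply: ext0_isor AB e].
- by split; [apply: is_zero_hom0r | apply: is_zero_ext0r].
- by split; [apply: hom0_extnr | apply: ext0_extnr].
- have hA := hom0_isor (factor_isol F) h1; have eA := ext0_isor (factor_isol F) e1.
  have hB := hom0_isor (factor_isor F) h2; have eB := ext0_isor (factor_isor F) e2.
  have hI := hom0_extn_sub hB; have eI := ext0_extn_quo eA.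
  split; split=> //.
  + exact: hom0_extn_sub hA.
  + exact: ext0_sub hI eA.
  + exact: hom0_quo hB eI.
  + exact: ext0_extn_quo eB.
Qed.

Fixpoint perp (gs : seq (rep k Q)) V : Prop :=
  if gs is G :: gs' then Perp G V /\ perp gs' V else True.

Lemma wide_perp gs : wide (perp gs).
Proof.
elim: gs => [|G gs IH] /=; first by split=> // A B f F _ _; split.
have WG := wide_Perp G.
split=> [A B AB [h e]|A Z|A B xi [h1 e1] [h2 e2]|A B f F [h1 e1] [h2 e2]].
- by split; [apply: (wide_iso WG) AB h | apply: (wide_iso IH) AB e].
- by split; [apply: (wide_zero WG) | apply: (wide_zero IH)].
- by split; [apply: (wide_extn WG) | apply: (wide_extn IH)].
- by case: (wide_factor WG F h1 h2); case: (wide_factor IH F e1 e2).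
Qed.

Section InWide.
Variables (C : rep k Q -> Prop) (WC : wide C).

Lemma cancel_mono U V (f : fam U V) :
  (forall a n (M : 'M[k]_(_, n)), f a *m M = 0 -> M = 0) -> mono_in C f.
Proof.
move=> H X g h _ _ _ E a; apply/eqP; rewrite -subr_eq0; apply/eqP/(H a).
by rewrite mulmxBr E subrr.
Qed.

(** The kernel lies in [C], so its inclusion can be compared with the zero map: a monomorphism of
    [C] is injective. *)
Lemma mono_ker U V (f : fam U V) (F : factorization f) :
  C U -> C V -> mono_in C f -> is_zero (fKer F).
Proof.
move=> CU CV M; have [i [Hi fi ci]] := factor_ker F.
have [CK _ _] := wide_factor WC F CU CV.
have i0 := M _ i (fun a => 0) CK Hi (fun phi => etrans (mul0mx _ _) (esym (mulmx0 _ _))).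
have {}i0 a : i a = 0 by apply: i0 => b; rewrite fi mulmx0.
move=> a; have E := ci a _ 1%:M; rewrite i0 mul0mx in E.
have := E (erefl _); case: (repdim (fKer F) a) => // n /matrixP /(_ 0 0).
by rewrite !mxE eqxx => /eqP; rewrite oner_eq0.
Qed.

Lemma simple_mono V X (f : fam V X) (F : factorization f) :
  simple_in C V -> C X -> ~ (forall a, f a = 0) -> is_zero (fKer F).
Proof.
move=> [CV _ SV] CX f0; have [i [Hi fi ci]] := factor_ker F.
have [CK _ _] := wide_factor WC F CV CX.
have [//|[_ [g [_ Kg]]]] := SV _ i CK Hi (cancel_mono ci).
case: f0 => a; have [_ ig] := Kg a.
by rewrite -[f a]mulmx1 -ig mulmxA fi mul0mx.
Qed.

Lemma simple_epi V X (f : fam X V) (F : factorization f) :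
  simple_in C V -> C X -> ~ (forall a, f a = 0) -> is_zero (fCok F).
Proof.
move=> [CV _ SV] CX f0; have [j [Hj cj [p [_ fE]]]] := factor_im F.
have [_ CI _] := wide_factor WC F CX CV.
have [Z|ij] := SV _ j CI Hj (cancel_mono cj).
  by case: f0; apply: factor_im0 F Z.
have d1 := isomorphic_dim (ex_intro _ j ij); have d2 := isomorphic_dim (factor_isor F).
by move=> a; apply/eqP; have /eqP := d2 a; rewrite -d1 /= -{1}[repdim _ a]addn0 eqn_add2l eq_sym.
Qed.

(** Schur's lemma inside a wide subcategory. *)
Lemma simple_hom_iso V1 V2 (f : fam V1 V2) :
  simple_in C V1 -> simple_in C V2 -> is_hom f -> ~ (forall a, f a = 0) -> is_iso f.
Proof.
move=> S1 S2 Hf f0; have [F] := factorization_exists Hf.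
have [[C1 _ _] [C2 _ _]] := (S1, S2).
apply: (factor_iso (F := F)) => //; first exact: simple_mono S1 C2 f0.
exact: simple_epi S2 C1 f0.
Qed.

Lemma simple_hom0 V1 V2 :
  simple_in C V1 -> simple_in C V2 -> ~ isomorphic V1 V2 -> hom_vanishes V1 V2.
Proof.
move=> S1 S2 N f Hf; apply: NNPP => f0.
by apply: N; exists f; apply: simple_hom_iso f0.
Qed.

(** An eigenvalue [c] of [f] at one vertex makes [f - c] non-invertible there, so [f - c] vanishes
    at all vertices by Schur's lemma. *)
Lemma simple_schur V : simple_in C V -> schur_indecomposable V.
Proof.
move=> S; have [CV NZ _] := S; split=> // f Hf.
have [a da] : exists a, (0 < repdim V a)%N.
  apply: NNPP => H; apply: NZ => a; apply/eqP; rewrite -leqn0 leqNgt.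
  by apply/negP => da; apply: H; exists a.
have [c] : exists c, root (char_poly (f a)) c.
  by apply: closed_rootP; rewrite size_char_poly; case: (repdim V a) da.
rewrite -eigenvalue_root_char => /eigenvalueP [v vf v0].
exists c; have Hg : is_hom (fun a => f a - c%:M : 'M_(repdim V a)).
  by move=> phi; rewrite mulmxBl mulmxBr Hf mul_scalar_mx mul_mx_scalar.
suff H : forall b, f b - c%:M = 0 by move=> b; apply/eqP; rewrite -subr_eq0 H.
apply: NNPP => g0; have [_ [h [_ K]]] := simple_hom_iso S S Hg g0.
have [_ gh] := K a; case/negP: v0; apply/eqP.
by rewrite -[v]mulmx1 -gh mulmxA mulmxBr vf mul_mx_scalar subrr mul0mx.
Qed.

(** If [X] is not simple, a proper non-zero subobject has smaller total dimension. *)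
Lemma simple_sub X : C X -> ~ is_zero X ->
  exists V (f : fam V X), [/\ simple_in C V, is_hom f & ~ (forall a, f a = 0)].
Proof.
have [n] := ubnP (tdim X); elim: n X => // n IH X leX CX NX.
case: (classic (simple_in C X)) => [S|NS].
  exists X, (@fam_id k Q X); split=> //; first exact: is_hom_id.
  move=> H; apply: NX => a; have := H a; rewrite /fam_id.
  case: (repdim X a) => // m /matrixP /(_ 0 0).
  by rewrite !mxE eqxx => /eqP; rewrite oner_eq0.
have [U [f [CU Hf M NU NI]]] : exists U (f : fam U X),
    [/\ C U, is_hom f, mono_in C f, ~ is_zero U & ~ is_iso f].
  apply: NNPP => H; apply: NS; split=> // U f CU Hf M.
  case: (classic (is_zero U)) => [|NU]; first by left.
  right; apply: NNPP => NI; apply: H; exists U, f; by split.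
have [F] := factorization_exists Hf.
have ZK := mono_ker F CU CX M.
have ltU : (tdim U < tdim X)%N.
  rewrite (factor_tdiml F) (factor_tdimr F) (proj2 (tdim_eq0 _) ZK) add0n.
  rewrite -{1}[tdim (fIm F)]addn0 ltn_add2l lt0n; apply/eqP => Z.
  by apply: NI; apply: (factor_iso (F := F)) => //; apply/tdim_eq0.
have [V [g [SV Hg g0]]] := IH U (leq_trans ltU leX) CU NU.
exists V, (fam_comp f g); split=> //; first exact: is_hom_comp.
by move=> H; apply: g0 => a; apply: (factor_mono ZK); apply: H.
Qed.

End InWide.
End WideSubcategories.

(** * The Euler form *)

Section Encoding.
Variables (k : fieldType) (X : finType) (p q : X -> nat).

(** Families of matrices are flattened to row vectors, which makes the rank theory of a single
    matrix available for them. *)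
Definition mx_entries : finType := {x : X & ('I_(p x) * 'I_(q x))%type}.

Lemma card_mx_entries : #|mx_entries| = (\sum_x p x * q x)%N.
Proof.
rewrite card_tagged sumnE big_map big_enum /=.
by apply: eq_bigr => x _; rewrite card_prod !card_ord.
Qed.

Definition enc (f : forall x, 'M[k]_(p x, q x)) : 'rV[k]_#|mx_entries| :=
  \row_i f (tag (enum_val i)) (tagged (enum_val i)).1 (tagged (enum_val i)).2.

Definition dec (v : 'rV[k]_#|mx_entries|) x : 'M[k]_(p x, q x) :=
  \matrix_(y, z) v 0 (enum_rank (Tagged (fun x => ('I_(p x) * 'I_(q x))%type) (y, z))).

Lemma encK f x : dec (enc f) x = f x.
Proof. by apply/matrixP => y z; rewrite !mxE enum_rankK. Qed.

Lemma decK v : enc (dec v) = v.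
Proof.
apply/rowP => i; rewrite !mxE; congr (v 0 _); rewrite -[RHS]enum_valK; congr enum_rank.
by case: (enum_val i) => x [y z].
Qed.

Lemma eq_enc f g : (forall x, f x = g x) -> enc f = enc g.
Proof. by move=> H; apply/rowP => i; rewrite !mxE H. Qed.

Lemma dec_is_linear c u v x : dec (c *: u + v) x = c *: dec u x + dec v x.
Proof. by apply/matrixP => y z; rewrite !mxE. Qed.

Lemma enc_is_linear c f g : enc (fun x => c *: f x + g x) = c *: enc f + enc g.
Proof. by apply/rowP => i; rewrite !mxE. Qed.

Lemma dec0 x : dec 0 x = 0.
Proof. by apply/matrixP => y z; rewrite !mxE. Qed.

Lemma decZ c u x : dec (c *: u) x = c *: dec u x.
Proof. by apply/matrixP => y z; rewrite !mxE. Qed.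

Lemma dec_inj u v : (forall x, dec u x = dec v x) -> u = v.
Proof. by move=> H; rewrite -(decK u) -(decK v); apply: eq_enc. Qed.

Lemma dec_sum I (r : seq I) (F : I -> 'rV[k]_#|mx_entries|) x :
  dec (\sum_(i <- r) F i) x = \sum_(i <- r) dec (F i) x.
Proof.
elim/big_rec2: _ => [|i u v _ <-]; first exact: dec0.
by rewrite -[F i]scale1r dec_is_linear !scale1r.
Qed.

End Encoding.

Section EulerForm.
Variables (k : closedFieldType) (Q : quiver).
Implicit Types A B X Y U V G : rep k Q.

Notation fam_enc A B :=
  (@enc k (Q0 Q) (fun a => repdim B a) (fun a => repdim A a)).
Notation fam_dec A B :=
  (@dec k (Q0 Q) (fun a => repdim B a) (fun a => repdim A a)).
Notation esp_enc A B :=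
  (@enc k (Q1 Q) (fun phi => repdim B (hd phi)) (fun phi => repdim A (tl phi))).
Notation esp_dec A B :=
  (@dec k (Q1 Q) (fun phi => repdim B (hd phi)) (fun phi => repdim A (tl phi))).

Definition cobound_mx A B :=
  \matrix_i esp_enc A B (cobound (fam_dec A B (delta_mx 0 i))).

Lemma mul_cobound_mx A B v :
  v *m cobound_mx A B = esp_enc A B (cobound (fam_dec A B v)).
Proof.
pose L u := esp_enc A B (cobound (fam_dec A B u)).
have linL c u w : L (c *: u + w) = c *: L u + L w.
  rewrite /L -enc_is_linear; apply: eq_enc => phi.
  rewrite /cobound !dec_is_linear mulmxDl mulmxDr -scalemxAl -scalemxAr scalerBr.
  by rewrite opprD addrACA.
have L0 : L 0 = 0 by have := linL (-1) 0 0; rewrite scaler0 addr0 scaleN1r addNr.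
rewrite -/(L v) [in RHS](row_sum_delta v) mulmx_sum_row.
elim/big_rec2: _ => [|i u w _ ->]; first by rewrite L0.
by rewrite linL rowK.
Qed.

(** The dimensions of Hom and Ext, by rank and nullity of the differential. *)
Definition hdim A B := (#|mx_entries (repdim B) (repdim A)| - \rank (cobound_mx A B))%N.
Definition edim A B :=
  (#|mx_entries (fun phi : Q1 Q => repdim B (hd phi)) (fun phi => repdim A (tl phi))|
   - \rank (cobound_mx A B))%N.

(** Euler characteristic of a two-term complex: the rank of the differential cancels. *)
Lemma euler_hdim A B : euler (repdim A) (repdim B) = (hdim A B)%:Z - (edim A B)%:Z.
Proof.
rewrite /hdim /edim -!subzn ?rank_leq_row ?rank_leq_col // opprD addrACA subrr subr0.
rewrite !card_mx_entries /euler -!(big_morph Posz PoszD (erefl 0)).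
by congr (_ - _); congr Posz; apply: eq_bigr => x _; rewrite mulnC.
Qed.

Lemma hom_vanishesP A B : hom_vanishes A B <-> hdim A B = 0%N.
Proof.
have -> : hdim A B = \rank (kermx (cobound_mx A B)) by rewrite mxrank_ker.
split=> [H|/eqP].
  apply/eqP; rewrite mxrank_eq0; apply/eqP/row_matrixP => i; rewrite row0.
  have K := mulmx_ker (cobound_mx A B).
  have {K}: row i (kermx (cobound_mx A B)) *m cobound_mx A B = 0 by rewrite -row_mul K row0.
  move: (row i _) => v Kv.
  apply: dec_inj => a; rewrite dec0; apply: (H (fam_dec A B v)); apply/is_homE => phi.
  by rewrite -(encK (cobound _) phi) -mul_cobound_mx Kv dec0.
rewrite mxrank_eq0 => /eqP K f /is_homE Hf a.
have : fam_enc A B f *m cobound_mx A B = 0.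
  rewrite mul_cobound_mx; apply: dec_inj => phi; rewrite encK dec0.
  by rewrite -[RHS](Hf phi) /cobound !encK.
by move/sub_kermxP; rewrite K submx0 => /eqP E; rewrite -(encK f) E dec0.
Qed.

Lemma ext0P A B : ext0 A B <-> edim A B = 0%N.
Proof.
split=> [H|/eqP].
  apply/eqP; rewrite subn_eq0 col_leq_rank -sub1mx; apply/row_subP => i.
  have [f Hf] := H (esp_dec A B (row i 1%:M)); apply/submxP.
  exists (fam_enc A B f); rewrite mul_cobound_mx; apply: dec_inj => phi.
  by rewrite encK -Hf /cobound !encK.
rewrite subn_eq0 col_leq_rank => full xi.
have /submxP [v Hv] : (esp_enc A B xi <= cobound_mx A B)%MS by apply: submx_full.
by exists (fam_dec A B v) => phi; rewrite -(encK xi) Hv mul_cobound_mx encK.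
Qed.

Lemma schur_hdim A : schur_indecomposable A -> hdim A A = 1%N.
Proof.
move=> [NZ S].
have -> : hdim A A = \rank (kermx (cobound_mx A A)) by rewrite mxrank_ker.
pose w := fam_enc A A (@fam_id k Q A).
have wK : (w <= kermx (cobound_mx A A))%MS.
  apply/sub_kermxP; rewrite mul_cobound_mx; apply: dec_inj => phi; rewrite encK dec0.
  by rewrite /cobound !encK mul1mx mulmx1 subrr.
suff -> : \rank (kermx (cobound_mx A A)) = \rank w.
  rewrite rank_rV; suff -> : w != 0 by [].
  apply/eqP => w0; apply: NZ => a.
  have := encK (@fam_id k Q A) a; rewrite -/w w0 dec0 /fam_id.
  case: (repdim A a) => // m /matrixP /(_ 0 0).
  by rewrite !mxE eqxx => /eqP; rewrite eq_sym oner_eq0.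
apply/eqP; rewrite eqn_leq !mxrankS //.
apply/row_subP => i; have : row i (kermx (cobound_mx A A)) *m cobound_mx A A = 0.
  by rewrite -row_mul mulmx_ker row0.
move: (row i _) => v Kv.
have [c Hc] : exists c : k, forall a, fam_dec A A v a = c%:M.
  by apply: S; apply/is_homE => phi; rewrite -(encK (cobound _) phi) -mul_cobound_mx Kv dec0.
apply/sub_rVP; exists c; apply: dec_inj => a.
by rewrite decZ encK Hc scalemx1.
Qed.

(* Representatives [c] of a basis of Ext(A, B). *)
Lemma ext_basis A B : exists c : 'I_(edim A B) -> ext_space A B,
  (forall f lam, (forall phi, cobound f phi = \sum_e lam e *: c e phi) ->
     forall e, lam e = 0) /\
  (forall eta : ext_space A B, exists f lam, forall phi,
     eta phi = cobound f phi + \sum_e lam e *: c e phi).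
Proof.
set F := cobound_mx A B.
(* A complement of the coboundaries maps isomorphically onto Ext([A], [B]); the rows of a basis of
   it serve as representatives. *)
have : edim A B = \rank (F^C)%MS by rewrite mxrank_compl.
move: (edim A B) => r er; subst r.
exists (fun e => esp_dec A B (row e (row_base (F^C)%MS))).
have sumE lam phi : \sum_e lam e *: esp_dec A B (row e (row_base (F^C)%MS)) phi =
    esp_dec A B ((\row_e lam e) *m row_base (F^C)%MS) phi.
  rewrite mulmx_sum_row dec_sum; apply: eq_bigr => e _.
  by rewrite decZ mxE.
split=> [f lam H e|eta].
  have E : fam_enc A B f *m F = (\row_e lam e) *m row_base (F^C)%MS.
    rewrite mul_cobound_mx; apply: dec_inj => phi; rewrite encK -sumE -H.
    by rewrite /cobound !encK.
  have : (fam_enc A B f *m F <= F :&: F^C)%MS.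
    by rewrite sub_capmx submxMl E (submx_trans (submxMl _ _)) // eq_row_base.
  rewrite capmx_compl submx0 E => /eqP l0.
  have : \row_e lam e = 0.
    by apply: (row_free_inj (row_base_free (F^C)%MS)); rewrite l0 mul0mx.
  by move/rowP/(_ e); rewrite !mxE.
have : (esp_enc A B eta <= F + F^C)%MS by apply: submx_full; apply: addsmx_compl_full.
rewrite -(adds_eqmx (eqmx_refl F) (eq_row_base (F^C)%MS)) => /sub_addsmxP [[u v] /= E].
exists (fam_dec A B u), (fun e => v 0 e) => phi.
rewrite sumE (_ : \row_e v 0 e = v); last by apply/rowP => e; rewrite mxE.
rewrite -(encK eta) E -[u *m F]scale1r dec_is_linear scale1r mul_cobound_mx encK.
by [].
Qed.

End EulerForm.

(** * Reflections *)

Section EulerBilinear.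
Variable Q : quiver.
Implicit Types al be ga : dimvec Q.

Lemma eq_euler al al' be be' : al =1 al' -> be =1 be' -> euler al be = euler al' be'.
Proof. by move=> Ha Hb; congr (_ - _); apply: eq_bigr => x _; rewrite Ha Hb. Qed.

Lemma euler_suml (I : finType) (c : I -> nat) (al : I -> dimvec Q) be :
  euler (fun a => \sum_i c i * al i a)%N be = \sum_i (c i)%:Z * euler (al i) be.
Proof.
have dist n (m : I -> nat) : (((\sum_i c i * m i) * n)%N%:Z = \sum_i (c i)%:Z * (m i * n)%N%:Z).
  rewrite big_distrl /= (big_morph Posz PoszD (erefl 0)); apply: eq_bigr => i _.
  by rewrite -mulnA PoszM.
rewrite /euler (eq_bigr _ (fun a _ => dist (be a) (fun i => al i a))).
rewrite (eq_bigr _ (fun phi _ => dist (be (hd phi)) (fun i => al i (tl phi)))).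
rewrite exchange_big [X in _ - X]exchange_big /= -sumrB; apply: eq_bigr => i _.
by rewrite mulrBr !big_distrr.
Qed.

Lemma euler_sumr (I : finType) (c : I -> nat) al (be : I -> dimvec Q) :
  euler al (fun a => \sum_i c i * be i a)%N = \sum_i (c i)%:Z * euler al (be i).
Proof.
have dist n (m : I -> nat) : ((n * (\sum_i c i * m i))%N%:Z = \sum_i (c i)%:Z * (n * m i)%N%:Z).
  rewrite big_distrr /= (big_morph Posz PoszD (erefl 0)); apply: eq_bigr => i _.
  by rewrite mulnCA PoszM.
rewrite /euler (eq_bigr _ (fun a _ => dist (al a) (fun i => be i a))).
rewrite (eq_bigr _ (fun phi _ => dist (al (tl phi)) (fun i => be i (hd phi)))).
rewrite exchange_big [X in _ - X]exchange_big /= -sumrB; apply: eq_bigr => i _.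
by rewrite mulrBr !big_distrr.
Qed.

Lemma eulerDr al be ga : euler al (fun a => be a + ga a)%N = euler al be + euler al ga.
Proof.
rewrite /euler addrACA -opprD -!big_split /=.
by congr (_ - _); apply: eq_bigr => x _; rewrite mulnDr PoszD.
Qed.

End EulerBilinear.

Section Reflection.
Variables (k : closedFieldType) (Q : quiver).
Implicit Types A B X Y U V G : rep k Q.

Definition exceptional G : Prop := schur_indecomposable G /\ ext0 G G.

Lemma euler_exceptional G : exceptional G -> euler (repdim G) (repdim G) = 1.
Proof.
by case=> S /ext0P e; rewrite (euler_hdim G G) (schur_hdim S) e.
Qed.

(** For a Schur representation the Euler form takes the value 1 - dim Ext([G], [G]). *)
Lemma schur_exceptional G :
  schur_indecomposable G -> euler (repdim G) (repdim G) = 1 -> exceptional G.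
Proof.
move=> S; rewrite (euler_hdim G G) (schur_hdim S) => E; split=> //.
apply/ext0P; move/eqP: E; rewrite -subr_eq0 addrAC subrr sub0r oppr_eq0.
by move/eqP => [].
Qed.

Lemma euler_Perp G X : Perp G X -> euler (repdim G) (repdim X) = 0.
Proof.
by case=> /hom_vanishesP h /ext0P e; rewrite (euler_hdim G X) h e.
Qed.

Lemma hom0_euler_ext0 G X : hom_vanishes G X ->
  euler (repdim G) (repdim X) = 0 -> ext0 G X.
Proof.
move=> /hom_vanishesP h; rewrite (euler_hdim G X) h sub0r => /eqP.
by rewrite oppr_eq0 => /eqP [] e; apply/ext0P.
Qed.

Lemma schur_inv V (f : fam V V) : schur_indecomposable V -> is_hom f ->
  ~ (forall a, f a = 0) -> exists2 c : k, c != 0 & forall a, f a = c%:M.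
Proof.
move=> [_ S] Hf f0; have [c fc] := S f Hf; exists c => //.
by apply/eqP => c0; apply: f0 => a; rewrite fc c0 -scalemx1 scale0r.
Qed.

Section OneReflection.
Variables (G : rep k Q) (EG : exceptional G).

(** The connecting map from End([G]), which consists of scalars, to Ext([G], [X]) sends the identity
    to the class of [xi]; it is injective when [xi] does not split. *)
Lemma hom0_nonsplit X (xi : ext_space G X) : hom_vanishes G X ->
  (forall f : fam G X, ~ (forall phi, cobound f phi = xi phi)) ->
  hom_vanishes G (extn xi).
Proof.
move=> hX nsplit f /is_homE Hf.
pose v : fam G G := fun a => dsubmx (f a).
have Hv : is_hom v.
  by apply/is_homE => phi; have := Hf phi; rewrite coboundr -col_mx0 => /eq_col_mx [].
have Hu phi : cobound (fun a => usubmx (f a) : 'M_(repdim X a, repdim G a)) phi = xi phi *m v (tl phi).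
  have := Hf phi; rewrite coboundr -col_mx0 => /eq_col_mx [/eqP].
  by rewrite subr_eq0 => /eqP.
have v0 : forall a, v a = 0.
  apply: NNPP => v0; have [c c0 vc] := schur_inv (proj1 EG) Hv v0.
  apply: (nsplit (fun a => c^-1 *: usubmx (f a))) => phi.
  rewrite /cobound -scalemxAl -scalemxAr -scalerBr; have := Hu phi; rewrite /cobound => ->.
  by rewrite vc mul_mx_scalar scalerA mulVf // scale1r.
move=> a; rewrite -[f a]vsubmxK [dsubmx _]v0 (hX (fun a => usubmx (f a))) ?col_mx0 //.
by apply/is_homE => phi; rewrite Hu v0 mulmx0.
Qed.

(* Every representation without maps from [G] reaches the perpendicular category
   of [G] through finitely many non-split extensions by [G]. *)
Lemma reflect_extn (R : rep k Q -> Prop) :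
  (forall X, Perp G X -> R X) ->
  (forall X (xi : ext_space G X), hom_vanishes G X -> R (extn xi) -> R X) ->
  forall X, hom_vanishes G X -> R X.
Proof.
move=> R0 RS X; have [n] := ubnP (edim G X); elim: n X => // n IH X le_n hX.
case: (classic (ext0 G X)) => [eX|neX]; first exact: R0.
have [xi nsplit] : exists xi : ext_space G X,
    forall f : fam G X, ~ (forall phi, cobound f phi = xi phi).
  apply: NNPP => H; apply: neX => xi; apply: NNPP => H'; apply: H; exists xi => f Hf.
  by apply: H'; exists f.
have hX' := hom0_nonsplit hX nsplit.
apply: (RS X xi hX); apply: IH => //.
(* The extension adds 1 to the Euler pairing with [G], and Hom stays zero, so the dimension of
   Ext([G], -) drops by 1. *)
have := euler_hdim G (extn xi); rewrite (proj1 (hom_vanishesP _ _) hX') sub0r.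
rewrite eulerDr (euler_exceptional EG) (euler_hdim G X) (proj1 (hom_vanishesP _ _) hX).
by move: le_n; lia.
Qed.

(** A map from [G] to the kernel gives a scalar endomorphism of [G] killed by the non-zero map [f],
    so the scalar is zero. *)
Lemma hom0_ker X (f : fam G X) (F : factorization f) : is_hom f ->
  ~ (forall a, f a = 0) -> hom_vanishes G (fKer F).
Proof.
move=> Hf f0 h Hh; have [i [Hi fi ci]] := factor_ker F.
have [_ S] := proj1 EG; have [c Hc] := S _ (is_hom_comp Hi Hh).
have c0 : c = 0.
  apply/eqP; apply/negP => /negP c0; apply: f0 => a.
  have E : c *: f a = 0.
    by rewrite -mul_mx_scalar -Hc /fam_comp mulmxA fi mul0mx.
  by rewrite -[f a]scale1r -(mulVf c0) -scalerA E scaler0.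
by move=> a; apply: (ci a); rewrite [LHS]Hc c0 -scalemx1 scale0r.
Qed.

(** Dividing out the image of a non-zero map from [G] lowers the total dimension, so after finitely
    many such steps no map from [G] is left. *)
Lemma reflect_quot (R : rep k Q -> Prop) :
  (forall X, hom_vanishes G X -> R X) ->
  (forall X (f : fam G X) (F : factorization f),
     hom_vanishes G (fKer F) -> R (fCok F) -> R X) ->
  forall X, R X.
Proof.
move=> R0 RS X; have [n] := ubnP (tdim X); elim: n X => // n IH X le_n.
case: (classic (hom_vanishes G X)) => [hX|nhX]; first exact: R0.
have [f Hf f0] : exists2 f : fam G X, is_hom f & ~ (forall a, f a = 0).
  by apply: NNPP => H; apply: nhX => f Hf; apply: NNPP => f0; apply: H; exists f.
have [F] := factorization_exists Hf; apply: (RS X f F); first exact: hom0_ker.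
apply: IH; rewrite -ltnS (leq_trans _ le_n) // ltnS (factor_tdimr F).
rewrite -{1}[tdim (fCok F)]add0n ltn_add2r lt0n; apply/eqP => /tdim_eq0 Z.
by apply: f0; apply: factor_im0 Z.
Qed.

(** [L] plays the role of the left adjoint of the inclusion of the perpendicular category, applied
    to [X]. It is described only by its effect on the vanishing of Ext and Hom; [C] is carried along
    so that the construction can be iterated. *)
Lemma reflection (C : rep k Q -> Prop) X : wide C -> C G -> C X ->
  exists L, [/\ C L, Perp G L,
    forall Y, Perp G Y -> ext0 X Y -> ext0 L Y
    & forall Y, Perp G Y -> hom_vanishes L Y -> hom_vanishes X Y].
Proof.
move=> WC CG; move: X; apply: reflect_quot => X.
  move=> hX CX; move: X hX CX; apply: reflect_extn => [X PX CX|X xi _ IH CX].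
    by exists X; split.
  have [L [CL PL eL hL]] := IH (wide_extn WC xi CX CG).
  exists L; split=> // Y PY.
    by move=> eX; apply: eL => //; apply: ext0_extnl => //; case: PY.
  move=> /(hL Y PY) hE f Hf a.
  (* A map from [X] extends to the extension because Ext(G, Y) = 0. *)
  have [_ eY] := PY; have [g Hg] := eY (fun phi => - (f (hd phi) *m xi phi)).
  have := hE (fun a => row_mx (f a) (g a)); rewrite -[f a](row_mxKl _ (g a)) => -> //.
    by rewrite -row_mx0 row_mxKl.
  apply/is_homE => phi; rewrite coboundl /cobound !row_mxKl !row_mxKr Hf subrr.
  by have := Hg phi; rewrite /cobound => ->; rewrite subrr row_mx0.
(* The image of [f] is a quotient of [G], hence has no maps to [Y]. Thus Ext(coker, [Y]) embeds into
   Ext([X], [Y]), and maps from [X] to [Y] factor through the cokernel. *)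
move=> f F hK IH CX; have [_ CI CC] := wide_factor WC F CG CX.
have [L [CL PL eL hL]] := IH CC; exists L; split=> // Y PY.
  move=> eX; apply: eL => //; apply: (ext0_quo (xi := feta F)).
    by apply: hom0_extn_quo (hom0_isol (factor_isol F) _); case: PY.
  exact: ext0_isol (factor_isor F) eX.
move=> /(hL Y PY) hC; apply: (hom0_isol (isomorphic_sym (factor_isor F))).
apply: hom0_extnl => //.
by apply: hom0_extn_quo (hom0_isol (factor_isol F) _); case: PY.
Qed.

Definition ldim (l : Q0 Q -> rat) X : rat := \sum_a l a * (repdim X a)%:R.

Lemma ldim_extn l A B (xi : ext_space B A) : ldim l (extn xi) = ldim l A + ldim l B.
Proof. by rewrite /ldim -big_split; apply: eq_bigr => a _; rewrite natrD mulrDr. Qed.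

Lemma ldim_isomorphic l A B : isomorphic A B -> ldim l A = ldim l B.
Proof. by move=> /isomorphic_dim H; apply: eq_bigr => a _; rewrite H. Qed.

(** A non-split extension by [G] does not change the value of [l]. In a quotient step the image has
    the class of [G] minus the kernel, and the kernel has no maps from [G], so it is covered by the
    first case. *)
Lemma ldim_reflect l (C : rep k Q -> Prop) : wide C -> C G -> ldim l G = 0 ->
  (forall X, C X -> Perp G X -> ldim l X = 0) -> forall X, C X -> ldim l X = 0.
Proof.
move=> WC CG lG lP.
have lh X : hom_vanishes G X -> C X -> ldim l X = 0.
  move: X; apply: reflect_extn => [X PX CX|X xi _ IH CX]; first exact: lP.
  by have := IH (wide_extn WC xi CX CG); rewrite ldim_extn lG addr0.
apply: reflect_quot => [X hX|X f F hK IH] CX; first exact: lh.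
have [CK CI CC] := wide_factor WC F CG CX.
rewrite (ldim_isomorphic l (factor_isor F)) ldim_extn (IH CC) addr0.
have := lG; rewrite (ldim_isomorphic l (factor_isol F)) ldim_extn (lh _ hK CK).
by rewrite add0r.
Qed.

End OneReflection.
End Reflection.

(** * Exceptional sequences *)

Section ExceptionalSequences.
Variables (k : closedFieldType) (Q : quiver).
Implicit Types A B X Y U V G T : rep k Q.
Implicit Types gs ts : seq (rep k Q).

(* The usual order of an exceptional sequence is reversed: the head of the list
   is perpendicular to all later entries. *)
Fixpoint exc gs : Prop :=
  if gs is G :: gs' then [/\ exceptional G, perp gs' G & exc gs'] else True.

Local Notation rnth := (nth (zero_rep k Q)).

Lemma perp_nth gs V i : perp gs V -> (i < size gs)%N -> Perp (rnth gs i) V.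
Proof. by elim: gs i => [|G gs IH] [|i] //= [P0 P1] // lt_i; apply: IH. Qed.

Lemma exc_nth gs i : exc gs -> (i < size gs)%N -> exceptional (rnth gs i).
Proof. by elim: gs i => [|G gs IH] [|i] //= [E _ X] // lt_i; apply: IH. Qed.

Lemma exc_nth_Perp gs i j : exc gs -> (i < j < size gs)%N -> Perp (rnth gs j) (rnth gs i).
Proof.
elim: gs i j => [|G gs IH] i j; first by rewrite ltn0 andbF.
by case: i j => [|i] [|j] //= [E P X] lt_j; [apply: perp_nth | apply: IH].
Qed.

(** The coefficients of the linear form [euler al] on dimension vectors. *)
Definition euler_form (al : dimvec Q) (a : Q0 Q) : rat :=
  (al a)%:R - \sum_(phi | hd phi == a) (al (tl phi))%:R.

Lemma ldim_euler al X : ldim (euler_form al) X = (euler al (repdim X))%:~R.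
Proof.
rewrite /ldim /euler rmorphB /= !rmorph_sum /=.
rewrite (eq_bigr _ (fun a _ => mulrBl _ _ _)) sumrB; congr (_ - _).
  by apply: eq_bigr => a _; rewrite -natrM.
rewrite (partition_big (@hd Q) predT) //=; apply: eq_bigr => a _.
rewrite big_distrl; apply: eq_bigr => phi /eqP <-.
by rewrite /= -natrM.
Qed.

Definition dim_mx gs : 'M[rat]_(size gs, #|Q0 Q|) :=
  \matrix_(i, a) (repdim (rnth gs i) (enum_val a))%:R.

Lemma dim_mx_mul gs (l : Q0 Q -> rat) i :
  (dim_mx gs *m \col_a l (enum_val a)) i 0 = ldim l (rnth gs i).
Proof.
rewrite mxE /ldim (reindex _ (onW_bij _ (@enum_val_bij (Q0 Q)))) /=.
by apply: eq_bigr => a _; rewrite !mxE mulrC.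
Qed.

(** The Gram matrix is triangular with unit diagonal, hence invertible, and it factors through a
    space of dimension [#|Q0 Q|]. *)
Lemma exc_size gs : exc gs -> (size gs <= #|Q0 Q|)%N.
Proof.
move=> E; pose L := \matrix_(a < #|Q0 Q|, j < size gs) euler_form (repdim (rnth gs j)) (enum_val a).
have gram i j : (dim_mx gs *m L) i j = (euler (repdim (rnth gs j)) (repdim (rnth gs i)))%:~R.
  rewrite -ldim_euler -dim_mx_mul !mxE; apply: eq_bigr => a _.
  by rewrite !mxE.
have trig : is_trig_mx (dim_mx gs *m L).
  apply/is_trig_mxP => i j lt_ij; rewrite gram (euler_Perp (exc_nth_Perp E _)) //.
  by rewrite lt_ij ltn_ord.
have : dim_mx gs *m L \in unitmx.
  rewrite unitmxE (det_trig trig) big1 ?unitr1 // => i _.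
  by rewrite gram euler_exceptional //; apply: exc_nth.
move/mxrank_unit => rk; rewrite -{1}rk (leq_trans (mxrankM_maxl _ _)) //.
exact: rank_leq_col.
Qed.

Lemma ldim_perp gs l : exc gs -> (forall i, (i < size gs)%N -> ldim l (rnth gs i) = 0) ->
  (forall X, perp gs X -> ldim l X = 0) -> forall X, ldim l X = 0.
Proof.
elim: gs => [|G gs IH] /= => [_ _ H X|[EG PG E] lg H]; first exact: H.
apply: IH => // [i lt_i|]; first exact: (lg i.+1).
apply: (ldim_reflect EG (wide_perp gs) PG (lg 0%N _)) => // X PX GX.
exact: H.
Qed.

Definition simp (z : Q0 Q) : rep k Q := @Rep k Q (fun a => (a == z) : nat) (fun _ => 0).

(** With fewer dimension vectors than vertices, a non-zero linear form would vanish on the sequence,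
    hence on all representations, in particular on each [simp z]. *)
Lemma perp_zero_size gs : exc gs -> (forall X, perp gs X -> is_zero X) ->
  (#|Q0 Q| <= size gs)%N.
Proof.
move=> E Z; rewrite leqNgt; apply/negP => lt_s.
have : kermx (dim_mx gs)^T != 0.
  rewrite -mxrank_eq0 mxrank_ker mxrank_tr -lt0n subn_gt0.
  exact: leq_ltn_trans (rank_leq_row _) lt_s.
case/rowV0Pn => v /sub_kermxP Dv v0; case/negP: v0.
pose l a := v 0 (enum_rank a).
have vE : v = (\col_a l (enum_val a))^T.
  by apply/rowP => a; rewrite !mxE /l enum_valK.
have lX : forall X, ldim l X = 0.
  apply: (ldim_perp E) => [i lt_i|X PX].
    rewrite -(dim_mx_mul l (Ordinal lt_i)) -[_ *m _]trmxK trmx_mul -vE Dv.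
    by rewrite !mxE.
  by apply: big1 => a _; rewrite (Z X PX a) mulr0.
apply/eqP/rowP => a; rewrite mxE.
have := lX (simp (enum_val a)); rewrite /ldim (bigD1 (enum_val a)) //= eqxx mulr1.
rewrite big1 ?addr0 => [|b nb]; last by rewrite (negPf nb) mulr0.
by rewrite /l enum_valK.
Qed.

Lemma perp_reflection gs X : exc gs -> exists L, [/\ perp gs L,
    forall Y, perp gs Y -> ext0 X Y -> ext0 L Y
    & forall Y, perp gs Y -> hom_vanishes L Y -> hom_vanishes X Y].
Proof.
elim: gs => [|G gs IH] /= => [_|[EG PG E]]; first by exists X; split.
have [L [PL eL hL]] := IH E.
have [M [CM PM eM hM]] := reflection EG (wide_perp gs) PG PL.
exists M; split=> // Y [PY CY] H; first exact/eM/eL.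
exact/hL/hM.
Qed.

Hypothesis acQ : acyclic Q.

(** The height counts the vertices reachable from [a]. It drops strictly along an arrow, as
    otherwise the tail could be reached from the head, which closes a cycle. *)
Lemma acyclic_height : exists h : Q0 Q -> nat, forall phi, (h (hd phi) < h (tl phi))%N.
Proof.
exists (fun a => #|connect (@adj Q) a|) => phi.
have adj_phi : adj (tl phi) (hd phi) by apply/existsP; exists phi; rewrite !eqxx.
apply: proper_card; apply/properP; split.
  by apply/subsetP => b; apply: connect_trans; apply: connect1.
exists (tl phi); first exact: connect0.
apply/negP => /connectP [p pth lst].
suff : hd phi :: p = [::] by [].
by apply: acQ; rewrite /= rcons_path pth -lst.
Qed.

Lemma perp_support_bottom gs : (exists2 Y, perp gs Y & ~ is_zero Y) ->
  exists z : Q0 Q, (exists2 Y, perp gs Y & repdim Y z != 0%N) /\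
    forall phi Y, tl phi = z -> perp gs Y -> repdim Y (hd phi) = 0%N.
Proof.
move=> [Y0 P0 N0]; have [h hP] := acyclic_height.
have [z0 Hz0] : exists z, exists2 Y, perp gs Y & repdim Y z != 0%N.
  apply: NNPP => H; apply: N0 => a; apply/eqP; apply: contraT => N.
  by case: H; exists a, Y0.
have [n] := ubnP (h z0); elim: n z0 Hz0 => // n IH z Hz le_n.
case: (classic (exists phi Y, [/\ tl phi = z, perp gs Y & repdim Y (hd phi) != 0%N])).
  move=> [phi [Y [tz PY N]]]; apply: (IH (hd phi)); first by exists Y.
  by rewrite -ltnS (leq_trans _ le_n) // ltnS -tz.
move=> H; exists z; split=> // phi Y tz PY; apply/eqP; apply: contraT => N.
by case: H; exists phi, Y.
Qed.

Lemma perp_projective gs : exc gs -> (exists2 Y, perp gs Y & ~ is_zero Y) ->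
  exists P, [/\ perp gs P, ~ is_zero P & forall Y, perp gs Y -> ext0 P Y].
Proof.
move=> E /perp_support_bottom [z [[Y PY Yz] below]].
(* An arrow out of [z] ends where [V] is zero, and any other arrow starts where [simp z] is zero, so
   there are no non-zero cocycles. *)
have eS V : perp gs V -> ext0 (simp z) V.
  move=> PV xi; exists (fun=> 0) => phi.
  case: (eqVneq (tl phi) z) => [tz|nz]; first exact/mx_dim0l/below.
  by apply: mx_dim0r; rewrite /= (negPf nz).
have hS : ~ hom_vanishes (simp z) Y.
  move=> H; pose f : fam (simp z) Y := fun a => const_mx 1.
  have /H /(_ z) : is_hom f.
    move=> phi; case: (eqVneq (tl phi) z) => [tz|nz]; first exact/mx_dim0l/below.
    by apply: mx_dim0r; rewrite /= (negPf nz).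
  rewrite /f; move: Yz; rewrite -lt0n => lt0 /matrixP.
  have lt1 : (0 < repdim (simp z) z)%N by rewrite /= eqxx.
  by move/(_ (Ordinal lt0) (Ordinal lt1)); rewrite !mxE => /eqP; rewrite oner_eq0.
have [P [PP eP hP]] := perp_reflection (simp z) E.
exists P; split=> // [Z|V PV]; last by apply: eP (eS V PV).
(* Were [P] zero, the vanishing of Hom([P], [Y]) would carry over to Hom([simp z], [Y]). *)
by apply: hS; apply: hP => //; apply: is_zero_hom0l.
Qed.

Lemma perp_simple_projective gs : exc gs -> (exists2 Y, perp gs Y & ~ is_zero Y) ->
  exists T, simple_in (perp gs) T /\ forall Y, perp gs Y -> ext0 T Y.
Proof.
move=> E /(perp_projective E) [P [PP NP eP]].
have WC := wide_perp gs.
have [n] := ubnP (tdim P); elim: n P PP NP eP => // n IH P PP NP eP le_n.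
case: (classic (simple_in (perp gs) P)) => [S|NS]; first by exists P.
have [U [f [CU Hf M NU NI]]] : exists U (f : fam U P),
    [/\ perp gs U, is_hom f, mono_in (perp gs) f, ~ is_zero U & ~ is_iso f].
  apply: NNPP => H; apply: NS; split=> // U f CU Hf M.
  case: (classic (is_zero U)) => [|NU]; first by left.
  right; apply: NNPP => NI; apply: H; exists U, f; by split.
have [F] := factorization_exists Hf.
have ZK := mono_ker WC F CU PP M.
have ltU : (tdim U < tdim P)%N.
  rewrite (factor_tdiml F) (factor_tdimr F) (proj2 (tdim_eq0 _) ZK) add0n.
  rewrite -{1}[tdim (fIm F)]addn0 ltn_add2l lt0n; apply/eqP => Z.
  by apply: NI; apply: (factor_iso (F := F)) => //; apply/tdim_eq0.
apply: (IH U) => // [Y PY|]; last exact: leq_trans ltU le_n.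
apply: (ext0_isol (isomorphic_sym (factor_isol F))).
apply: ext0_extnl; first exact: is_zero_ext0l.
by apply: ext0_extn_sub (ext0_isol (factor_isor F) (eP Y PY)).
Qed.

(** On [perp gs] the group Ext([T], -) is zero, so being perpendicular to [T] only means having no
    maps from [T]. This passes to subobjects and holds for every simple object other than [T]. Hence
    the simple objects of [perp (T :: gs)] are the remaining ones of [perp gs], and [T] comes first
    in the order. *)
Lemma perp_simples gs : exc gs -> exists ts, [/\
  (size ts + size gs = #|Q0 Q|)%N,
  forall i, (i < size ts)%N -> simple_in (perp gs) (rnth ts i),
  forall V, simple_in (perp gs) V -> exists2 i, (i < size ts)%N & isomorphic V (rnth ts i),
  forall i j, (i < j < size ts)%N -> hom_vanishes (rnth ts i) (rnth ts j)
  & forall i j, (i <= j < size ts)%N -> ext0 (rnth ts i) (rnth ts j)].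
Proof.
have [n] := ubnP (#|Q0 Q| - size gs); elim: n gs => // n IH gs le_n E.
case: (classic (exists2 Y, perp gs Y & ~ is_zero Y)) => [NZ|Z]; last first.
  have {}Z Y : perp gs Y -> is_zero Y.
    by move=> PY; apply: NNPP => NY; apply: Z; exists Y.
  exists [::]; split=> [|i|V [CV NV _]|i j|i j]; rewrite ?ltn0 ?andbF //.
    by apply/eqP; rewrite eqn_leq exc_size //= perp_zero_size.
  by case: NV; apply: Z.
have [T [ST eT]] := perp_simple_projective E NZ.
have [CT NT _] := ST.
have E' : exc (T :: gs).
  by split; [split; [exact: (simple_schur (wide_perp gs) ST) | exact: eT] | |].
have := exc_size E' => /= lt_s.
have [||ts [sz S cplt hts ets]] := IH (T :: gs) => //.
  by rewrite -ltnS (leq_trans _ le_n) //= subnS ltnS prednK ?subn_gt0.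
have PT i : (i < size ts)%N -> Perp T (rnth ts i) /\ perp gs (rnth ts i).
  by move=> lt_i; have [] := S i lt_i.
exists (T :: ts); split=> /=.
- by rewrite -sz /= addSnnS.
- move=> [|i] //=; rewrite ltnS => lt_i.
  have [[PTi Ci] Ni Si] := S i lt_i; split=> // U f CU Hf Mf.
  apply: Si => //; last by move=> X g h [_ CX]; apply: Mf.
  have [F] := factorization_exists Hf.
  have ZK := mono_ker (wide_perp gs) F CU Ci Mf.
  split=> //; split; last exact: eT.
  move=> h Hh a; apply: (factor_mono ZK).
  exact: (proj1 PTi _ (is_hom_comp Hf Hh)).
- move=> V SV; have [CV NV MV] := SV.
  case: (classic (isomorphic V T)) => [VT|NVT]; first by exists 0%N.
  have hTV : hom_vanishes T V.
    by apply: (simple_hom0 (wide_perp gs)) => // TV; apply/NVT/isomorphic_sym.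
  have CV' : perp (T :: gs) V by split=> //; split=> //; apply: eT.
  have [|i lt_i Vi] := cplt V; last by exists i.+1.
  split=> // U f CU Hf Mf; have [F] := factorization_exists Hf.
  have ZK := mono_ker (wide_perp (T :: gs)) F CU CV' Mf.
  apply: MV => //; first by case: CU.
  exact/cancel_mono/(factor_mono ZK).
- move=> [|i] [|j] //= lt_ij; last exact: hts.
  by have [[]] := PT j lt_ij.
- move=> [|i] [|j] //= lt_ij; last exact: ets.
    exact: eT.
  by apply: eT; have [] := PT j lt_ij.
Qed.

End ExceptionalSequences.

(** * Representations of the Ext-quiver *)

Section Orthogonality.
Variables (k : fieldType) (I : finType) (b d : I -> nat) (n : nat).
Variables (rn : forall i, 'I_(b i) -> 'M[k]_(n, d i)) (ro : forall i, 'I_(b i) -> 'M[k]_(d i, n)).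
Hypothesis ron : forall i (u v : 'I_(b i)), ro u *m rn v = (u == v)%:R%:M.
Hypothesis ron0 : forall i j (u : 'I_(b i)) (v : 'I_(b j)), i != j -> ro u *m rn v = 0.

(** Extracts a coefficient in a direct sum decomposition with inclusions [rn] and projections
    [ro]. *)
Lemma ortho_row i (u : 'I_(b i)) p (F : forall j, 'I_(b j) -> 'M[k]_(d j, p)) :
  ro u *m (\sum_j \sum_v rn v *m F j v) = F i u.
Proof.
rewrite mulmx_sumr (bigD1 i) //= [X in _ + X]big1 ?addr0; last first.
  move=> j nj; rewrite mulmx_sumr big1 // => v _.
  by rewrite mulmxA ron0 ?mul0mx // eq_sym.
rewrite mulmx_sumr (bigD1 u) //= big1 ?addr0; last first.
  by move=> v nv; rewrite mulmxA ron eq_sym (negPf nv) -scalemx1 scale0r mul0mx.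
by rewrite mulmxA ron eqxx mul1mx.
Qed.

Lemma ortho_col i (u : 'I_(b i)) p (F : forall j, 'I_(b j) -> 'M[k]_(p, d j)) :
  (\sum_j \sum_v F j v *m ro v) *m rn u = F i u.
Proof.
rewrite mulmx_suml (bigD1 i) //= [X in _ + X]big1 ?addr0; last first.
  by move=> j nj; rewrite mulmx_suml big1 // => v _; rewrite -mulmxA ron0 ?mulmx0.
rewrite mulmx_suml (bigD1 u) //= big1 ?addr0; last first.
  by move=> v nv; rewrite -mulmxA ron (negPf nv) -scalemx1 scale0r mulmx0.
by rewrite -mulmxA ron eqxx mulmx1.
Qed.

End Orthogonality.

Section Realization.
Variables (k : closedFieldType) (Q : quiver) (m : nat) (T : 'I_m -> rep k Q).
Variables (r : 'I_m -> 'I_m -> nat).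
Variable (c : forall i j, 'I_(r i j) -> ext_space (T i) (T j)).
Implicit Types (i j : 'I_m).

Let Sg := arrows_quiver r.

Definition arw i j (e : 'I_(r i j)) : Q1 Sg :=
  Tagged (fun kl : 'I_m * 'I_m => 'I_(r kl.1 kl.2)) (e : 'I_(r (i, j).1 (i, j).2)).

Definition atw (U V : rep k Sg) (xi : ext_space U V) i j (e : 'I_(r i j)) :
  'M[k]_(repdim V j, repdim U i) := xi (arw e).

Definition act (V : rep k Sg) i j (e : 'I_(r i j)) : 'M[k]_(repdim V j, repdim V i) :=
  arr V (arw e).

(* [X] is the sum of the [T i], one copy for each basis vector of [V] at [i], with
   the copies glued along the extensions [c] as prescribed by the arrows of [V]. *)
Record realization (V : rep k Sg) (X : rep k Q) := Realization {
  rin : forall i, 'I_(repdim V i) -> fam (T i) X;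
  rout : forall i, 'I_(repdim V i) -> fam X (T i);
  routin : forall i u v a, rout (i := i) u a *m rin v a = (u == v)%:R%:M;
  routin0 : forall i j u v a, i != j -> rout (i := i) u a *m rin (i := j) v a = 0;
  rinout : forall a, \sum_i \sum_u rin (i := i) u a *m rout u a = 1%:M;
  arr_rin : forall phi i u,
    arr X phi *m rin (i := i) u (tl phi) = rin u (hd phi) *m arr (T i) phi +
      \sum_j \sum_(v < repdim V j) \sum_(e < r i j)
        act V e v u *: (rin (i := j) v (hd phi) *m c e phi) }.

Section OneRealization.
Variables (V : rep k Sg) (X : rep k Q) (R : realization V X).

Lemma rout_sum i (u : 'I_(repdim V i)) a n (F : forall j, 'I_(repdim V j) -> 'M[k]_(_, n)) :
  rout R u a *m (\sum_j \sum_v rin R v a *m F j v) = F i u.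
Proof.
apply: (ortho_row (ro := fun i u => rout R u a) (rn := fun i u => rin R u a)) => [j v w|j j' v w].
  exact: routin.
exact: routin0.
Qed.

Lemma rin_sum i (u : 'I_(repdim V i)) a n (F : forall j, 'I_(repdim V j) -> 'M[k]_(n, _)) :
  (\sum_j \sum_v F j v *m rout R v a) *m rin R u a = F i u.
Proof.
apply: (ortho_col (ro := fun i u => rout R u a) (rn := fun i u => rin R u a)) => [j v w|j j' v w].
  exact: routin.
exact: routin0.
Qed.

Lemma rin_decomp a n (M : 'M[k]_(n, repdim X a)) :
  M = \sum_i \sum_u (M *m rin R u a) *m rout R (i := i) u a.
Proof.
rewrite -{1}[M]mulmx1 -(rinout R) mulmx_sumr; apply: eq_bigr => i _.
by rewrite mulmx_sumr; apply: eq_bigr => u _; rewrite mulmxA.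
Qed.

Lemma rout_decomp a n (M : 'M[k]_(repdim X a, n)) :
  M = \sum_i \sum_u rin R u a *m (rout R (i := i) u a *m M).
Proof.
rewrite -{1}[M]mul1mx -(rinout R) mulmx_suml; apply: eq_bigr => i _.
by rewrite mulmx_suml; apply: eq_bigr => u _; rewrite mulmxA.
Qed.

Lemma rin_inj a n (M N : 'M[k]_(n, repdim X a)) :
  (forall i (u : 'I_(repdim V i)), M *m rin R u a = N *m rin R u a) -> M = N.
Proof.
move=> H; rewrite [M]rin_decomp [N]rin_decomp.
by apply: eq_bigr => i _; apply: eq_bigr => u _; rewrite H.
Qed.

(** The counterpart of [arr_rin] for the projections; both sides are compared on every inclusion. *)
Lemma rout_arr phi i (u : 'I_(repdim V i)) :
  rout R u (hd phi) *m arr X phi = arr (T i) phi *m rout R u (tl phi) +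
    \sum_j \sum_(v < repdim V j) \sum_(e < r j i)
      act V e u v *: (c e phi *m rout R (i := j) v (tl phi)).
Proof.
apply: rin_inj => j v; rewrite mulmxDl -mulmxA arr_rin mulmxDr.
have -> : rout R u (hd phi) *m (rin R v (hd phi) *m arr (T j) phi) =
    arr (T i) phi *m rout R u (tl phi) *m rin R v (tl phi).
  rewrite -mulmxA mulmxA; case: (eqVneq i j) => [ij|nij]; last first.
    by rewrite !routin0 // mul0mx mulmx0.
  by subst j; rewrite !routin mul_scalar_mx mul_mx_scalar.
congr (_ + _).
pose F j' (w : 'I_(repdim V j')) := \sum_(e < r j j') act V e w v *: c e phi.
rewrite (eq_bigr (fun j' => \sum_w rin R w (hd phi) *m F j' w)); last first.
  move=> j' _; apply: eq_bigr => w _; rewrite /F mulmx_sumr.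
  by apply: eq_bigr => e _; rewrite scalemxAr.
rewrite rout_sum /F.
pose F' j' (w : 'I_(repdim V j')) := \sum_(e < r j' i) act V e u w *: c e phi.
rewrite (eq_bigr (fun j' => \sum_w F' j' w *m rout R w (tl phi))); last first.
  move=> j' _; apply: eq_bigr => w _; rewrite /F' mulmx_suml.
  by apply: eq_bigr => e _; rewrite scalemxAl.
by rewrite rin_sum.
Qed.

Lemma realization_iso Y : isomorphic X Y -> inhabited (realization V Y).
Proof.
case=> f [Hf [g [Hg K]]]; constructor.
apply: (@Realization V Y (fun i u => fam_comp f (rin R u)) (fun i u => fam_comp (rout R u) g)).
- by move=> i u v a; rewrite /fam_comp mulmxA -(mulmxA _ (g a)) (proj1 (K a)) mulmx1 routin.
- by move=> i j u v a nij; rewrite /fam_comp mulmxA -(mulmxA _ (g a)) (proj1 (K a)) mulmx1 routin0.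
- move=> a; rewrite -(proj2 (K a)) -[X in _ = X *m _]mulmx1 -(rinout R) mulmx_sumr mulmx_suml.
  apply: eq_bigr => i _; rewrite mulmx_sumr mulmx_suml; apply: eq_bigr => u _.
  by rewrite /fam_comp !mulmxA.
- move=> phi i u; rewrite /fam_comp mulmxA -Hf -mulmxA arr_rin mulmxDr mulmxA; congr (_ + _).
  rewrite mulmx_sumr; apply: eq_bigr => j _; rewrite mulmx_sumr; apply: eq_bigr => v _.
  by rewrite mulmx_sumr; apply: eq_bigr => e _; rewrite -scalemxAr mulmxA.
Qed.

End OneRealization.

Lemma realization_zero V X : is_zero V -> is_zero X -> inhabited (realization V X).
Proof.
move=> ZV ZX; constructor.
apply: (@Realization V X (fun i u a => 0) (fun i u a => 0)).
- by move=> i u; exfalso; case: u => x; rewrite ZV.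
- by move=> i j u; exfalso; case: u => x; rewrite ZV.
- by move=> a; apply: mx_dim0l.
- by move=> phi i u; exfalso; case: u => x; rewrite ZV.
Qed.

Lemma realization_simp i : inhabited (realization (simp k (i : Q0 Sg)) (T i)).
Proof.
constructor.
(* [pid_mx] stands for the identity; it is also well typed at [j != i], where no basis vectors
   exist. *)
apply: (@Realization (simp k (i : Q0 Sg)) (T i)
  (fun j u a => (j == i)%:R *: pid_mx (repdim (T i) a))
  (fun j u a => (j == i)%:R *: pid_mx (repdim (T i) a))).
- move=> j /= u v a; have : (0 < (j == i))%N by case: u => x; apply: leq_trans.
  rewrite lt0b => /eqP ji; subst j.
  move: u v; rewrite /= eqxx => u v; rewrite !scale1r !pid_mx_1 mulmx1.
  by rewrite !ord1 eqxx.
- move=> j j' /= u v a; have : (0 < (j == i))%N by case: u => x; apply: leq_trans.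
  have : (0 < (j' == i))%N by case: v => x; apply: leq_trans.
  by rewrite !lt0b => /eqP -> /eqP ->; rewrite eqxx.
- move=> a; rewrite (bigD1 i) //= [X in _ + X]big1 ?addr0; last first.
    by move=> j nj; rewrite (negPf nj) big_ord0.
  by rewrite eqxx big_ord1 !scale1r !pid_mx_1 mulmx1.
- move=> phi j u /=; have : (0 < (j == i))%N by case: u => x; apply: leq_trans.
  rewrite lt0b => ji; rewrite [X in _ + X]big1 ?addr0; last first.
    move=> j' _; rewrite big1 // => v _; rewrite big1 // => e _.
    by rewrite /act mxE scale0r.
  by rewrite ji; move/eqP: ji => ji; subst j; rewrite !scale1r !pid_mx_1 mulmx1 mul1mx.
Qed.

Definition realized_dim (V : dimvec Sg) : dimvec Q :=
  fun a => (\sum_i V i * repdim (T i) a)%N.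

(** The coordinates of [X] at [a] are triples of a vertex [i], a basis vector of [V] at [i] and a
    coordinate of [T i] at [a]. The arrows are then dictated by [arr_rin]. *)
Lemma realization_exists V : exists2 X, inhabited (realization V X) &
  repdim X =1 realized_dim (repdim V).
Proof.
pose E a := mx_entries (repdim V) (fun i : 'I_m => repdim (T i) a).
pose tg a i (u : 'I_(repdim V i)) y : E a :=
  Tagged (fun i : 'I_m => ('I_(repdim V i) * 'I_(repdim (T i) a))%type) (u, y).
pose rn i (u : 'I_(repdim V i)) a : 'M[k]_(#|E a|, repdim (T i) a) :=
  \matrix_(x, y) (enum_val x == tg a i u y)%:R.
pose ro i (u : 'I_(repdim V i)) a := (rn i u a)^T.
have ronE i j (u : 'I_(repdim V i)) (v : 'I_(repdim V j)) a y z :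
    (ro i u a *m rn j v a) y z = (tg a i u y == tg a j v z)%:R.
  rewrite mxE (bigD1 (enum_rank (tg a i u y))) //= !mxE enum_rankK eqxx mul1r.
  rewrite big1 ?addr0 // => x nx; rewrite !mxE (_ : enum_val x == _ = false) ?mul0r //.
  by apply/negbTE; apply: contraNneq nx => <-; rewrite enum_valK.
have ron i (u v : 'I_(repdim V i)) a : ro i u a *m rn i v a = (u == v)%:R%:M.
  apply/matrixP => y z; rewrite ronE !mxE eq_Tagged /= xpair_eqE.
  by case: eqP => _ //=; rewrite ?mul0rn.
have ron0 i j (u : 'I_(repdim V i)) (v : 'I_(repdim V j)) a : i != j ->
    ro i u a *m rn j v a = 0.
  move=> nij; apply/matrixP => y z; rewrite ronE !mxE.
  by case: eqP => // /(congr1 (@tag _ _)) /= ij; rewrite ij eqxx in nij.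
have nro a : \sum_i \sum_u rn i u a *m ro i u a = 1%:M.
  apply/matrixP => x x'.
  transitivity (\sum_(p : E a) (enum_val x == p)%:R * (enum_val x' == p)%:R : k).
    pose J i : finType := ('I_(repdim V i) * 'I_(repdim (T i) a))%type.
    pose H (p : E a) := (enum_val x == p)%:R * (enum_val x' == p)%:R : k.
    transitivity (\sum_i \sum_(q : J i) H (Tagged J q)); last first.
      rewrite (sig_big_dep xpredT (fun _ _ => true) (fun i (q : J i) => H (Tagged J q))) /=.
      by apply: eq_bigr => [[i q]] _.
    rewrite summxE; apply: eq_bigr => i _; rewrite summxE.
    transitivity (\sum_u \sum_y H (tg a i u y)).
      by apply: eq_bigr => u _; rewrite mxE; apply: eq_bigr => y _; rewrite !mxE.
    by rewrite pair_big /=; apply: eq_bigr => [[u y]] _.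
  rewrite (bigD1 (enum_val x)) //= eqxx mul1r big1 ?addr0.
    by rewrite mxE (inj_eq enum_val_inj) eq_sym.
  by move=> p np; rewrite eq_sym (negPf np) mul0r.
pose X := @Rep k Q (fun a => #|E a|) (fun phi =>
  \sum_i \sum_u (rn i u (hd phi) *m arr (T i) phi +
      \sum_j \sum_(v < repdim V j) \sum_(e < r i j)
        act V e v u *: (rn j v (hd phi) *m c e phi)) *m ro i u (tl phi)).
exists X; last by move=> a; rewrite /= card_mx_entries.
constructor; apply: (@Realization V X rn ro) => // phi i u.
apply: (ortho_col (ro := fun i u => ro i u (tl phi)) (rn := fun i u => rn i u (tl phi))
  _ _ u (fun i u => rn i u (hd phi) *m arr (T i) phi + \sum_j \sum_(v < repdim V j)
     \sum_(e < r i j) act V e v u *: (rn j v (hd phi) *m c e phi))) => [j v w|j j' v w].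
  exact: ron.
exact: ron0.
Qed.

End Realization.

(** * The functor on morphisms and extensions *)

Section RealizedMorphisms.
Variables (k : closedFieldType) (Q : quiver) (m : nat) (T : 'I_m -> rep k Q).
Variables (r : 'I_m -> 'I_m -> nat).
Variable (c : forall i j, 'I_(r i j) -> ext_space (T i) (T j)).
Implicit Types (i j : 'I_m).

Let Sg := arrows_quiver r.
Implicit Types (U V P : rep k Sg) (X Y Z : rep k Q).

(** The cocycle which [xi] induces between the realizations, restricted to the copy [v] of [T i]. *)
Definition glue U Y (S : realization c U Y) V (xi : ext_space V U) phi i (v : 'I_(repdim V i)) :=
  \sum_j \sum_(w < repdim U j) \sum_(e < r i j)
     atw xi e w v *: (rin S w (hd phi) *m c e phi).

(** The functor on morphisms: [f] is the sum of the [g i] tensored with the identity of [T i]. *)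
Definition realizes V X U Y (R : realization c V X) (S : realization c U Y)
    (g : fam V U) (f : fam X Y) : Prop :=
  forall i (v : 'I_(repdim V i)) a,
    f a *m rin R v a = \sum_(w < repdim U i) (g i : 'M_(repdim U i, repdim V i)) w v *: rin S w a.

Lemma realizes_exists V X U Y (R : realization c V X) (S : realization c U Y) (g : fam V U) :
  exists f, realizes R S g f.
Proof.
exists (fun a => \sum_i \sum_v
  (\sum_(w < repdim U i) (g i : 'M_(repdim U i, repdim V i)) w v *: rin S w a) *m rout R v a).
by move=> i v a; rewrite rin_sum.
Qed.

Lemma realizes_unique V X U Y (R : realization c V X) (S : realization c U Y) g f f' :
  realizes R S g f -> realizes R S g f' -> forall a, f a = f' a.
Proof. by move=> H H' a; apply: (rin_inj (R := R)) => i v; rewrite H H'. Qed.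

Lemma realizes_eq V X U Y (R : realization c V X) (S : realization c U Y) (g g' : fam V U) f :
  (forall i, g i = g' i) -> realizes R S g f -> realizes R S g' f.
Proof. by move=> E H i v a; rewrite H; apply: eq_bigr => w _; rewrite E. Qed.

Lemma realizes_comp V X U Y P Z (R : realization c V X) (S : realization c U Y)
    (N : realization c P Z) g f h l :
  realizes R S g f -> realizes S N h l -> realizes R N (fam_comp h g) (fam_comp l f).
Proof.
move=> H H' i v a; rewrite /fam_comp -mulmxA H mulmx_sumr.
rewrite (eq_bigr (fun w => \sum_(p < repdim P i)
   ((h i : 'M_(repdim P i, repdim U i)) p w * (g i : 'M_(repdim U i, repdim V i)) w v)
     *: rin N p a)).
  rewrite exchange_big; apply: eq_bigr => p _; rewrite -scaler_suml; congr (_ *: _).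
  by rewrite mxE.
move=> w _; rewrite -scalemxAr H' scaler_sumr; apply: eq_bigr => p _.
by rewrite scalerA mulrC.
Qed.

Lemma realizes_id V X (R : realization c V X) : realizes R R (@fam_id k Sg V) (@fam_id k Q X).
Proof.
move=> i v a; rewrite mul1mx (bigD1 v) //= mxE eqxx scale1r big1 ?addr0 // => w nw.
by rewrite mxE (negPf nw) scale0r.
Qed.

Lemma atw_cobound V U (g : fam V U) i j (e : 'I_(r i j)) :
  atw (cobound g) e = (g j : 'M_(repdim U j, repdim V j)) *m act V e -
    act U e *m (g i : 'M_(repdim U i, repdim V i)).
Proof. by []. Qed.

(** The arrows inside the copies of [T i] commute with the coefficients [g i] and cancel; only the
    gluing terms remain. *)
Lemma cobound_realizes V X U Y (R : realization c V X) (S : realization c U Y) g f :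
  realizes R S g f -> forall phi i (v : 'I_(repdim V i)),
  cobound f phi *m rin R v (tl phi) = glue S (cobound g) phi v.
Proof.
move=> H phi i v; rewrite /cobound mulmxBl -mulmxA arr_rin mulmxDr mulmxA H.
rewrite -mulmxA H mulmx_suml [X in _ - X]mulmx_sumr.
rewrite [X in _ - X](eq_bigr (fun w => (g i : 'M_(repdim U i, repdim V i)) w v *:
    (rin S w (hd phi) *m arr (T i) phi) + (g i : 'M_(repdim U i, repdim V i)) w v *:
      \sum_j \sum_(w' < repdim U j) \sum_(e < r i j)
        act U e w' w *: (rin S w' (hd phi) *m c e phi))); last first.
  by move=> w _; rewrite -scalemxAr arr_rin scalerDr.
rewrite big_split /= opprD addrACA.
rewrite [X in X + _](_ : _ = 0) ?add0r; last first.
  apply/eqP; rewrite subr_eq0; apply/eqP; apply: eq_bigr => w _.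
  by rewrite -scalemxAl.
rewrite /glue (eq_bigr _ (fun w _ => scaler_sumr _ _ _ _)) [X in _ - X]exchange_big /=.
rewrite mulmx_sumr -sumrB; apply: eq_bigr => j _.
rewrite mulmx_sumr (eq_bigr (fun v' => \sum_(w < repdim U j) \sum_(e < r i j)
    (act V e v' v * (g j : 'M_(repdim U j, repdim V j)) w v') *: (rin S w (hd phi) *m c e phi)));
  last first.
  move=> v' _; rewrite exchange_big mulmx_sumr; apply: eq_bigr => e _.
  rewrite -scalemxAr mulmxA H mulmx_suml scaler_sumr; apply: eq_bigr => w _.
  by rewrite -scalemxAl scalerA.
rewrite exchange_big /= (eq_bigr _ (fun w _ => scaler_sumr _ _ _ _)).
rewrite [X in _ - X]exchange_big /= -sumrB; apply: eq_bigr => w _.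
rewrite exchange_big (eq_bigr _ (fun w _ => scaler_sumr _ _ _ _)) [X in _ - X]exchange_big /=.
rewrite -sumrB; apply: eq_bigr => e _; rewrite atw_cobound !mxE scalerBl; congr (_ - _).
  by rewrite -scaler_suml; congr (_ *: _); apply: eq_bigr => v' _; rewrite mulrC.
rewrite scaler_suml; apply: eq_bigr => w' _.
by rewrite scalerA mulrC.
Qed.

Lemma realizes_hom V X U Y (R : realization c V X) (S : realization c U Y) g f :
  realizes R S g f -> is_hom g -> is_hom f.
Proof.
move=> H /is_homE Hg; apply/is_homE => phi; apply: (rin_inj (R := R)) => i v.
rewrite (cobound_realizes H) mul0mx /glue big1 // => j _; rewrite big1 // => w _.
by rewrite big1 // => e _; rewrite /atw Hg mxE scale0r.
Qed.

(** Basis vectors of the extension over [Sg] are those of [U] followed by those of [V], which gives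
    the two kinds of inclusions and projections. *)
Lemma realization_extn V X U Y (R : realization c V X) (S : realization c U Y)
    (xi : ext_space V U) (eta : ext_space X Y) :
  (forall phi i (v : 'I_(repdim V i)), eta phi *m rin R v (tl phi) = glue S xi phi v) ->
  inhabited (realization c (extn xi) (extn eta)).
Proof.
move=> H; constructor.
pose rn i (u : 'I_(repdim (extn xi) i)) : fam (T i) (extn eta) := fun a =>
  match split (u : 'I_(repdim U i + repdim V i)) with
  | inl w => col_mx (rin S w a) 0
  | inr v => col_mx 0 (rin R v a)
  end.
pose ro i (u : 'I_(repdim (extn xi) i)) : fam (extn eta) (T i) := fun a =>
  match split (u : 'I_(repdim U i + repdim V i)) with
  | inl w => row_mx (rout S w a) 0
  | inr v => row_mx 0 (rout R v a)
  end.
have rnl i w a : rn i (lshift _ w) a = col_mx (rin S w a) 0.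
  by rewrite /rn (unsplitK (inl _ w)).
have rnr i v a : rn i (rshift _ v) a = col_mx 0 (rin R v a).
  by rewrite /rn (unsplitK (inr _ v)).
have rol i w a : ro i (lshift _ w) a = row_mx (rout S w a) 0.
  by rewrite /ro (unsplitK (inl _ w)).
have ror i v a : ro i (rshift _ v) a = row_mx 0 (rout R v a).
  by rewrite /ro (unsplitK (inr _ v)).
apply: (@Realization _ _ _ _ _ _ _ _ rn ro).
- move=> i u v a; rewrite /rn /ro -{2}[u](@splitK (repdim U i) (repdim V i)).
  rewrite -{2}[v](@splitK (repdim U i) (repdim V i)).
  case: split => u'; case: split => v' /=; rewrite mul_row_col !(mul0mx, mulmx0) ?addr0 ?add0r.
  + by rewrite routin (inj_eq (@lshift_inj _ _)).
  + by rewrite eq_lrshift -scalemx1 scale0r.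
  + by rewrite eq_rlshift -scalemx1 scale0r.
  + by rewrite routin (inj_eq (@rshift_inj _ _)).
- move=> i j u v a nij; rewrite /rn /ro.
  by case: split => u'; case: split => v'; rewrite mul_row_col ?routin0 // !(mul0mx, mulmx0) addr0.
- move=> a; rewrite scalar_mx_block -(rinout R) -(rinout S).
  rewrite (eq_bigr (fun i => block_mx (\sum_(w < repdim U i) rin S w a *m rout S w a) 0 0
     (\sum_(v < repdim V i) rin R v a *m rout R v a))).
    elim/big_rec3: _ => [|i M N K _ ->]; first by rewrite block_mx_const.
    by rewrite add_block_mx !addr0.
  move=> i _; rewrite big_split_ord /=.
  rewrite (eq_bigr (fun w => block_mx (rin S w a *m rout S w a) 0 0 0)); last first.
    by move=> w _; rewrite rnl rol mul_col_mx !mul_mx_row !(mul0mx, mulmx0) block_mxEv.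
  rewrite [X in _ + X](eq_bigr (fun v => block_mx 0 0 0 (rin R v a *m rout R v a))); last first.
    by move=> v _; rewrite rnr ror mul_col_mx !mul_mx_row !(mul0mx, mulmx0) block_mxEv.
  have -> : \sum_(w < repdim U i) block_mx (rin S w a *m rout S w a) 0 0 0 =
     block_mx (\sum_(w < repdim U i) rin S w a *m rout S w a) 0 0 (0 : 'M_(repdim X a, repdim X a)).
    elim/big_rec2: _ => [|w M N _ ->]; first by rewrite block_mx_const.
    by rewrite add_block_mx !addr0.
  have -> : \sum_(v < repdim V i) block_mx 0 0 0 (rin R v a *m rout R v a) =
     block_mx (0 : 'M_(repdim Y a, repdim Y a)) 0 0 (\sum_(v < repdim V i) rin R v a *m rout R v a).
    elim/big_rec2: _ => [|w M N _ ->]; first by rewrite block_mx_const.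
    by rewrite add_block_mx !addr0.
  by rewrite add_block_mx !(addr0, add0r).
- move=> phi i u; rewrite -[u](@splitK (repdim U i) (repdim V i)).
  pose i1 a : 'M[k]_(repdim Y a + repdim X a, repdim Y a) := col_mx 1%:M 0.
  pose i2 a : 'M[k]_(repdim Y a + repdim X a, repdim X a) := col_mx 0 1%:M.
  have {}rnl j w a : rn j (lshift _ w) a = i1 a *m rin S w a.
    by rewrite rnl /i1 mul_col_mx mul1mx mul0mx.
  have {}rnr j v a : rn j (rshift _ v) a = i2 a *m rin R v a.
    by rewrite rnr /i2 mul_col_mx mul1mx mul0mx.
  have arr1 : arr (extn eta) phi *m i1 (tl phi) = i1 (hd phi) *m arr Y phi.
    by rewrite /i1 /= !blockE.
  have arr2 : arr (extn eta) phi *m i2 (tl phi) = i1 (hd phi) *m eta phi + i2 (hd phi) *m arr X phi.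
    by rewrite /i1 /i2 /= !blockE.
  have act_ll j (e : 'I_(r i j)) w w' : act (extn xi) e (lshift _ w) (lshift _ w') = act U e w w'.
    exact: block_mxEul.
  have act_rl j (e : 'I_(r i j)) v w' : act (extn xi) e (rshift _ v) (lshift _ w') = 0.
    by rewrite [LHS]block_mxEdl mxE.
  have act_lr j (e : 'I_(r i j)) w v' : act (extn xi) e (lshift _ w) (rshift _ v') = atw xi e w v'.
    exact: block_mxEur.
  have act_rr j (e : 'I_(r i j)) v v' : act (extn xi) e (rshift _ v) (rshift _ v') = act V e v v'.
    exact: block_mxEdr.
  case: split => u' /=.
  + rewrite !rnl mulmxA arr1 -mulmxA arr_rin mulmxDr mulmxA; congr (_ + _).
    rewrite mulmx_sumr; apply: eq_bigr => j _; rewrite big_split_ord /= [X in _ = _ + X]big1.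
      rewrite addr0 mulmx_sumr; apply: eq_bigr => w _; rewrite mulmx_sumr.
      by apply: eq_bigr => e _; rewrite act_ll rnl -scalemxAr mulmxA.
    by move=> v _; rewrite big1 // => e _; rewrite act_rl scale0r.
  + rewrite !rnr mulmxA arr2 mulmxDl -!mulmxA H arr_rin mulmxDr addrCA mulmxA; congr (_ + _).
    rewrite !mulmx_sumr -big_split; apply: eq_bigr => j _; rewrite big_split_ord /=.
    rewrite !mulmx_sumr; congr (_ + _); apply: eq_bigr => w _; rewrite !mulmx_sumr.
      by apply: eq_bigr => e _; rewrite act_lr rnl -scalemxAr mulmxA.
    by apply: eq_bigr => e _; rewrite act_rr rnr -scalemxAr mulmxA.
Qed.

End RealizedMorphisms.

(** * Fullness, and the comparison of extensions *)

Section FullyFaithful.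
Variables (k : closedFieldType) (Q : quiver) (m : nat) (T : 'I_m -> rep k Q).
Variables (r : 'I_m -> 'I_m -> nat).
Variable (c : forall i j, 'I_(r i j) -> ext_space (T i) (T j)).
Implicit Types (i j : 'I_m).

Let Sg := arrows_quiver r.
Implicit Types (U V P : rep k Sg) (X Y Z : rep k Q).

Section Components.
Variables (V U : rep k Sg) (X Y : rep k Q).
Variables (R : realization c V X) (S : realization c U Y).

Definition component (f : fam X Y) i j (v : 'I_(repdim V i)) (w : 'I_(repdim U j)) :
  fam (T i) (T j) := fun a => rout S w a *m f a *m rin R v a.

Lemma rout_glue (xi : ext_space V U) phi i (v : 'I_(repdim V i)) j (w : 'I_(repdim U j)) :
  rout S w (hd phi) *m glue S xi phi v = \sum_(e < r i j) atw xi e w v *: c e phi.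
Proof.
rewrite -(rout_sum S w (fun j' w' => \sum_(e < r i j') atw xi e w' v *: c e phi)).
congr (_ *m _); apply: eq_bigr => j' _; apply: eq_bigr => w' _; rewrite mulmx_sumr.
by apply: eq_bigr => e _; rewrite -scalemxAr.
Qed.

Lemma cobound_component (f : fam X Y) i j (v : 'I_(repdim V i)) (w : 'I_(repdim U j)) phi :
  cobound (component f v w) phi =
  rout S w (hd phi) *m cobound f phi *m rin R v (tl phi)
  - \sum_j' \sum_(v' < repdim V j') \sum_(e < r i j')
      act V e v' v *: (component f v' w (hd phi) *m c e phi)
  + \sum_i' \sum_(w' < repdim U i') \sum_(e < r i' j)
      act U e w w' *: (c e phi *m component f v w' (tl phi)).
Proof.
rewrite {2}/cobound mulmxBr mulmxBl.
have -> : rout S w (hd phi) *m (f (hd phi) *m arr X phi) *m rin R v (tl phi) =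
    component f v w (hd phi) *m arr (T i) phi +
    \sum_j' \sum_(v' < repdim V j') \sum_(e < r i j')
      act V e v' v *: (component f v' w (hd phi) *m c e phi).
  rewrite -!mulmxA arr_rin !mulmxDr !mulmxA; congr (_ + _).
  rewrite mulmx_sumr; apply: eq_bigr => j' _; rewrite mulmx_sumr; apply: eq_bigr => v' _.
  by rewrite mulmx_sumr; apply: eq_bigr => e _; rewrite -scalemxAr mulmxA.
have -> : rout S w (hd phi) *m (arr Y phi *m f (tl phi)) *m rin R v (tl phi) =
    arr (T j) phi *m component f v w (tl phi) +
    \sum_i' \sum_(w' < repdim U i') \sum_(e < r i' j)
      act U e w w' *: (c e phi *m component f v w' (tl phi)).
  rewrite mulmxA rout_arr !mulmxDl -!mulmxA; congr (_ + _); first by rewrite /component !mulmxA.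
  rewrite mulmx_suml; apply: eq_bigr => i' _; rewrite mulmx_suml; apply: eq_bigr => w' _.
  by rewrite mulmx_suml; apply: eq_bigr => e _; rewrite -scalemxAl !mulmxA.
by rewrite /cobound opprD addrA [X in _ = X + _]addrAC subrK addrAC addrK.
Qed.

Lemma component_assemble (F : forall i j, 'I_(repdim V i) -> 'I_(repdim U j) -> fam (T i) (T j)) :
  exists f : fam X Y, forall i j (v : 'I_(repdim V i)) (w : 'I_(repdim U j)) a,
    component f v w a = F i j v w a.
Proof.
exists (fun a => \sum_j \sum_w rin S w a *m (\sum_i \sum_v F i j v w a *m rout R v a)).
by move=> i j v w a; rewrite /component rout_sum rin_sum.
Qed.

End Components.

Hypothesis schurT : forall i, schur_indecomposable (T i).
Hypothesis homT : forall i j, i != j -> hom_vanishes (T i) (T j).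
Hypothesis c_indep : forall i j (f : fam (T i) (T j)) lam,
  (forall phi, cobound f phi = \sum_(e < r i j) lam e *: c e phi) -> forall e, lam e = 0.
Hypothesis c_span : forall i j (eta : ext_space (T i) (T j)), exists f lam,
  forall phi, eta phi = cobound f phi + \sum_(e < r i j) lam e *: c e phi.
Variable sg : 'I_m -> nat.
Hypothesis sgP : forall i j, 'I_(r i j) -> (sg j < sg i)%N.

(** [mu] is the weight for triangular inductions: it drops when the source moves forward along an
    arrow or the target moves back along one. [B] bounds [sg], so the truncated subtraction stays
    strict. *)
Let B := (\sum_i sg i)%N.
Let mu i j := (sg i + (B - sg j))%N.

Lemma mu_left i j j' : 'I_(r i j') -> (mu j' j < mu i j)%N.
Proof. by move=> e; rewrite ltn_add2r; apply: sgP. Qed.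

Lemma mu_right i j i' : 'I_(r i' j) -> (mu i i' < mu i j)%N.
Proof.
move=> e; rewrite ltn_add2l ltn_sub2l ?sgP //.
by rewrite (leq_trans (sgP e)) // /B (bigD1 i') //= leq_addr.
Qed.

Section Full.
Variables (V U : rep k Sg) (X Y : rep k Q).
Variables (R : realization c V X) (S : realization c U Y).
Variables (f : fam X Y) (xi : ext_space V U).
Hypothesis f_xi : forall phi i (v : 'I_(repdim V i)),
  cobound f phi *m rin R v (tl phi) = glue S xi phi v.

Local Notation cmp := (component R S f).

(** If the components of lower weight are zero or scalar, [cobound_component] expresses the
    coboundary of this one through the cocycles [c e] alone. By their independence all coefficients
    vanish: the component is a homomorphism, and the coefficients of [xi] are determined. *)
Lemma component_step i j (v : 'I_(repdim V i)) (w : 'I_(repdim U j))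
    (g1 : 'I_(repdim V j) -> k) (g2 : 'I_(repdim U i) -> k) :
  (forall j', 'I_(r i j') -> j' != j -> forall v' a, cmp (i := j') v' w a = 0) ->
  ('I_(r i j) -> forall v' a, cmp v' w a = (g1 v')%:M) ->
  (forall i', 'I_(r i' j) -> i' != i -> forall w' a, cmp (j := i') v w' a = 0) ->
  ('I_(r i j) -> forall w' a, cmp v w' a = (g2 w')%:M) ->
  is_hom (cmp v w) /\ forall e : 'I_(r i j),
    atw xi e w v = \sum_v' g1 v' * act V e v' v - \sum_w' act U e w w' * g2 w'.
Proof.
move=> z1 s1 z2 s2.
pose lam (e : 'I_(r i j)) :=
  atw xi e w v - \sum_v' g1 v' * act V e v' v + \sum_w' act U e w w' * g2 w'.
have E phi : cobound (cmp v w) phi = \sum_e lam e *: c e phi.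
  rewrite cobound_component -mulmxA f_xi rout_glue.
  rewrite (bigD1 j) //= [X in _ - (_ + X)]big1 ?addr0; last first.
    move=> j' nj; rewrite big1 // => v' _; rewrite big1 // => e _.
    by rewrite z1 // mul0mx scaler0.
  rewrite (bigD1 i) //= [X in _ + (_ + X)]big1 ?addr0; last first.
    move=> i' ni; rewrite big1 // => w' _; rewrite big1 // => e _.
    by rewrite z2 // mulmx0 scaler0.
  rewrite exchange_big [X in _ + X]exchange_big /= -sumrB -big_split /=.
  apply: eq_bigr => e _; rewrite /lam scalerDl scalerBl !scaler_suml; congr (_ - _ + _).
    by apply: eq_bigr => v' _; rewrite (s1 e) mul_scalar_mx scalerA mulrC.
  by apply: eq_bigr => w' _; rewrite (s2 e) mul_mx_scalar scalerA.
have l0 := c_indep E; split=> [|e].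
  by apply/is_homE => phi; rewrite E big1 // => e _; rewrite l0 scale0r.
by have /eqP := l0 e; rewrite /lam addrAC subr_eq0 => /eqP <-; rewrite addrK.
Qed.

(** By induction on [mu] each component is a homomorphism between the [T i], hence zero or a scalar.
    [pid_mx] allows the scalar case to be typed before [i] and [j] are identified. *)
Lemma component_scalar i j :
  (i != j -> forall v w a, cmp (i := i) (j := j) v w a = 0) /\
  (i = j -> forall v w, exists x : k, forall a,
     cmp (i := i) (j := j) v w a = x *: pid_mx (repdim (T i) a)).
Proof.
have [n] := ubnP (mu i j); elim: n i j => // n IH i j le_n.
have {}IH i' j' : (mu i' j' < mu i j)%N -> _ := fun lt => IH i' j' (leq_trans lt le_n).
have H v w : is_hom (cmp (i := i) (j := j) v w).
  have [g1 Hg1] : exists g1, 'I_(r i j) -> forall v' a,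
      cmp (i := j) (j := j) v' w a = (g1 v')%:M.
    (* An arrow from [i] to [j] gives the diagonal component smaller weight. Without one the claim
       is vacuous and [0] is a default. *)
    have [[e _]|ne] := classic (exists e : 'I_(r i j), True); last first.
      by exists (fun=> 0) => e; case: ne; exists e.
    have [_ /(_ erefl) sc] := IH _ _ (mu_left j e).
    have [g1 Hg1] := fin_all_exists (fun v' => sc v' w).
    by exists g1 => _ v' a; rewrite Hg1 pid_mx_1 scalemx1.
  have [g2 Hg2] : exists g2, 'I_(r i j) -> forall w' a,
      cmp (i := i) (j := i) v w' a = (g2 w')%:M.
    have [[e _]|ne] := classic (exists e : 'I_(r i j), True); last first.
      by exists (fun=> 0) => e; case: ne; exists e.
    have [_ /(_ erefl) sc] := IH _ _ (mu_right i e).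
    have [g2 Hg2] := fin_all_exists (fun w' => sc v w').
    by exists g2 => _ w' a; rewrite Hg2 pid_mx_1 scalemx1.
  have [] // := component_step (v := v) (w := w) (g1 := g1) (g2 := g2).
    by move=> j' e nj v' a; have [-> //] := IH _ _ (mu_left j e).
  move=> i' e ni w' a; have [-> //] := IH _ _ (mu_right i e).
  by rewrite eq_sym.
split=> [nij v w a|ij v w]; first exact: homT nij _ (H v w) a.
subst j; have [_ sc] := schurT i; have [x Hx] := sc _ (H v w).
by exists x => a; rewrite Hx pid_mx_1 scalemx1.
Qed.

(** For [xi = 0] this is fullness of the functor; in general it is injectivity on Ext. *)
Lemma realization_full : exists g : fam V U,
  realizes R S g f /\ forall phi, cobound g phi = xi phi.
Proof.
have sc i (vw : 'I_(repdim V i) * 'I_(repdim U i)) : exists x : k, forall a,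
    cmp (i := i) (j := i) vw.1 vw.2 a = x%:M.
  have [_ /(_ erefl vw.1 vw.2) [x Hx]] := component_scalar i i.
  by exists x => a; rewrite Hx pid_mx_1 scalemx1.
have [G HG] := fin_all_exists (fun i => fin_all_exists (sc i)).
exists (fun i => \matrix_(w, v) G i (v, w)); split.
  move=> i v a; rewrite [LHS](rout_decomp S) (bigD1 i) //= [X in _ + X]big1 ?addr0; last first.
    move=> j nj; apply: big1 => w _; have [z _] := component_scalar i j.
    by rewrite (mulmxA (rout S w a)) [X in _ *m X](z _ v w a) ?mulmx0 // eq_sym.
  apply: eq_bigr => w _.
  by rewrite (mulmxA (rout S w a)) [X in _ *m X](HG i (v, w)) mul_mx_scalar mxE.
case=> [[i j] e]; apply/matrixP => w v.
have [|||| _ /(_ e) ->] := component_step (v := v) (w := w)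
    (g1 := fun v' => G j (v', w)) (g2 := fun w' => G i (v, w')).
- by move=> j' _ nj v' a; have [->] := component_scalar j' j.
- by move=> _ v' a; rewrite (HG j (v', w)).
- by move=> i' _ ni w' a; have [->] := component_scalar i i'; rewrite // eq_sym.
- by move=> _ w' a; rewrite (HG i (v, w')).
rewrite /cobound !mxE; congr (_ - _); apply: eq_bigr => x _; rewrite !mxE //.
Qed.

End Full.

(** Surjectivity on Ext. The components of [f] are found in order of increasing [mu]: the
    corrections are then already known, and [c_span] decomposes what is left. *)
Lemma realization_ext_full V U X Y (R : realization c V X) (S : realization c U Y)
    (eta : ext_space X Y) :
  exists (f : fam X Y) (xi : ext_space V U), forall phi i (v : 'I_(repdim V i)),
    eta phi *m rin R v (tl phi) = cobound f phi *m rin R v (tl phi) + glue S xi phi v.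
Proof.
suff [f [lam H]] : exists (f : fam X Y)
    (lam : forall i j, 'I_(repdim V i) -> 'I_(repdim U j) -> 'I_(r i j) -> k),
    forall i j (v : 'I_(repdim V i)) (w : 'I_(repdim U j)) phi,
    rout S w (hd phi) *m eta phi *m rin R v (tl phi) =
    rout S w (hd phi) *m cobound f phi *m rin R v (tl phi) + \sum_e lam i j v w e *: c e phi.
  exists f, (fun phi : Q1 Sg => \matrix_(w, v) lam (tag phi).1 (tag phi).2 v w (tagged phi)).
  move=> phi i v; rewrite [LHS](rout_decomp S) [RHS](rout_decomp S).
  apply: eq_bigr => j _; apply: eq_bigr => w _; congr (_ *m _).
  rewrite mulmxDr rout_glue mulmxA H mulmxA; congr (_ + _).
  by apply: eq_bigr => e _; rewrite /atw mxE.
pose F0 i j (v : 'I_(repdim V i)) (w : 'I_(repdim U j)) : fam (T i) (T j) := fun a => 0.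
(* By [cobound_component], [D F] is the block of the coboundary of the family with components
   [F]. *)
pose D (F : forall i j, 'I_(repdim V i) -> 'I_(repdim U j) -> fam (T i) (T j)) i j v w phi :=
  cobound (F i j v w) phi
  + \sum_j' \sum_(v' < repdim V j') \sum_(e < r i j')
      act V e v' v *: (F j' j v' w (hd phi) *m c e phi)
  - \sum_i' \sum_(w' < repdim U i') \sum_(e < r i' j)
      act U e w w' *: (c e phi *m F i i' v w' (tl phi)).
(* This sum exceeds every value of [mu], so at this stage all components are settled. *)
suff /(_ (\sum_i \sum_j (mu i j).+1)%N) [F [lam H]] : forall n, exists F
    (lam : forall i j, 'I_(repdim V i) -> 'I_(repdim U j) -> 'I_(r i j) -> k),
    forall i j, (mu i j < n)%N -> forall v w phi,
    rout S w (hd phi) *m eta phi *m rin R v (tl phi) =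
      D F i j v w phi + \sum_e lam i j v w e *: c e phi.
  have [f Hf] := component_assemble R S F; exists f, lam => i j v w phi.
  rewrite H; last first.
    by rewrite (bigD1 i) //= (bigD1 j) //= -addnA ltnS leq_addr.
  congr (_ + _); rewrite /D.
  have -> : cobound (F i j v w) phi = cobound (component R S f v w) phi.
    by rewrite /cobound !Hf.
  rewrite cobound_component.
  rewrite [X in _ - X + _ + _ - _](_ : _ = \sum_j' \sum_(v' < repdim V j') \sum_(e < r i j')
      act V e v' v *: (F j' j v' w (hd phi) *m c e phi)); last first.
    by apply: eq_bigr => j' _; apply: eq_bigr => v' _; apply: eq_bigr => e _; rewrite Hf.
  rewrite [X in _ - _ + X + _ - _](_ : _ = \sum_i' \sum_(w' < repdim U i') \sum_(e < r i' j)
      act U e w w' *: (c e phi *m F i i' v w' (tl phi))); last first.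
    by apply: eq_bigr => i' _; apply: eq_bigr => w' _; apply: eq_bigr => e _; rewrite Hf.
  by rewrite [X in X - _]addrAC subrK addrK.
elim=> [|n [F [lam H]]]; first by exists F0, (fun i j v w e => 0).
pose rhs i j (v : 'I_(repdim V i)) (w : 'I_(repdim U j)) : ext_space (T i) (T j) := fun phi =>
  rout S w (hd phi) *m eta phi *m rin R v (tl phi) -
  (D F i j v w phi - cobound (F i j v w) phi).
have new i j v w : exists fl : fam (T i) (T j) * ('I_(r i j) -> k),
    forall phi, rhs i j v w phi = cobound fl.1 phi + \sum_e fl.2 e *: c e phi.
  by have [f [l Hl]] := c_span (rhs i j v w); exists (f, l).
have [N HN] := fin_all_exists (fun i => fin_all_exists (fun j =>
  fin_all_exists (fun v => fin_all_exists (new i j v)))).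
exists (fun i j v w => if mu i j == n then (N i j v w).1 else F i j v w).
exists (fun i j v w => if mu i j == n then (N i j v w).2 else lam i j v w).
move=> i j; rewrite ltnS leq_eqVlt => le_n v w phi.
(* Redefining the components of weight [n] leaves the corrections for weights up to [n] unchanged,
   as these involve smaller weights only. *)
have DE : D (fun i j v w => if mu i j == n then (N i j v w).1 else F i j v w) i j v w phi =
    cobound (if mu i j == n then (N i j v w).1 else F i j v w) phi +
    (D F i j v w phi - cobound (F i j v w) phi).
  have lt_n i' j' : (mu i' j' < mu i j)%N -> (mu i' j' == n) = false.
    move=> lt; apply/ltn_eqF/(leq_trans lt).
    by case/orP: le_n => [/eqP -> //|/ltnW].
  rewrite /D; set f := (if _ then _ else F i j v w).
  have cancel3 (W : zmodType) (x y z : W) : x + y - z - x = y - z.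
    by rewrite addrAC [x + y]addrC addrK.
  rewrite cancel3 -addrA; congr (_ + _); congr (_ - _).
    apply: eq_bigr => j' _; apply: eq_bigr => v' _; apply: eq_bigr => e _.
    by rewrite lt_n // mu_left.
  apply: eq_bigr => i' _; apply: eq_bigr => w' _; apply: eq_bigr => e _.
  by rewrite lt_n // mu_right.
case: (eqVneq (mu i j) n) le_n => [En _|nn /= lt_n]; rewrite DE; last first.
  by rewrite (negPf nn) [X in X + _]addrC subrK H.
by rewrite En eqxx addrAC -HN /rhs subrK.
Qed.

End FullyFaithful.

(** * Equivalences and simple objects *)

Section Equivalences.
Variable k : closedFieldType.

(* An equivalence between two full subcategories, given by the relation "the
   functor sends [V] to [X]" rather than by a functor. *)
Record equivalence (Q1 Q2 : quiver) (D1 : rep k Q1 -> Prop) (D2 : rep k Q2 -> Prop) :=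
  Equivalence {
  eqo : rep k Q1 -> rep k Q2 -> Type;
  eqm : forall V X U Y, eqo V X -> eqo U Y -> fam V U -> fam X Y -> Prop;
  eqo_r : forall V, D1 V -> exists2 X, D2 X & inhabited (eqo V X);
  eqo_l : forall X, D2 X -> exists2 V, D1 V & inhabited (eqo V X);
  eqm_r : forall V X U Y (R : eqo V X) (S : eqo U Y) g, is_hom g ->
    exists2 f, is_hom f & eqm R S g f;
  eqm_l : forall V X U Y (R : eqo V X) (S : eqo U Y) f, is_hom f ->
    exists2 g, is_hom g & eqm R S g f;
  eqm_unique : forall V X U Y (R : eqo V X) (S : eqo U Y) g g' f f',
    eqm R S g f -> eqm R S g' f' -> (forall a, g a = g' a) <-> (forall a, f a = f' a);
  eqm_comp : forall V X U Y P Z (R : eqo V X) (S : eqo U Y) (N : eqo P Z) g f h l,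
    eqm R S g f -> eqm S N h l -> eqm R N (fam_comp h g) (fam_comp l f);
  eqm_id : forall V X (R : eqo V X), eqm R R (@fam_id k Q1 V) (@fam_id k Q2 X);
  eqo_zero : forall V X, eqo V X -> (is_zero V <-> is_zero X) }.

(** Transparent, so that an object of [eqo] for [E] is also one for the inverse by conversion. *)
Definition equivalence_sym Q1 Q2 (D1 : rep k Q1 -> Prop) (D2 : rep k Q2 -> Prop) :
  equivalence D1 D2 -> equivalence D2 D1.
Proof.
move=> E; apply: (@Equivalence _ _ D2 D1 (fun X V => eqo E V X)
  (fun X V Y U R S f g => eqm R S g f)).
- exact: eqo_l.
- exact: eqo_r.
- by move=> V X U Y R S; apply: eqm_l.
- by move=> V X U Y R S; apply: eqm_r.
- by move=> V X U Y R S g g' f f' H H'; have [H1 H2] := eqm_unique H H'.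
- by move=> V X U Y P Z R S N g f h l; apply: eqm_comp.
- by move=> V X R; apply: eqm_id.
- by move=> X V R; have [H1 H2] := eqo_zero R.
Defined.

Section OneWay.
Variables (Q1 Q2 : quiver) (D1 : rep k Q1 -> Prop) (D2 : rep k Q2 -> Prop).
Variable E : equivalence D1 D2.

Lemma eqm_iso V X U Y (R : eqo E V X) (S : eqo E U Y) g f :
  eqm R S g f -> is_iso g -> is_hom f -> is_iso f.
Proof.
move=> H [_ [h [Hh K]]] Hf; split=> //.
have [l Hl Hhl] := eqm_r S R Hh; exists l; split=> // a.
have [_ [gh hg]] := (K, conj (fun a => proj1 (K a)) (fun a => proj2 (K a))).
have [K1 _] := eqm_unique (eqm_comp H Hhl) (eqm_id R).
have [K2 _] := eqm_unique (eqm_comp Hhl H) (eqm_id S).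
by split; [apply: (K1 gh) | apply: (K2 hg)].
Qed.

Lemma eqo_isomorphic V X U Y : eqo E V X -> eqo E U Y -> isomorphic V U -> isomorphic X Y.
Proof.
move=> R S [g Ig]; have [f Hf H] := eqm_r R S (proj1 Ig).
by exists f; apply: eqm_iso H Ig Hf.
Qed.

(** A subobject of [X] lifts to one of [V] by essential surjectivity and fullness; faithfulness
    transports the monomorphism property. *)
Lemma eqo_simple V X : eqo E V X -> D2 X -> simple_in D1 V -> simple_in D2 X.
Proof.
move=> R D2X [_ NV SV]; split=> //; first by move/(proj2 (eqo_zero R)).
move=> Y f D2Y Hf Mf; have [U D1U [S]] := eqo_l E D2Y.
have [g Hg gf] := eqm_l S R Hf.
have [|ZU|Ig] := SV U g D1U Hg; last 2 first.
- by left; apply: (proj1 (eqo_zero S)).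
- by right; apply: eqm_iso gf Ig Hf.
move=> P h h' D1P Hh Hh' gh; have [Z D2Z [N]] := eqo_r E D1P.
have [l Hl hl] := eqm_r N S Hh; have [l' Hl' hl'] := eqm_r N S Hh'.
apply/(proj2 (eqm_unique hl hl'))/(Mf Z) => //.
exact: (proj1 (eqm_unique (eqm_comp hl gf) (eqm_comp hl' gf)) gh).
Qed.

End OneWay.

Lemma equivalence_simple_dims Q1 Q2 (D1 : rep k Q1 -> Prop) (D2 : rep k Q2 -> Prop)
    (E : equivalence D1 D2) m (al : 'I_m -> dimvec Q1) :
  simple_dims D1 al -> exists2 al' : 'I_m -> dimvec Q2, simple_dims D2 al' &
    forall i, exists V X, [/\ inhabited (eqo E V X), repdim V =1 al i & repdim X =1 al' i].
Proof.
move=> [T [sT uT cT dT]].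
have ex i : exists X, D2 X /\ inhabited (eqo E (T i) X).
  by have [DT _ _] := sT i; have [X] := eqo_r E DT; exists X.
have [T' HT'] := fin_all_exists ex.
exists (fun i => repdim (T' i)); last first.
  by move=> i; exists (T i), (T' i); split=> //; have [] := HT' i.
exists T'; split=> [i|i j iso|X SX|//].
- by have [D2T [R]] := HT' i; apply: eqo_simple R D2T (sT i).
- have [_ [R]] := HT' i; have [_ [S]] := HT' j; apply: uT.
  exact: (@eqo_isomorphic _ _ _ _ (equivalence_sym E) _ _ _ _ R S iso).
- have [D2X _ _] := SX; have [V D1V [R]] := eqo_l E D2X.
  have SV : simple_in D1 V.
    exact: (@eqo_simple _ _ _ _ (equivalence_sym E) X V R D1V SX).
  have [i iso] := cT V SV; exists i; have [_ [S]] := HT' i.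
  exact: eqo_isomorphic R S iso.
Qed.

Lemma simple_dims_ext Q (C C' : rep k Q -> Prop) m (al al' : 'I_m -> dimvec Q) :
  (forall V, C V <-> C' V) -> (forall i, al i =1 al' i) ->
  simple_dims C al -> simple_dims C' al'.
Proof.
move=> CC aa [T [sT uT cT dT]].
have simpE (D D' : rep k Q -> Prop) V : (forall V, D V <-> D' V) -> simple_in D V -> simple_in D' V.
  move=> DD [DV NV SV]; split=> //; first exact/DD.
  move=> U f /DD DU Hf Mf; apply: SV => // X g h /DD DX; exact: Mf.
exists T; split=> [i|//|V SV|i a].
- exact: simpE (sT i).
- by apply: cT; apply: simpE SV => U; rewrite CC.
- by rewrite dT aa.
Qed.

End Equivalences.

Section ExtensionIsomorphisms.
Variables (k : closedFieldType) (Q : quiver).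
Implicit Types A B : rep k Q.

Lemma extn_cobound_iso A B (eta eta' : ext_space B A) (f : fam B A) :
  (forall phi, eta phi = cobound f phi + eta' phi) -> isomorphic (extn eta) (extn eta').
Proof.
move=> H.
pose g : fam (extn eta) (extn eta') := fun a => block_mx 1%:M (- f a) 0 1%:M.
exists g; apply/is_isoP; split.
  move=> phi; rewrite /g /= !blockE; congr block_mx.
  by rewrite mulNmx mulmxN H /cobound addrAC [X in X - _]addrC addrK.
exists (fun a => block_mx 1%:M (f a) 0 1%:M) => a.
by rewrite /g !blockE addNr subrr -scalar_mx_block.
Qed.

Lemma extn_zero_sub A B (xi : ext_space B A) : is_zero A -> isomorphic (extn xi) B.
Proof.
move=> Z; exists (@extn_out _ _ _ _ xi); apply/is_isoP; split; first exact: extn_out_hom.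
exists (fun a => col_mx 0 1%:M : 'M_(repdim A a + repdim B a, _)) => a.
rewrite /extn_out !blockE; split=> //.
rewrite [RHS]scalar_mx_block block_mxEv; congr col_mx; exact/mx_dim0l/Z.
Qed.

End ExtensionIsomorphisms.

(** * Equivalence with a perpendicular category *)

Section PerpEquivalence.
Variables (k : closedFieldType) (Q : quiver) (m : nat) (T : 'I_m -> rep k Q).
Variables (r : 'I_m -> 'I_m -> nat).
Variable (c : forall i j, 'I_(r i j) -> ext_space (T i) (T j)).
Implicit Types (i j : 'I_m).

Let Sg := arrows_quiver r.
Implicit Types (U V P : rep k Sg) (X Y Z G : rep k Q).

(** The identity of [V] induces mutually inverse maps between [X] and the realization constructed
    explicitly, whose dimension is known. *)
Lemma realization_dim V X : realization c V X -> repdim X =1 realized_dim T (repdim V).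
Proof.
move=> R; have [Y [S] dY] := realization_exists c V.
move=> a; rewrite -dY.
have [f Hf] := realizes_exists R S (@fam_id k Sg V).
have [h Hh] := realizes_exists S R (@fam_id k Sg V).
have id2 i : fam_comp (@fam_id k Sg V) (@fam_id k Sg V) i = fam_id V i by apply: mul1mx.
have hf := realizes_unique (realizes_eq id2 (realizes_comp Hf Hh)) (realizes_id R) a.
have fh := realizes_unique (realizes_eq id2 (realizes_comp Hh Hf)) (realizes_id S) a.
by apply/eqP; rewrite eqn_leq (mulmx1_min hf) (mulmx1_min fh).
Qed.

Lemma euler_arrows_quiver (x y : dimvec Sg) :
  euler x y = \sum_i (x i * y i)%N%:Z - \sum_i \sum_j (r i j * (x i * y j))%N%:Z.
Proof.
congr (_ - _).
pose J (kl : 'I_m * 'I_m) := 'I_(r kl.1 kl.2) : finType.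
transitivity (\sum_kl \sum_(e : J kl) (x kl.1 * y kl.2)%N%:Z).
  rewrite (sig_big_dep xpredT (fun _ _ => true) (fun kl (e : J kl) => (x kl.1 * y kl.2)%N%:Z)).
  by apply: eq_bigr => [[[i j] e]] _.
rewrite (eq_bigr (fun kl => (r kl.1 kl.2 * (x kl.1 * y kl.2))%N%:Z)); last first.
  by move=> kl _; rewrite sumr_const card_ord -mulr_natl PoszM natz.
by rewrite -(pair_big xpredT xpredT (fun i j => (r i j * (x i * y j))%N%:Z)).
Qed.

Hypothesis rP : forall i j, (r i j)%:Z = (i == j)%:Z - euler (repdim (T i)) (repdim (T j)).

(** The numbers of arrows are chosen so that the simple representations of [Sg] and the [T i] have
    the same Gram matrix. *)
Lemma euler_realized (x y : dimvec Sg) :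
  euler (realized_dim T x) (realized_dim T y) = euler x y.
Proof.
rewrite euler_suml euler_arrows_quiver -sumrB; apply: eq_bigr => i _.
rewrite euler_sumr mulr_sumr.
rewrite (eq_bigr (fun j => (i == j)%:Z * (x i * y j)%N%:Z - (r i j * (x i * y j))%N%:Z)).
  rewrite sumrB; congr (_ - _); rewrite (bigD1 i) //= eqxx mul1r big1 ?addr0 // => j nj.
  by rewrite eq_sym (negPf nj) mul0r.
move=> j _; rewrite !PoszM rP mulrBl opprB addrC subrK.
by rewrite mulrA mulrC.
Qed.

Hypothesis schurT : forall i, schur_indecomposable (T i).
Hypothesis homT : forall i j, i != j -> hom_vanishes (T i) (T j).
Hypothesis c_indep : forall i j (f : fam (T i) (T j)) lam,
  (forall phi, cobound f phi = \sum_(e < r i j) lam e *: c e phi) -> forall e, lam e = 0.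
Hypothesis c_span : forall i j (eta : ext_space (T i) (T j)), exists f lam,
  forall phi, eta phi = cobound f phi + \sum_(e < r i j) lam e *: c e phi.
Variable sg : 'I_m -> nat.
Hypothesis sgP : forall i j, 'I_(r i j) -> (sg j < sg i)%N.

Lemma T_support i : exists a, repdim (T i) a != 0%N.
Proof.
have [NZ _] := schurT i; apply: NNPP => H; apply: NZ => a.
by apply/eqP; apply: contraT => N; case: H; exists a.
Qed.

Lemma realized_zero V X : realization c V X -> (is_zero V <-> is_zero X).
Proof.
move=> R; split=> Z.
  by move=> a; rewrite (realization_dim R) /realized_dim big1 // => i _; rewrite Z.
move=> i; have [a na] := T_support i.
have := Z a; rewrite (realization_dim R) => /eqP; rewrite sum_nat_eq0 => /forallP /(_ i).
by rewrite /= muln_eq0 (negPf na) orbF => /eqP.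
Qed.

Lemma realizes_faithful V X U Y (R : realization c V X) (S : realization c U Y) g g' f f' :
  realizes R S g f -> realizes R S g' f' -> (forall i, g i = g' i) <-> (forall a, f a = f' a).
Proof.
move=> H H'; split=> E.
  exact: realizes_unique (realizes_eq E H) H'.
move=> i; have [a na] := T_support i; apply/matrixP => w v.
have rE h l : realizes R S h l -> rout S w a *m l a *m rin R v a = (h i w v)%:M.
  move=> Hh; rewrite -mulmxA Hh mulmx_sumr (bigD1 w) //= -scalemxAr routin eqxx scalemx1.
  rewrite big1 ?addr0 // => w' nw; rewrite -scalemxAr routin eq_sym (negPf nw).
  by rewrite -scalemx1 scale0r scaler0.
have := rE _ _ H; rewrite E (rE _ _ H'); rewrite -lt0n in na.
by move=> /matrixP /(_ (Ordinal na) (Ordinal na)); rewrite !mxE eqxx.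
Qed.

(** A component of [f] at [i] is a homomorphism once those at the tails of arrows into [i] vanish,
    and these have larger [sg]. Ext then vanishes by the Euler form. *)
Lemma realized_Perp V X G : realization c V X -> (forall i, Perp G (T i)) -> Perp G X.
Proof.
move=> R PT.
have hX : hom_vanishes G X.
  move=> f Hf; have f0 i (u : 'I_(repdim V i)) a : rout R u a *m f a = 0.
    pose B := (\sum_i sg i)%N.
    have [n] := ubnP (B - sg i)%N; elim: n i u a => // n IH i u a le_n.
    apply: (proj1 (PT i) (fun a => rout R u a *m f a)); apply/is_homE => phi.
    rewrite /cobound -mulmxA Hf mulmxA rout_arr mulmxDl mulmxA addrC addrA addNr add0r.
    rewrite mulmx_suml big1 // => j _; rewrite mulmx_suml big1 // => v _.
    rewrite mulmx_suml big1 // => e _; rewrite -scalemxAl -mulmxA IH ?mulmx0 ?scaler0 //.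
    rewrite -ltnS (leq_trans _ le_n) // ltnS ltn_sub2l ?sgP //.
    by rewrite (leq_trans (sgP e)) // /B (bigD1 j) //= leq_addr.
  move=> a; rewrite [f a](rout_decomp R) big1 // => i _; rewrite big1 // => u _.
  by rewrite f0 mulmx0.
split=> //; apply: hom0_euler_ext0 => //.
rewrite (eq_euler (fun=> erefl) (realization_dim R)) euler_sumr big1 // => i _.
by rewrite euler_Perp ?mulr0.
Qed.

Lemma realized_perp gs V X : realization c V X -> (forall i, perp gs (T i)) -> perp gs X.
Proof.
move=> R; elim: gs => //= G gs IH H; split.
  by apply: (realized_Perp R) => i; have [] := H i.
by apply: IH => i; have [] := H i.
Qed.

(** Hom is compared by full faithfulness; Ext follows because the Euler forms agree. *)
Lemma Perp_realized V X (G : rep k Sg) Y : realization c V X -> realization c G Y ->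
  (Perp G V <-> Perp Y X).
Proof.
move=> R S.
have eE : euler (repdim Y) (repdim X) = euler (repdim G) (repdim V).
  by rewrite (eq_euler (realization_dim S) (realization_dim R)) euler_realized.
split=> P; have e0 := euler_Perp P; have [h0 _] := P.
  have h : hom_vanishes Y X.
    move=> f /is_homE Hf.
    have [|g [H Hg]] := @realization_full _ _ _ _ _ _ schurT homT c_indep sg sgP _ _ _ _
      S R f (fun phi => 0).
      move=> phi i v; rewrite Hf mul0mx /glue big1 // => j _; rewrite big1 // => w _.
      by rewrite big1 // => e _; rewrite /atw mxE scale0r.
    have g0 := h0 _ (proj2 (is_homE _) Hg).
    move=> a; apply: (rin_inj (R := S)) => i v; rewrite H mul0mx big1 // => w _.
    by rewrite g0 mxE scale0r.
  by split=> //; apply: hom0_euler_ext0 => //; rewrite eE.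
have h : hom_vanishes G V.
  move=> g Hg; have [f Hf] := realizes_exists S R g.
  have f0 := h0 _ (realizes_hom Hf Hg).
  have z : realizes S R (fun i => 0) (fun a => 0).
    move=> i v a; rewrite mul0mx big1 // => w _; by rewrite mxE scale0r.
  exact: (proj2 (realizes_faithful Hf z)).
by split=> //; apply: hom0_euler_ext0 => //; rewrite -eE.
Qed.

(** A simple subobject of [X] is some [T i], and the quotient is realized by induction. The class of
    the extension is cohomologous to a glued cocycle, whose extension is realized over [Sg]. *)
Lemma realization_surj (C : rep k Q -> Prop) : wide C -> (forall i, simple_in C (T i)) ->
  (forall X, simple_in C X -> exists i, isomorphic X (T i)) ->
  forall X, C X -> exists V, inhabited (realization c V X).
Proof.
move=> WC sT cT X; have [n] := ubnP (tdim X); elim: n X => // n IH X le_n CX.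
case: (classic (is_zero X)) => [ZX|NX].
  by exists (zero_rep k Sg); apply: realization_zero.
have [W [f [SW Hf f0]]] := simple_sub WC CX NX.
have [F] := factorization_exists Hf.
have ZK := simple_mono WC F SW CX f0.
have [i iW] := cT W SW.
have iI : isomorphic (T i) (fIm F).
  apply: isomorphic_trans (isomorphic_sym iW) _.
  exact: isomorphic_trans (factor_isol F) (extn_zero_sub _ ZK).
have [CW _ _] := SW; have [_ CI CC] := wide_factor WC F CW CX.
have [|V [R]] := IH (fCok F) _ CC.
  rewrite -ltnS (leq_trans _ le_n) // ltnS (factor_tdimr F).
  rewrite -{1}[tdim (fCok F)]add0n ltn_add2r lt0n; apply/eqP => /tdim_eq0 Z.
  by apply: f0; apply: factor_im0 Z.
have [S0] := realization_simp c i; have [S] := realization_iso S0 iI.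
have [h [xi H]] := realization_ext_full c_span sgP R S (feta F).
pose eta' : ext_space (fCok F) (fIm F) := fun phi => feta F phi - cobound h phi.
exists (extn xi).
have [N] : inhabited (realization c (extn xi) (extn eta')).
  apply: (realization_extn (R := R) (S := S)) => phi j v.
  by rewrite /eta' mulmxBl H addrC addKr.
apply: (realization_iso N); apply: isomorphic_sym.
apply: isomorphic_trans (factor_isor F) _.
by apply: (extn_cobound_iso (f := h)) => phi; rewrite /eta' addrC subrK.
Qed.

(** Transparent, because [step_model] reads dimensions off the underlying [realization]. *)
Definition perp_equivalence gs (G : rep k Sg) Y : 
  (forall i, simple_in (perp gs) (T i)) ->
  (forall X, simple_in (perp gs) X -> exists i, isomorphic X (T i)) ->
  realization c G Y -> equivalence (Perp G) (perp (Y :: gs)).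
Proof.
move=> sT cT S.
apply: (@Equivalence _ _ _ (Perp G) (perp (Y :: gs)) (realization c) (@realizes _ _ _ _ _ c)).
- move=> V PV; have [X [R] _] := realization_exists c V; exists X; last by constructor.
  split; first exact/(Perp_realized R S).
  by apply: realized_perp R _ => i; have [] := sT i.
- move=> X [PX CX]; have [V [R]] := realization_surj (wide_perp gs) sT cT CX.
  by exists V; [apply/(Perp_realized R S) | constructor].
- move=> V X U Z R N g Hg; have [f H] := realizes_exists R N g.
  by exists f => //; apply: realizes_hom H Hg.
- move=> V X U Z R N f /is_homE Hf.
  have [|g [H /is_homE Hg]] := @realization_full _ _ _ _ _ _ schurT homT c_indep sg sgP _ _ _ _
    R N f (fun phi => 0); last by exists g.
  move=> phi i v; rewrite Hf mul0mx /glue big1 // => j _; rewrite big1 // => w _.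
  by rewrite big1 // => e _; rewrite /atw mxE scale0r.
- exact: realizes_faithful.
- exact: realizes_comp.
- exact: realizes_id.
- exact: realized_zero.
Defined.

End PerpEquivalence.

(** * Generic representations *)

Section PolynomialFunctions.
Variables (k : closedFieldType) (X : Type) (I : finType) (c : X -> I -> k).

Definition polyfun (F : X -> k) : Prop :=
  exists p : {mpoly k[#|I|]}, forall x, p.@[fun i => c x (enum_val i)] = F x.

Lemma polyfun_const a : polyfun (fun=> a).
Proof. by exists a%:MP => x; rewrite mevalC. Qed.

Lemma polyfun_coord i : polyfun (fun x => c x i).
Proof. by exists 'X_(enum_rank i) => x; rewrite mevalXU enum_rankK. Qed.

Lemma polyfunD F G : polyfun F -> polyfun G -> polyfun (fun x => F x + G x).
Proof. by move=> [p Hp] [q Hq]; exists (p + q) => x; rewrite mevalD Hp Hq. Qed.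

Lemma polyfunM F G : polyfun F -> polyfun G -> polyfun (fun x => F x * G x).
Proof. by move=> [p Hp] [q Hq]; exists (p * q) => x; rewrite mevalM Hp Hq. Qed.

Lemma eq_polyfun F G : F =1 G -> polyfun F -> polyfun G.
Proof. by move=> E [p Hp]; exists p => x; rewrite Hp. Qed.

Lemma polyfunN F : polyfun F -> polyfun (fun x => - F x).
Proof.
move=> HF; apply: (eq_polyfun (F := fun x => -1 * F x)) => [x|]; first by rewrite mulN1r.
exact: polyfunM (polyfun_const _) HF.
Qed.

Lemma polyfun_sum J (s : seq J) (F : J -> X -> k) :
  (forall j, polyfun (F j)) -> polyfun (fun x => \sum_(j <- s) F j x).
Proof.
move=> H; elim: s => [|j s IH].
  by apply: eq_polyfun (polyfun_const 0) => x; rewrite big_nil.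
by apply: eq_polyfun (polyfunD (H j) IH) => x; rewrite big_cons.
Qed.

Lemma polyfun_prod J (s : seq J) (F : J -> X -> k) :
  (forall j, polyfun (F j)) -> polyfun (fun x => \prod_(j <- s) F j x).
Proof.
move=> H; elim: s => [|j s IH].
  by apply: eq_polyfun (polyfun_const 1) => x; rewrite big_nil.
by apply: eq_polyfun (polyfunM (H j) IH) => x; rewrite big_cons.
Qed.

Definition polymx m n (M : X -> 'M[k]_(m, n)) := forall i j, polyfun (fun x => M x i j).

Lemma polymx_const m n (M : 'M[k]_(m, n)) : polymx (fun=> M).
Proof. by move=> i j; apply: polyfun_const. Qed.

Lemma polymxB m n (M N : X -> 'M[k]_(m, n)) :
  polymx M -> polymx N -> polymx (fun x => M x - N x).
Proof.
move=> HM HN i j; apply: eq_polyfun (polyfunD (HM i j) (polyfunN (HN i j))) => x.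
by rewrite !mxE.
Qed.

Lemma polymxM m n p (M : X -> 'M[k]_(m, n)) (N : X -> 'M[k]_(n, p)) :
  polymx M -> polymx N -> polymx (fun x => M x *m N x).
Proof.
move=> HM HN i j.
apply: eq_polyfun (polyfun_sum (index_enum _) (fun l => polyfunM (HM i l) (HN l j))) => x.
by rewrite mxE.
Qed.

Lemma polymxZ m n F (M : X -> 'M[k]_(m, n)) :
  polyfun F -> polymx M -> polymx (fun x => F x *: M x).
Proof.
by move=> HF HM i j; apply: eq_polyfun (polyfunM HF (HM i j)) => x; rewrite mxE.
Qed.

Lemma polyfun_det n (M : X -> 'M[k]_n) : polymx M -> polyfun (fun x => \det (M x)).
Proof.
move=> HM; apply: polyfun_sum => s; apply: polyfunM; first exact: polyfun_const.
exact: polyfun_prod.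
Qed.

Lemma polymx_adj n (M : X -> 'M[k]_n) : polymx M -> polymx (fun x => \adj (M x)).
Proof.
move=> HM i j.
apply: (eq_polyfun (F := fun x => cofactor (M x) j i)) => [x|]; first by rewrite mxE.
apply: polyfunM; first exact: polyfun_const.
by apply: polyfun_det => u v; apply: eq_polyfun (HM (lift j u) (lift i v)) => x; rewrite !mxE.
Qed.

Definition affine_coord : Prop := forall y : I -> k, exists x, forall i, c x i = y i.

(* Two non-empty open sets meet: restrict both polynomials to the line through a
   point of each. *)
Lemma generically_meet (P : X -> Prop) F x1 : affine_coord -> generically c P ->
  polyfun F -> F x1 != 0 -> exists2 x, P x & F x != 0.
Proof.
move=> surj [U [[Fam HU] [x0 Ux0] UP]] [q Hq] F1.
have [p Fp p0] := proj1 (HU x0) Ux0.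
pose a (i : 'I_#|I|) := c x0 (enum_val i).
pose b (i : 'I_#|I|) := c x1 (enum_val i) - a i.
have line (g : {mpoly k[#|I|]}) : exists u : {poly k}, forall t, u.[t] = g.@[fun i => a i + t * b i].
  exists (\sum_(mn <- msupp g) (g@_mn)%:P * \prod_i ((a i)%:P + 'X * (b i)%:P) ^+ mn i) => t.
  rewrite mevalE horner_sum; apply: eq_bigr => mn _.
  rewrite hornerM hornerC horner_prod; congr (_ * _); apply: eq_bigr => i _.
  by rewrite horner_exp !hornerE.
have [[up Hup] [uq Huq]] := (line p, line q).
have eq_meval (g : {mpoly k[#|I|]}) v w : v =1 w -> g.@[v] = g.@[w].
  by move=> E; rewrite !mevalE; apply: eq_bigr => mn _; congr (_ * _); apply: eq_bigr => i _; rewrite E.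
have up0 : up != 0.
  apply: contraNneq p0 => E; rewrite -(eq_meval p (fun i => a i + 0 * b i)) => [|i].
    by rewrite -Hup E horner0.
  by rewrite mul0r addr0.
have uq0 : uq != 0.
  apply: contraNneq F1 => E; rewrite -Hq -(eq_meval q (fun i => a i + 1 * b i)) => [|i].
    by rewrite -Huq E horner0.
  by rewrite mul1r addrC subrK.
(* An algebraically closed field is infinite, so a non-zero polynomial has a non-root. *)
have : up * uq != 0 by rewrite mulf_neq0.
move/closed_nonrootP => [t]; rewrite rootM negb_or /root Hup Huq => /andP [pt qt].
have [x Hx] := surj (fun i => a (enum_rank i) + t * b (enum_rank i)).
have E g : g.@[fun i => c x (enum_val i)] = g.@[fun i => a i + t * b i].
  by apply: eq_meval => i; rewrite Hx enum_valK.
exists x; last by rewrite -Hq E.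
by apply: UP; apply/HU; exists p; rewrite // E.
Qed.

Lemma generically_polyfun (P : X -> Prop) F x0 : polyfun F -> F x0 != 0 ->
  (forall x, F x != 0 -> P x) -> generically c P.
Proof.
move=> [p Hp] F0 H; exists (fun x => F x != 0); split; [|by exists x0|exact: H].
exists (eq p) => x; split=> [Fx|[q <-]]; last by rewrite Hp.
by exists p; rewrite ?Hp.
Qed.

End PolynomialFunctions.

(** * Open orbits of exceptional representations *)

Section Orbits.
Variables (k : closedFieldType) (Q : quiver).

(* For [V] near [S] the equivariant polynomial family
     det(D) id - id Phi(V) adj(D) Z,   D = Z Phi(V),   Z Phi(S) = 1,
   consists of homomorphisms from [S] to [V], and equals [id] at [V = S]. *)
Lemma exceptional_orbit (X : Type) (I : finType) (c : X -> I -> k) (S : rep k Q)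
    (v : X -> repSpace k (repdim S)) :
  ext0 S S -> (forall phi, polymx c (fun x => v x phi)) ->
  exists F, [/\ polyfun c F, forall x, F x != 0 -> isomorphic S (Rep (v x))
    & forall x, (forall phi, v x phi = arr S phi) -> F x != 0].
Proof.
move=> /ext0P e0 pv.
pose nf := #|mx_entries (repdim S) (repdim S)|.
pose ne := #|mx_entries (fun phi : Q1 Q => repdim S (hd phi)) (fun phi => repdim S (tl phi))|.
pose Phi x : 'M[k]_(nf, ne) := cobound_mx S (Rep (v x)).
(* The vanishing of Ext([S], [S]) means that [cobound_mx S S] has full column rank, hence a left
   inverse. *)
have [Z HZ] : exists Z : 'M[k]_(ne, nf), Z *m (cobound_mx S S : 'M_(nf, ne)) = 1%:M.
  by apply/row_fullP; rewrite -col_leq_rank -subn_eq0; apply/eqP.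
pose w : 'rV[k]_nf := enc (@fam_id k Q S).
pose D x : 'M[k]_ne := Z *m Phi x.
pose f x : 'rV[k]_nf := \det (D x) *: w - w *m Phi x *m \adj (D x) *m Z.
have fPhi x : f x *m Phi x = 0.
  rewrite /f mulmxBl -scalemxAl -!mulmxA -/(D x) mul_adj_mx mul_mx_scalar -scalemxAr.
  by rewrite subrr.
have pPhi : polymx c Phi.
  move=> i j; pose g := dec (p := repdim S) (q := repdim S) (delta_mx 0 i : 'rV[k]__).
  pose phi := tag (enum_val j); pose yz := tagged (enum_val j).
  apply: (eq_polyfun (F := fun x => (g (hd phi) *m arr S phi - v x phi *m g (tl phi)) yz.1 yz.2)).
    by move=> x; rewrite [RHS]mxE [RHS]mxE.
  exact: (polymxB (polymx_const _ _) (polymxM (pv phi) (polymx_const _ _))).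
have pf : polymx c f.
  have pD : polymx c D by apply: polymxM => //; apply: polymx_const.
  apply: polymxB; first by apply: polymxZ; [apply: polyfun_det | apply: polymx_const].
  apply: polymxM; last exact: polymx_const.
  apply: polymxM; last exact: polymx_adj.
  by apply: polymxM => //; apply: polymx_const.
pose fd x a : 'M[k]_(repdim S a) := dec (p := repdim S) (q := repdim S) (f x) a.
(* The homomorphism is invertible exactly where no vertex has zero determinant. *)
exists (fun x => \prod_a \det (fd x a)); split.
- apply: polyfun_prod => a; apply: polyfun_det => y z.
  apply: (eq_polyfun (F := fun x => f x 0 (enum_rank
    (Tagged (fun a => ('I_(repdim S a) * 'I_(repdim S a))%type) (y, z))))) => [x|].
    by rewrite [RHS]mxE.
  exact: pf.
- move=> x /prodf_neq0 dn; exists (fd x : fam S (Rep (v x))); apply/is_isoP; split.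
    apply/is_homE => phi.
    by rewrite -(encK (cobound _) phi) -mul_cobound_mx fPhi dec0.
  exists (fun a => invmx (fd x a)) => a.
  have u : fd x a \in unitmx by rewrite unitmxE unitfE dn.
  by rewrite mulVmx // mulmxV.
- move=> x vx; have PhiE : Phi x = cobound_mx S S.
    by apply/matrixP => i j; rewrite !mxE /cobound /= vx.
  have wPhi : w *m cobound_mx S S = 0.
    rewrite mul_cobound_mx; apply/rowP => j; rewrite [LHS]mxE [RHS]mxE.
    by rewrite /cobound !encK mul1mx mulmx1 subrr mxE.
  have fE : f x = w by rewrite /f /D PhiE HZ det1 scale1r wPhi !mul0mx subr0.
  rewrite prodf_seq_neq0; apply/allP => a _ /=.
  by rewrite /fd fE encK det1 oner_neq0.
Qed.

Lemma affine_rep_coord (al : dimvec Q) : affine_coord (@rep_coord k Q al).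
Proof.
move=> y; exists (fun phi => \matrix_(i, j) y (Tagged _ (i, j))) => [[phi [i j]]].
by rewrite /rep_coord mxE.
Qed.

Lemma affine_rep_coord2 (al be : dimvec Q) : affine_coord (@rep_coord2 k Q al be).
Proof.
move=> y; have [V HV] := affine_rep_coord (fun e => y (inl e)).
have [W HW] := affine_rep_coord (fun e => y (inr e)).
by exists (V, W) => [[e|e]]; rewrite /= ?HV ?HW.
Qed.

(** The open orbits of [A] and [B] meet the generic set, and perpendicularity is invariant under
    isomorphism. *)
Lemma perpendicular_Perp (A B : rep k Q) : exceptional A -> exceptional B ->
  perpendicular k (repdim A) (repdim B) -> Perp A B.
Proof.
move=> [_ eA] [_ eB] gen.
have [|F [pF isoF F0]] := exceptional_orbit (c := @rep_coord2 k Q (repdim A) (repdim B))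
    (v := fun x => x.1) eA.
  by move=> phi i j; apply: (polyfun_coord _ (inl (Tagged _ (i, j)))).
have [|G [pG isoG G0]] := exceptional_orbit (c := @rep_coord2 k Q (repdim A) (repdim B))
    (v := fun x => x.2) eB.
  by move=> phi i j; apply: (polyfun_coord _ (inr (Tagged _ (i, j)))).
have FG0 : F (@arr _ _ A, @arr _ _ B) * G (@arr _ _ A, @arr _ _ B) != 0.
  by rewrite mulf_neq0 ?F0 ?G0.
have [x [hx /ext_vanishesP ex]] := generically_meet
  (@affine_rep_coord2 _ _) gen (polyfunM pF pG) FG0.
rewrite mulf_eq0 negb_or => /andP [/isoF iA /isoG iB].
have [iA' iB'] := (isomorphic_sym iA, isomorphic_sym iB).
by split; [apply: hom0_isol iA' (hom0_isor iB' hx) | apply: ext0_isol iA' (ext0_isor iB' ex)].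
Qed.

End Orbits.

(** * The procedure *)

Section Procedure.
Variables (k : closedFieldType) (Q : quiver).
Hypothesis acQ : acyclic Q.
Implicit Types (X Y V W G : rep k Q) (gs ts : seq (rep k Q)).

Lemma rperpE (Q' : quiver) (A B : rep k Q') : rperp A B <-> Perp A B.
Proof. by split=> [[h /ext_vanishesP e]|[h e]]; split=> //; apply/ext_vanishesP. Qed.

Lemma Perp_isol (Q' : quiver) (A A' B : rep k Q') : isomorphic A A' -> Perp A B <-> Perp A' B.
Proof.
move=> iso; have iso' := isomorphic_sym iso.
by split=> -[h e]; split; by [apply: hom0_isol h | apply: ext0_isol e].
Qed.

Lemma hom0_self X : hom_vanishes X X -> is_zero X.
Proof.
move=> H a; have := H _ (@is_hom_id k Q X) a; rewrite /fam_id.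
case: (repdim X a) => // n /matrixP /(_ 0 0).
by rewrite !mxE eqxx => /eqP; rewrite oner_eq0.
Qed.

Lemma exists_simple_dims gs : exc gs ->
  exists m (al : 'I_m -> dimvec Q), simple_dims (perp gs) al.
Proof.
move=> E; have [ts [_ sT cT hT _]] := perp_simples acQ E.
exists (size ts), (fun i => repdim (nth (zero_rep k Q) ts i)).
exists (fun i => nth (zero_rep k Q) ts i); split=> // [i|i j iso|V SV].
- exact: sT.
- apply/val_inj; have NZ l : (l < size ts)%N -> ~ is_zero (nth (zero_rep k Q) ts l).
    by move=> /sT [].
  case: (ltngtP i j) => // lt.
    case: (NZ j (ltn_ord j)); apply: hom0_self; apply: (hom0_isol iso); apply: hT.
    by rewrite lt ltn_ord.
  case: (NZ i (ltn_ord i)); apply: hom0_self; apply: (hom0_isol (isomorphic_sym iso)).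
  by apply: hT; rewrite lt ltn_ord.
- by have [i lt_i iso] := cT V SV; exists (Ordinal lt_i).
Qed.

(** Simple objects are unique up to isomorphism and order, so the count and the ordering come from
    [perp_simples]; [sg] is the position in that list. *)
Lemma simple_dims_model gs m (al : 'I_m -> dimvec Q) : exc gs -> simple_dims (perp gs) al ->
  (m + size gs = #|Q0 Q|)%N /\
  exists (T : 'I_m -> rep k Q) (sg : 'I_m -> nat), [/\
    forall i, simple_in (perp gs) (T i),
    forall V, simple_in (perp gs) V -> exists i, isomorphic V (T i),
    forall i, repdim (T i) =1 al i,
    forall i j, i != j -> hom_vanishes (T i) (T j)
    & forall i j, ~ ext0 (T i) (T j) -> (sg j < sg i)%N].
Proof.
move=> E [T [sT uT cT dT]]; have [ts [sz sts cts hts ets]] := perp_simples acQ E.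
have [sg Hsg] := fin_all_exists (fun i => let: ex_intro2 j lt iso := cts _ (sT i) in
  ex_intro (fun j => (j < size ts)%N /\ isomorphic (T i) (nth (zero_rep k Q) ts j)) j (conj lt iso)).
have [tau Htau] := fin_all_exists (fun j : 'I_(size ts) => cT _ (sts j (ltn_ord j))).
have tau_inj : injective tau.
  move=> i j ij; have iso : isomorphic (nth (zero_rep k Q) ts i) (nth (zero_rep k Q) ts j).
    by apply: isomorphic_trans (Htau i) _; rewrite ij; apply/isomorphic_sym/Htau.
  apply/val_inj; case: (ltngtP i j) => // lt.
    have [_ NZ _] := sts j (ltn_ord j).
    by case: NZ; apply: hom0_self; apply: (hom0_isol iso); apply: hts; rewrite lt ltn_ord.
  have [_ NZ _] := sts i (ltn_ord i).
  by case: NZ; apply: hom0_self; apply: (hom0_isol (isomorphic_sym iso)); apply: hts; rewrite lt ltn_ord.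
have sg_inj : injective (fun i => Ordinal (proj1 (Hsg i))).
  move=> i j [ij]; apply: uT; apply: isomorphic_trans (proj2 (Hsg i)) _.
  by rewrite ij; apply/isomorphic_sym; have [] := Hsg j.
split.
  rewrite -sz; congr (_ + _)%N; apply/eqP; rewrite eqn_leq.
  have := leq_card _ sg_inj; have := leq_card _ tau_inj; rewrite !card_ord => -> ->.
  by [].
exists T, sg; split=> // [i j nij|i j ne].
- by apply: (simple_hom0 (wide_perp gs)) => // /uT ij; rewrite ij eqxx in nij.
- rewrite ltnNge; apply/negP => le; apply: ne.
  apply: (ext0_isol (isomorphic_sym (proj2 (Hsg i)))).
  apply: (ext0_isor (isomorphic_sym (proj2 (Hsg j)))).
  by apply: ets; rewrite le; case: (Hsg j).
Qed.

Lemma ext_basis_dim (A B : rep k Q) n : edim A B = n -> exists c : 'I_n -> ext_space A B,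
  (forall f lam, (forall phi, cobound f phi = \sum_e lam e *: c e phi) ->
     forall e, lam e = 0) /\
  (forall eta : ext_space A B, exists f lam, forall phi,
     eta phi = cobound f phi + \sum_e lam e *: c e phi).
Proof. by move=> <-; apply: ext_basis. Qed.

Section OneStep.
Variables (gs : seq (rep k Q)) (Y : rep k Q) (m : nat) (al : 'I_m -> dimvec Q).
Hypothesis EY : exc (Y :: gs).
Hypothesis sal : simple_dims (perp gs) al.

Lemma euler_simple (T : 'I_m -> rep k Q) :
  (forall i, simple_in (perp gs) (T i)) ->
  (forall i j, i != j -> hom_vanishes (T i) (T j)) ->
  forall i j, (edim (T i) (T j))%:Z = (i == j)%:Z - euler (repdim (T i)) (repdim (T j)).
Proof.
move=> sT hT i j; rewrite (euler_hdim (T i) (T j)).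
case: (eqVneq i j) => [<-|nij].
  by rewrite (schur_hdim (simple_schur (wide_perp gs) (sT i))) opprB addrC subrK.
by rewrite (proj1 (hom_vanishesP _ _) (hT i j nij)) !sub0r opprK.
Qed.

(** Paired with [T j], only [al j], with value 1, and vectors of smaller [sg] contribute, so the
    coefficients are determined one after the other. *)
Lemma simple_dims_indep (x y : 'I_m -> nat) :
  (forall a, \sum_i x i * al i a = \sum_i y i * al i a)%N -> x =1 y.
Proof.
have [_ _ E] := EY; have [_ [T [sg [sT cT dT hT eT]]]] := simple_dims_model E sal.
move=> xy j; have [n] := ubnP (sg j); elim: n j => // n IH j le_n.
have xyE : \sum_i (x i)%:Z * euler (repdim (T j)) (al i) =
    \sum_i (y i)%:Z * euler (repdim (T j)) (al i).
  by rewrite -!euler_sumr; apply: eq_euler.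
have eTT i : euler (repdim (T j)) (al i) = (j == i)%:Z - (edim (T j) (T i))%:Z.
  by rewrite (euler_simple sT hT) opprB addrC subrK; apply: eq_euler => // a; rewrite dT.
have jj : euler (repdim (T j)) (al j) = 1.
  rewrite eTT eqxx; suff /ext0P -> : ext0 (T j) (T j) by rewrite subr0.
  by apply: NNPP => /eT; rewrite ltnn.
apply/eqP; rewrite -eqz_nat; apply/eqP.
move: xyE; rewrite (bigD1 j) //= [RHS](bigD1 j) //= jj !mulr1.
rewrite [X in _ = _ + X](eq_bigr (fun i => (x i)%:Z * euler (repdim (T j)) (al i))).
  by move/addIr.
move=> i ni; rewrite eTT; case: (classic (ext0 (T j) (T i))) => [/ext0P ->|/eT lt].
  by rewrite eq_sym (negPf ni) subr0 !mulr0.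
by rewrite IH // -ltnS (leq_trans _ le_n).
Qed.

(** The prescribed number of arrows is the dimension of Ext([T i], [T j]), so bases of these groups
    can be indexed by arrows; [G] is the object whose realization is [Y]. *)
Lemma step_model (r : 'I_m -> 'I_m -> nat) :
  (forall i j, (r i j)%:Z = (i == j)%:Z - euler (al i) (al j)) ->
  exists (G : rep k (arrows_quiver r)) (E : equivalence (Perp G) (perp (Y :: gs))),
  [/\ exceptional G, forall a, repdim Y a = (\sum_(i < m) repdim G i * al i a)%N
    & forall U X, inhabited (eqo E U X) -> forall a,
        repdim X a = (\sum_(i < m) repdim U i * al i a)%N].
Proof.
move=> rP; have [XY CY Egs] := EY.
have [_ [T [sg [sT cT dT hT eT]]]] := simple_dims_model Egs sal.
have rT i j : (r i j)%:Z = (i == j)%:Z - euler (repdim (T i)) (repdim (T j)).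
  by rewrite rP; congr (_ - _); apply: eq_euler => a; rewrite dT.
have er i j : edim (T i) (T j) = r i j.
  by apply/eqP; rewrite -eqz_nat rT (euler_simple sT hT).
have [c Hc] := fin_all_exists (fun i => fin_all_exists (fun j => ext_basis_dim (er i j))).
have c_indep i j := proj1 (Hc i j); have c_span i j := proj2 (Hc i j).
have schurT i := simple_schur (wide_perp gs) (sT i).
have sgP i j : 'I_(r i j) -> (sg j < sg i)%N.
  by move=> e; apply: eT => /ext0P; rewrite er => r0; move: e; rewrite r0; case.
have [G [R]] := realization_surj c_span sgP (wide_perp gs) sT cT CY.
have dimE U X : realization c U X -> forall a, repdim X a = (\sum_(i < m) repdim U i * al i a)%N.
  move=> S a; rewrite (realization_dim S); apply: eq_bigr => i _.
  by rewrite dT.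
exists G, (perp_equivalence rT schurT hT c_indep c_span sgP sT cT R); split.
- have eG : euler (repdim G) (repdim G) = 1.
    rewrite -(euler_realized rT) -(euler_exceptional XY).
    by apply: eq_euler => a; rewrite (realization_dim R).
  apply: schur_exceptional => //; split.
    by move/(realized_zero schurT R); have [[]] := XY.
  move=> g Hg; have [f Hf] := realizes_exists R R g.
  have [_ S] := proj1 XY; have [x fx] := S f (realizes_hom Hf Hg).
  exists x; apply: (proj2 (realizes_faithful schurT Hf (f' := fun a => x%:M) _)) => //.
  move=> i v a; rewrite mul_scalar_mx (bigD1 v) //= mxE eqxx mulr1n big1 ?addr0 // => w nw.
  by rewrite mxE (negPf nw) scale0r.
- exact: dimE R.
- by move=> V X [S]; apply: dimE S.
Qed.

(** The numbers of arrows are dimensions of Ext groups and the coefficients of [repdim Y] are those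
    of [repdim G], so none is negative. *)
Lemma step_exists : exists m' (al' : 'I_m' -> dimvec Q), step k (repdim Y) al al'.
Proof.
have [XY CY Egs] := EY.
have [_ [T [sg [sT cT dT hT eT]]]] := simple_dims_model Egs sal.
have rP i j : (edim (T i) (T j))%:Z = (i == j)%:Z - euler (al i) (al j).
  by rewrite (euler_simple sT hT); congr (_ - _); apply: eq_euler => a; rewrite dT.
have [G [E [[_ eG] dY dE]]] := step_model rP.
have [m' [be sbe]] := exists_simple_dims EY.
have [albar sbar _] := equivalence_simple_dims (equivalence_sym E) sbe.
exists m', (fun j a => \sum_(i < m) albar j i * al i a)%N.
exists (fun i j => edim (T i) (T j)), (repdim G), albar; split=> //.
have [|F [pF isoF F0]] := exceptional_orbit (c := @rep_coord k _ (repdim G)) (v := id) eG.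
  by move=> phi i j; apply: (polyfun_coord _ (Tagged _ (i, j))).
apply: (generically_polyfun (F := F) (x0 := @arr _ _ G)) => // [|V /isoF iso].
  exact: F0.
apply: simple_dims_ext sbar => // U.
by rewrite rperpE; apply: Perp_isol.
Qed.

(** The generic representation of the procedure can be taken in the open orbit of [G]; the simple
    objects are then carried over by the equivalence. *)
Lemma step_correct m' (al' : 'I_m' -> dimvec Q) :
  step k (repdim Y) al al' -> simple_dims (perp (Y :: gs)) al'.
Proof.
move=> [r [ga [albar [rP dga gen al'E]]]].
have [G [E [[_ eG] dY dE]]] := step_model rP.
have gaE : repdim G = ga.
  (* Dimension vectors index the types of representations, so [ga] must be replaced by an equal
     function, not just a pointwise equal one. *)
  apply: functional_extensionality; apply: simple_dims_indep => a.
  by rewrite -dY dga.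
subst ga.
have [|F [pF isoF F0]] := exceptional_orbit (c := @rep_coord k _ (repdim G)) (v := id) eG.
  by move=> phi i j; apply: (polyfun_coord _ (Tagged _ (i, j))).
have [V sV /isoF iso] := generically_meet (@affine_rep_coord k _ (repdim G)) gen pF
  (F0 _ (fun phi => erefl)).
have sG : simple_dims (Perp G) albar.
  apply: simple_dims_ext sV => // U.
  by rewrite rperpE; apply: Perp_isol; apply: isomorphic_sym.
have [be sbe H] := equivalence_simple_dims E sG.
apply: simple_dims_ext sbe => // j a.
have [U [X [R dU dX]]] := H j; rewrite -dX (dE _ _ R) al'E.
by apply: eq_bigr => i _; rewrite dU.
Qed.

End OneStep.

End Procedure.

(** * Perpendicular categories of direct sums *)

Section PerpDirectSum.
Variables (k : closedFieldType) (Q : quiver).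
Implicit Types (A B V : rep k Q).

Lemma Perp_zero V : Perp (zero_rep k Q) V.
Proof. by split; [apply: is_zero_hom0l | apply: is_zero_ext0l]. Qed.

Lemma Perp_dsum A B V : Perp (dsum A B) V <-> Perp A V /\ Perp B V.
Proof.
have -> : dsum A B = @extn k Q A B (fun phi => 0) by [].
split=> [[h e]|[[hA eA] [hB eB]]]; last by split; [apply: hom0_extnl | apply: ext0_extnl].
have hB := hom0_extn_quo h; have eA := ext0_extn_sub e.
split; split=> //.
  (* The extension is split, so maps on the summand [A] extend by zero. *)
  move=> f Hf a; pose F : fam (@extn k Q A B (fun=> 0)) V := fun a => row_mx (f a) 0.
  have HF : is_hom F by move=> phi; rewrite /F /= !blockE Hf.
  by have := h F HF a; rewrite -row_mx0 => /eq_row_mx [].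
move=> xi; have [f Hf] := e (fun phi => row_mx 0 (xi phi)).
exists (fun a => rsubmx (f a)) => phi.
by have := Hf phi; rewrite coboundl mulmx0 add0r => /eq_row_mx [].
Qed.

Lemma Perp_multiple n A V : (0 < n)%N -> Perp (multiple n A) V <-> Perp A V.
Proof.
elim: n => // [[|n]] IH _; rewrite [multiple _ _]iterS Perp_dsum.
  by split=> [[]|] //; split=> //; apply: Perp_zero.
by rewrite (IH isT); split=> [[]|].
Qed.

Lemma Perp_bigsum (I : eqType) (s : seq I) (M : I -> rep k Q) V :
  Perp (\big[@dsum k Q / zero_rep k Q]_(i <- s) M i) V <->
  forall i, i \in s -> Perp (M i) V.
Proof.
elim: s => [|i s IH]; first by rewrite big_nil; split=> // _; apply: Perp_zero.
rewrite big_cons Perp_dsum IH; split=> [[P0 P1] j|H].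
  by rewrite inE => /predU1P [->|/P1].
by split=> [|j js]; apply: H; rewrite inE ?eqxx // js orbT.
Qed.

Lemma perp_map (I : eqType) (s : seq I) (S : I -> rep k Q) V :
  perp (map S s) V <-> forall i, i \in s -> Perp (S i) V.
Proof.
elim: s => [|i s IH] //=; rewrite IH; split=> [[P0 P1] j|H].
  by rewrite inE => /predU1P [->|/P1].
by split=> [|j js]; apply: H; rewrite inE ?eqxx // js orbT.
Qed.

End PerpDirectSum.

(** * The loop invariant *)

Section RootSequence.
Variables (k : closedFieldType) (Q : quiver) (t : nat) (S : 'I_t -> rep k Q).
Hypothesis acQ : acyclic Q.
Hypothesis excS : forall i, exceptional (S i).
Hypothesis perpS : forall i j : 'I_t, (i < j)%N -> Perp (S i) (S j).

(** Reversed because [exc] expects the latest member, which is right perpendicular to all earlier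
    ones, at the head. *)
Definition passed n : seq (rep k Q) := map S (rev (take n (enum 'I_t))).

Lemma passedS (i : 'I_t) : passed i.+1 = S i :: passed i.
Proof.
by rewrite /passed (take_nth i) ?size_enum_ord // nth_ord_enum rev_rcons.
Qed.

Lemma perp_passed n V : perp (passed n) V <-> forall i : 'I_t, (i < n)%N -> Perp (S i) V.
Proof.
rewrite perp_map; split=> H i; last by rewrite mem_rev in_take ?mem_enum // index_enum_ord; apply: H.
by move=> lt_i; apply: H; rewrite mem_rev in_take ?mem_enum // index_enum_ord.
Qed.

Lemma exc_passed n : (n <= t)%N -> exc (passed n).
Proof.
elim: n => [|n IH] lt_n; first by rewrite /passed take0.
have := passedS (Ordinal lt_n) => /= ->; split; first exact: excS.
  by apply/perp_passed => i lt_i; apply: perpS.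
exact/IH/ltnW.
Qed.

Lemma size_passed n : (n <= t)%N -> size (passed n) = n.
Proof. by move=> le_n; rewrite size_map size_rev size_takel // size_enum_ord. Qed.

(** The invariant of the loop: after [n] passes the list describes the simple objects perpendicular
    to the first [n] members. *)
Lemma reached_simple_dims n m (al : 'I_m -> dimvec Q) :
  reached k (fun i => repdim (S i)) n al -> (n <= t)%N /\ simple_dims (perp (passed n)) al.
Proof.
elim=> {n m al} [m al s0|i m al m' al' _ [_ sal] st].
  by split=> //; apply: simple_dims_ext s0 => // V; rewrite /passed take0.
split; first exact: ltn_ord.
have E := exc_passed (ltn_ord i); rewrite passedS in E *.
exact: (step_correct acQ E sal st).
Qed.

End RootSequence.

Close Scope ring_scope.

Theorem mainTheorem2 (k : closedFieldType) (Q : quiver) (t : nat)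
    (S : 'I_t -> rep k Q) (mult : 'I_t -> nat) (W : rep k Q) :
  [pchar k]%R =i pred0 ->
  acyclic Q ->
  (forall i, schur_indecomposable (S i)) ->
  perpendicular_sequence k (fun i => repdim (S i)) ->
  (forall i, real_schur_root k (repdim (S i))) ->
  (forall i, 0 < mult i) ->
  W = \big[@dsum k Q / zero_rep k Q]_(i < t) multiple (mult i) (S i) ->
  let d := fun i => repdim (S i) in
  (* the procedure starts, and no pass ever gets stuck *)
  (exists (m : nat) (al : 'I_m -> dimvec Q), reached k d 0 al) /\
  (forall (i : 'I_t) (m : nat) (al : 'I_m -> dimvec Q), reached k d i al ->
     exists (m' : nat) (al' : 'I_m' -> dimvec Q), step k (d i) al al') /\
  (* after i passes the list has n - i entries *)
  (forall (i m : nat) (al : 'I_m -> dimvec Q), reached k d i al ->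
     m + i = #|Q0 Q|) /\
  (* whatever is returned after the last pass is correct *)
  (forall (m : nat) (al : 'I_m -> dimvec Q), reached k d t al ->
     simple_dims (rperp W) al).
Proof.
move=> _ acQ schurS [_ perpS] realS mult0 WE d.
have excS i : exceptional (S i) by apply: schur_exceptional => //; case: (realS i).
have PS (i j : 'I_t) : i < j -> Perp (S i) (S j).
  by move=> lt; apply: perpendicular_Perp => //; apply: perpS.
split; [|split; [|split]].
(* For the empty sequence the perpendicular category is the whole category. *)
- have [m [al sal]] := @exists_simple_dims k Q acQ [::] I.
  by exists m, al; apply: (@reached_start k Q t d m al); apply: simple_dims_ext sal.
- move=> i m al /(reached_simple_dims acQ excS PS) [_ sal].
  have := exc_passed excS PS (ltn_ord i); rewrite passedS => E.
  exact: (step_exists acQ E sal).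
- move=> i m al /(reached_simple_dims acQ excS PS) [le_i sal].
  have [sz _] := simple_dims_model acQ (exc_passed excS PS le_i) sal.
  by rewrite -sz size_passed.
- move=> m al /(reached_simple_dims acQ excS PS) [_ sal].
  (* Since all multiplicities are positive, the perpendicular category of [W] is the intersection of
     those of the [S i]. *)
  apply: simple_dims_ext sal => // V; rewrite rperpE perp_passed WE Perp_bigsum.
  split=> H i Hi; first by apply/(Perp_multiple _ _ (mult0 i)); apply: H.
  by apply/(Perp_multiple _ _ (mult0 i)); apply: H; rewrite mem_index_enum.
Qed.
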